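(* Let $\Gamma$ be a strongly regular graph with parameters $(99,14,1,2)$ and let $G=\mathrm{Aut}(\Gamma)$ be its full automorphism group. Then: (a) If $2$ divides $|G|$, then $|G|$ divides $6$. (b) If $7$ divides $|G|$, then $G$ is isomorphic to either $\mathbb Z_7$ or $Frob(21)$.
   Context: A strongly regular graph with parameters $(v,k,\lambda,\mu)$ is a simple $k$-regular graph on $v$ vertices in which any two adjacent vertices have exactly $\lambda$ common neighbors and any two distinct nonadjacent vertices have exactly $\mu$ common neighbors. $Frob(21)$ denotes the Frobenius group of order $21$, i.e. the nonabelian group $\mathbb Z_7\rtimes\mathbb Z_3$ of order $21$ (the index $2$ subgroup of $\mathbb Z_7\rtimes\mathrm{Aut}(\mathbb Z_7)$). *)

(* Defs.v *)
From HB Require Import structures.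
From mathcomp Require Import all_boot all_algebra all_fingroup all_solvable.

Set Implicit Arguments.
Unset Strict Implicit.
Unset Printing Implicit Defensive.

Import GroupScope.

Section Graphs.

Variable T : finType.

Definition neighbours (e : rel T) (x : T) : {set T} := [set y | e x y].

Definition strongly_regular (e : rel T) (v k lambda mu : nat) : Prop :=
  [/\ symmetric e /\ irreflexive e,
      #|T| = v,
      forall x, #|neighbours e x| = k,
      forall x y, e x y -> #|neighbours e x :&: neighbours e y| = lambda
    & forall x y, x != y -> ~~ e x y ->
        #|neighbours e x :&: neighbours e y| = mu].

Definition graph_aut (e : rel T) : {set {perm T}} :=
  [set s : {perm T} | [forall x, forall y, e (s x) (s y) == e x y]].

Lemma graph_autP (e : rel T) (s : {perm T}) :
  reflect (forall x y, e (s x) (s y) = e x y) (s \in graph_aut e).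
Proof.
rewrite inE; apply: (iffP forallP) => [sP x y | sP x].
  by apply/eqP; move/forallP: (sP x).
by apply/forallP=> y; rewrite sP.
Qed.

Lemma graph_aut_group_set (e : rel T) : group_set (graph_aut e).
Proof.
apply/group_setP; split=> [|s t /graph_autP sP /graph_autP tP].
  by apply/graph_autP=> x y; rewrite !perm1.
by apply/graph_autP=> x y; rewrite !permM tP sP.
Qed.

Canonical graph_aut_group (e : rel T) : {group {perm T}} :=
  Group (graph_aut_group_set e).

End Graphs.

(* The holomorph Z_7 ><| Aut(Z_7); 'Z_7 carries its additive group law. *)
Definition hol7 : finGroupType := sdprod_by [Aut [set: 'Z_7]]%gact.

(* The subgroup generated by the squares. The next two lemmas show that it is
   the only subgroup of index 2 of hol7. *)
Definition Frob21 : {group hol7} := <<[set x ^+ 2 | x : hol7]>>%G.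

Lemma Frob21_sub_index2 (H : {group hol7}) :
  #|[set: hol7] : H| = 2 -> Frob21 \subset H.
Proof.
move=> iH; have /andP[_ nH] := index2_normal (subsetT H) iH.
rewrite gen_subG; apply/subsetP=> _ /imsetP[x _ ->].
have Nx : x \in 'N(H) by apply: (subsetP nH); rewrite inE.
apply: coset_idr; first by rewrite groupX.
rewrite morphX //; apply/eqP; rewrite -order_dvdn.
have <- : #|[set: hol7] / H| = 2 by rewrite card_quotient.
by apply: order_dvdG; rewrite mem_quotient ?inE.
Qed.

Lemma Frob21_index : #|[set: hol7] : Frob21| = 2.
Proof.
pose to := [Aut [set: 'Z_7]]%gact.
have defG := sdprod_sdpair to.
set X := sdpair1 to @* _ in defG; set A := sdpair2 to @* _ in defG.
have oZ : #|[set: 'Z_7]| = 7 by rewrite cardsT card_ord.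
have cA : cyclic (Aut [set: 'Z_7]) by rewrite Aut_prime_cyclic ?oZ.
have oAut : #|Aut [set: 'Z_7]| = 6.
  by rewrite card_Aut_cyclic ?oZ // prime_cyclic ?oZ.
have oX : #|X| = 7 by rewrite card_injm ?injm_sdpair1.
have oA : #|A| = 6 by rewrite card_injm ?injm_sdpair2.
have /cyclicP[a Aa] : cyclic A by rewrite morphim_cyclic.
have oa : #[a] = 6 by rewrite orderE -Aa.
have [nsX sAG defXA nXA tiXA] := sdprod_context defG.
have oG : #|[set: hol7]| = 42 by rewrite -(sdprod_card defG) oX oA.
have sKA : <[a ^+ 2]> \subset A by rewrite Aa cycleX.
have oK : #|<[a ^+ 2]>| = 3 by rewrite -orderE orderXdiv oa.
have oH : #|X <*> <[a ^+ 2]>| = 21.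
  rewrite norm_joinEr ?(subset_trans sKA) // TI_cardMg ?oX ?oK //.
  by apply/trivgP; rewrite -tiXA setIS.
have iH : #|[set: hol7] : (X <*> <[a ^+ 2]>)%G| = 2.
  by rewrite -divgS ?subsetT //= oG oH.
have sFH := Frob21_sub_index2 iH.
suff -> : Frob21 :=: (X <*> <[a ^+ 2]>)%G by [].
apply/eqP; rewrite eqEsubset sFH join_subG cycle_subG /=.
apply/andP; split; last by apply/mem_gen/imset_f.
apply/subsetP=> x Xx.
have x7 : x ^+ 7 = 1 by apply/eqP; rewrite -order_dvdn -oX order_dvdG.
have -> : x = (x ^+ 4) ^+ 2 by rewrite -expgM (expgD x 7 1) x7 mul1g.
by apply/mem_gen/imset_f.
Qed.

Lemma index2_Frob21 (H : {group hol7}) :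
  #|[set: hol7] : H| = 2 -> H :=: Frob21.
Proof.
move=> iH; apply/eqP; rewrite eq_sym eqEcard Frob21_sub_index2 //=.
have oH := Lagrange (subsetT H); have := Lagrange (subsetT Frob21).
by rewrite -oH iH Frob21_index => /eqP; rewrite eqn_pmul2r // => /eqP <-.
Qed.

(* Main.v *)
(* The vertices at distance two from a vertex x correspond to the pairs of
   non-adjacent neighbours of x. For an automorphism g with n fixed vertices, one
   of them x, this gives 2n = f^2 + s + 2, where f counts the fixed neighbours of
   x and s the neighbours that g interchanges with a non-neighbour. Modulo 7 the
   eigenvalues 3 and -4 of the adjacency matrix coincide, and therefore n
   determines the number of vertices y adjacent to g y modulo 7. It follows that
   an automorphism of prime order p has one fixed vertex for p = 2 and 7, none or
   three (a triangle) for p = 3 and none for p = 11, and that no other p occurs.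

   An involution t is central in the stabilizer of its fixed vertex, because it
   interchanges the two ends of each edge among the neighbours, and it is an odd
   permutation. If G has even order, the Frattini argument for the subgroup of
   even permutations provides involutions normalizing Sylow subgroups for
   p = 3, 7, 11. The resulting subgroups of order 14, 18 and 22 do not exist: for
   the cyclic group of order 14 and for the case of order 18 where t inverts the
   normal subgroup W of order 9, the quotient matrix B of the partition into
   orbits satisfies B^2 + B = 12 + 2J, and its possibilities are enumerated.

   If 7 divides |G|, then |G| is odd and the stabilizer H of the fixed vertex of
   an element of order 7 has order 7 or 21 and contains the normalizer of the
   Sylow 7-subgroup. The index of H is congruent to 1 modulo 7, thus 1 or 99, and
   99 would make a Sylow 11-subgroup normal and centralized by the element of
   order 7. *)

Require Import Defs.
From mathcomp Require Import all_boot all_algebra all_fingroup all_solvable.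
From mathcomp Require Import zify.

Import GroupScope.

Set Implicit Arguments.
Unset Strict Implicit.
Unset Printing Implicit Defensive.

(** * Group actions and equitable partitions *)

(** All counts rest on the identity A^2 + A = 12 + 2J of the adjacency matrix A, and most
    identifications of vertices on lambda = 1: an edge lies in exactly one triangle, so two
    constructions of its third vertex agree. The prime 3 is the main obstacle. The order of a Sylow
    3-subgroup is not bounded beforehand, so a subgroup W of order 9 invariant under the involution
    t is extracted from it, and t can act on W in two ways. If t centralizes some w other than 1,
    then W is generated by w and an element v inverted by t, and the contradiction comes from
    counting how the vertices attach to three fixed triangles. If t inverts W, the enumeration
    leaves one configuration: x has four neighbours in its W-orbit. Then every vertex has, and the
    graph consists of 11 Cayley graphs of valency 4 joined by perfect matchings; a direct count of
    common neighbours refutes it. *)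

Section Counting.

Local Open Scope nat_scope.

Variable T : finType.
Implicit Types (g h : {perm T}) (S : {set T}) (H : {group {perm T}}).

Lemma card_fix_mod (p : nat) g S :
    p.-elt g -> (forall y, y \in S -> g y \in S) ->
  #|S| = #|[set y in S | g y == y]| %[mod p].
Proof.
move=> pg Sg.
have aS : [acts <[g]>, on S | 'P].
  rewrite cycle_subG inE /=; apply/andP; split; first by rewrite inE.
  by rewrite inE; apply/subsetP => y yS; rewrite inE /=; apply: Sg.
rewrite (pgroup_fix_mod pg aS); congr (_ %% _); apply: eq_card => y.
rewrite in_setI [RHS]inE; apply: andb_id2l => _.
apply/idP/eqP => [/afixP/(_ g (cycle_id g)) // | gy].
apply/afixP => a.
case/cycleP=> i ->; elim: i => [|i IHi] /=; first by rewrite expg0 /= /aperm perm1.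
by rewrite expgS /= /aperm permM gy; apply: IHi.
Qed.

(** Meant for maps that are periodic on S only: replaced by the identity outside S, f becomes a
    permutation and [card_fix_mod] applies. *)
Lemma dvdn_card_cyclic_map p (f : T -> T) S :
    prime p -> (forall y, y \in S -> f y \in S) ->
    (forall y, y \in S -> iter p f y = y) ->
    (forall y, y \in S -> f y != y) ->
  p %| #|S|.
Proof.
move=> pp fS fp fn; pose f' y := if y \in S then f y else y.
have it i y : y \in S -> (iter i f y \in S) * (iter i f' y = iter i f y).
  move=> yS; elim: i => [|i [IS IE]] //=; split; first exact: fS.
  by rewrite IE /f' IS.
have f'p y : iter p f' y = y.
  case: (boolP (y \in S)) => yS; first by rewrite it // fp.
  by elim: (p) => //= i ->; rewrite /f' (negPf yS).
have f'inj : injective f'.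
  apply: (can_inj (g := iter p.-1 f')) => y.
  by rewrite -iterSr prednK ?prime_gt0 // f'p.
pose g := perm f'inj.
have gi i y : (g ^+ i)%g y = iter i f' y.
  by rewrite permX; elim: i => //= i ->; rewrite permE.
have pg : p.-elt g.
  apply: (@pnat_dvd _ p); last by rewrite pnat_id.
  rewrite order_dvdn; apply/eqP/permP => y; by rewrite gi f'p perm1.
have gS y : y \in S -> g y \in S by move=> yS; rewrite permE /f' yS fS.
have := card_fix_mod pg gS.
have -> : [set y in S | g y == y] = set0.
  apply/setP => y; rewrite !inE; apply/negP => /andP[yS].
  by rewrite permE /f' yS (negPf (fn _ yS)).
by rewrite cards0 mod0n => /eqP.
Qed.

Lemma card_orbit_free H y :
  (forall h, h \in H -> h y = y -> h = 1%g) -> #|orbit 'P H y| = #|H|.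
Proof.
move=> fr; rewrite /orbit card_in_imset // => g h gH hH /= eq_gh.
apply/eqP; rewrite eq_mulgV1; apply/eqP/fr; first by rewrite groupM ?groupV.
by rewrite permM -[g y]/(aperm y g) eq_gh /aperm permK.
Qed.

Lemma acts_permP H S :
  reflect (forall h y, h \in H -> y \in S -> h y \in S) [acts H, on S | 'P].
Proof.
apply: (iffP idP) => [aS h y hH yS | HS].
  by rewrite -[h y]/(aperm y h) (acts_act aS hH).
apply/subsetP => h hH; rewrite inE /=; apply/andP; split; first by rewrite inE.
by rewrite inE; apply/subsetP => y yS; rewrite inE; apply: HS.
Qed.

(** The representatives form a sequence, not a set, because the orbits become the rows and columns
    of a matrix. *)
Lemma orbit_reps H S :
    (forall h y, h \in H -> y \in S -> h y \in S) ->
  exists X : seq T,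
    [/\ {subset X <= S}, pairwise (fun x y => y \notin orbit 'P H x) X &
        forall F : T -> nat,
          \sum_(y in S) F y = \sum_(r <- X) \sum_(y in orbit 'P H r) F y].
Proof.
have [n] := ubnP #|S|; elim: n S => // n IHn S leSn SH.
case: (set_0Vmem S) => [-> | [x xS]].
  by exists [::]; split=> // F; rewrite big_set0 big_nil.
have oS : orbit 'P H x \subset S.
  by apply/subsetP => _ /imsetP[h hH ->]; apply: SH.
have xo : x \in orbit 'P H x := orbit_refl _ _ _.
have lt' : #|S :\: orbit 'P H x| < n.
  rewrite -ltnS; apply: leq_trans leSn; rewrite ltnS; apply: proper_card.
  by apply/properP; split; [apply: subsetDl | exists x; rewrite // !inE xo].
have SH' h y : h \in H -> y \in S :\: orbit 'P H x -> h y \in S :\: orbit 'P H x.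
  move=> hH; rewrite !inE => /andP[yo yS]; rewrite SH // andbT.
  apply: contra yo => /orbitP[k kH kx]; apply/orbitP.
  exists (k * h^-1)%g; first by rewrite groupM ?groupV.
  by rewrite /= /aperm permM; move: kx; rewrite /= /aperm => ->; rewrite permK.
have [X [XS pX XF]] := IHn _ lt' SH'.
exists (x :: X); split=> [y | | F].
- by rewrite inE => /predU1P[-> // | /XS]; rewrite inE => /andP[].
- by rewrite /= pX andbT; apply/allP => y /XS; rewrite inE => /andP[].
rewrite big_cons -XF (big_setID (orbit 'P H x)) /=.
by rewrite (setIidPr oS).
Qed.

Lemma dvdn_card_free H S :
    (forall h y, h \in H -> y \in S -> h y \in S) ->
    (forall h y, h \in H -> y \in S -> h y = y -> h = 1%g) ->
  #|H| %| #|S|.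
Proof.
move=> HS fr; have [X [XS _ sumX]] := orbit_reps HS.
have := sumX (fun=> 1); rewrite sum1_card => ->; rewrite big_seq; apply: (big_ind (fun n => #|H| %| n)) => [||r /XS rS]; first exact: dvdn0.
  exact: dvdn_add.
by rewrite sum1_card card_orbit_free // => h hH; apply: fr.
Qed.

End Counting.

(** * Exhaustive search for quotient matrices *)

Section QuotientSearch.

Local Open Scope nat_scope.

Fixpoint compositions n k : seq (seq nat) :=
  if k is k'.+1 then
    flatten [seq [seq a :: r | r <- compositions (n - a) k'] | a <- iota 0 n.+1]
  else if n is 0 then [:: [::]] else [::].

Lemma mem_compositions s : s \in compositions (sumn s) (size s).
Proof.
elim: s => // a s IHs; apply/flatten_mapP; exists a.
  by rewrite mem_iota add0n ltnS /= leq_addr.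
by apply/mapP; exists s; rewrite //= addKn.
Qed.

Variable m : seq nat.

Let n := size m.

(** The entry (i, j) of B^2 computed from rows i and j alone: the factor b k j of column j is
    recovered from row j as b j k m_j / m_k. This allows testing a matrix row by row. *)
Definition dot (i j : nat) (r s : seq nat) :=
  sumn (mkseq (fun k => nth 0 r k * ((nth 0 s k * nth 0 m j) %/ nth 0 m k)) n).

(** The conditional keeps call-by-value evaluation from forming products for a row that already
    fails the symmetry test. *)
Definition compatible (pre : seq (seq nat)) (r : seq nat) :=
  let i := size pre in
  if all (fun j => nth 0 m i * nth 0 r j == nth 0 m j * nth 0 (nth [::] pre j) i) (iota 0 i)
  then all (fun j => dot i j r (nth [::] pre j) + nth 0 r j == 2 * nth 0 m j) (iota 0 i)
  else false.

(** The conditions on a row by itself, which filter the candidates before the search. The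
    divisibility makes the quotients in [dot] exact. *)
Definition diagonal_ok (i : nat) (r : seq nat) :=
  (dot i i r r + nth 0 r i == 12 + 2 * nth 0 m i) &&
  all (fun k => nth 0 m k %| nth 0 r k * nth 0 m i) (iota 0 n).

Fixpoint refute (final : pred (seq (seq nat))) (cands : seq (seq (seq nat))) pre :=
  if cands is c :: cs then
    all (fun r => if compatible pre r then refute final cs (rcons pre r) else true) c
  else ~~ final pre.

Lemma refute_sound (final : pred (seq (seq nat))) cands pre rows :
    size rows = size cands ->
    (forall k, k < size rows -> nth [::] rows k \in nth [::] cands k) ->
    (forall k, k < size rows -> compatible (pre ++ take k rows) (nth [::] rows k)) ->
    final (pre ++ rows) ->
  ~~ refute final cands pre.
Proof.
elim: cands pre rows => [|c cs IHc] pre [|r rows] //=.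
  by rewrite cats0 => _ _ _ ->.
move=> [szr] inC comp fin; apply/negP => /allP/(_ r (inC 0 isT)).
have := comp 0 isT; rewrite cats0 /= => -> /=; apply/negP.
apply: (IHc _ rows) => // [k kr|k kr|]; first exact: (inC k.+1).
  by rewrite cat_rcons; apply: (comp k.+1).
by rewrite cat_rcons.
Qed.

(* [b i j] is the number of neighbours in the [j]-th part of a vertex of the
   [i]-th part of an equitable partition whose parts have the sizes [m]. *)
Definition quotient_matrix (b : nat -> nat -> nat) :=
  [/\ forall i, i < n -> \sum_(k < n) b i k = 14,
      forall i j, i < n -> j < n -> nth 0 m i * b i j = nth 0 m j * b j i &
      forall i j, i < n -> j < n ->
        \sum_(k < n) b i k * b k j + b i j = 12 * (i == j) + 2 * nth 0 m j].

(** A genuine quotient matrix passes every test, so a search that returns [true] excludes it. The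
    arguments [extra] and [final] carry what the matrix equations do not express: restrictions on
    single rows and on the complete matrix. *)
Lemma quotient_matrix_refute (b : nat -> nat -> nat) gens
    (extra : nat -> pred (seq nat)) (final : pred (seq (seq nat))) :
    all (leq 1) m -> quotient_matrix b -> size gens = n ->
    (forall i, i < n -> mkseq (b i) n \in nth [::] gens i) ->
    (forall i, i < n -> extra i (mkseq (b i) n)) ->
    final (mkseq (fun i => mkseq (b i) n) n) ->
  ~~ refute final
       (mkseq (fun i => [seq r <- nth [::] gens i | diagonal_ok i r && extra i r]) n) [::].
Proof.
move=> m_gt0 [_ bsym bsq] szg ing ext fin.
have mk_gt0 k : k < n -> 0 < nth 0 m k by move=> kn; apply: (all_nthP 0 m_gt0).
have dotE i j : i < n -> j < n ->
    dot i j (mkseq (b i) n) (mkseq (b j) n) + b i j = 12 * (i == j) + 2 * nth 0 m j.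
  move=> i_n j_n; rewrite -bsq //; congr (_ + _).
  rewrite /dot sumnE big_map (_ : iota 0 n = index_iota 0 n)
    ?big_mkord; last by rewrite /index_iota subn0.
  apply: eq_bigr => k _; rewrite !nth_mkseq //; congr (_ * _).
  by rewrite mulnC bsym // mulKn // mk_gt0.
apply: (refute_sound (rows := mkseq (fun i => mkseq (b i) n) n)); rewrite ?size_mkseq //.
  move=> k kn; rewrite !nth_mkseq // mem_filter ing // ext // andbT andbT /diagonal_ok.
  rewrite !nth_mkseq // dotE // eqxx muln1 eqxx /=.
  apply/allP => l; rewrite mem_iota /= add0n => ln.
  by rewrite nth_mkseq // mulnC bsym // dvdn_mulr.
move=> k kn; rewrite nth_mkseq // cat0s /compatible size_takel ?size_mkseq ?(ltnW kn) //.
set sym := all _ _; set dots := all _ _; suff [-> ->] : sym * dots by [].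
split; apply/allP => j; rewrite mem_iota /= add0n => jk;
  have jn := ltn_trans jk kn; rewrite nth_take // !nth_mkseq //.
  by apply/eqP/bsym.
by apply/eqP; rewrite dotE // (gtn_eqF jk).
Qed.

End QuotientSearch.

(** * Finite groups *)

(** Take u of order 3 in the centre. Either t inverts u, or u * u ^ t is an element of order 3 fixed
    by t. *)
Lemma invariant_order3 (gT : finGroupType) (P : {group gT}) (t : gT) :
    3.-group P -> P :!=: 1%g -> t \in 'N(P) -> (t ^+ 2 = 1)%g ->
  exists Z : {group gT}, [/\ Z \subset 'Z(P), #|Z| = 3 & t \in 'N(Z)].
Proof.
move=> pP ntP tP t2.
have ntZ : 'Z(P) != 1%g by rewrite (center_nil_eq1 (pgroup_nil pP)).
have [_ d3 _] := pgroup_pdiv (pgroupS (center_sub P) pP) ntZ.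
have [u uZ ou] := Cauchy (isT : prime 3) d3.
have utZ : (u ^ t)%g \in 'Z(P).
  by rewrite memJ_norm // (subsetP (char_norms (center_char P))).
have utt : ((u ^ t) ^ t = u)%g by rewrite -conjgM -[(t * t)%g]/(t ^+ 2)%g t2 conjg1.
have cu : commute u (u ^ t)%g by apply: (centsP (center_abelian P)).
have cycZ g : g \in 'Z(P) -> #[g]%g = 3 -> t \in 'N(<[g]>)%g ->
    exists Z : {group gT}, [/\ Z \subset 'Z(P), #|Z| = 3 & t \in 'N(Z)].
  by move=> gZ og tg; exists <[g]>%G; rewrite cycle_subG.
have [uut | uut] := eqVneq (u * u ^ t)%g 1%g.
  apply: (cycZ u) => //; rewrite inE -cycleJ cycle_subG.
  suff -> : (u ^ t = u^-1)%g by rewrite groupV cycle_id.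
  by apply/eqP; rewrite eq_sym eq_invg_mul uut.
apply: (cycZ (u * u ^ t)%g); first exact: groupM.
- by apply: nt_prime_order => //; rewrite expgMn // -conjXg -ou expg_order conj1g mulg1.
by rewrite inE -cycleJ conjMg utt -cu cycle_subG cycle_id.
Qed.

(** Two applications of [invariant_order3], to P and to P / Z; the preimage of the second subgroup
    has order 9. *)
Lemma invariant_order9 (gT : finGroupType) (P : {group gT}) (t : gT) :
    3.-group P -> 9 %| #|P| -> t \in 'N(P) -> (t ^+ 2 = 1)%g ->
  exists W : {group gT}, [/\ W \subset P, #|W| = 9 & t \in 'N(W)].
Proof.
move=> pP d9 tP t2.
have ntP : P :!=: 1%g by rewrite -cardG_gt1; have := dvdn_leq (cardG_gt0 P) d9; lia.
have [Z [ZZ oZ tZ]] := invariant_order3 pP ntP tP t2.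
have nsZ : Z <| P by apply: sub_center_normal.
have nPZ := normal_norm nsZ.
have ntQ : (P / Z)%g != 1%g.
  rewrite -cardG_gt1 card_quotient // -divgS ?normal_sub // oZ.
  by have := dvdn_leq (cardG_gt0 P) d9; case/dvdnP: d9 => k ->; rewrite -[9]/(3 * 3)%N mulnA mulnK //; lia.
have tQ : coset Z t \in 'N(P / Z)%g.
  rewrite (subsetP (quotient_norm Z P)) // mem_quotient //.
have tt2 : (coset Z t ^+ 2 = 1)%g by rewrite -morphX // t2 morph1.
have [Y [YZ oY tY]] := invariant_order3 (quotient_pgroup Z pP) ntQ tQ tt2.
exists (coset Z @*^-1 Y)%G; split.
- by rewrite -(quotientGK nsZ) morphpreS // (subset_trans YZ) // center_sub.
- by rewrite /= card_cosetpre oZ oY.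
by apply: (subsetP (morphpre_norm (coset Z) Y)); rewrite mem_morphpre.
Qed.

Lemma odd_permX (T : finType) (s : {perm T}) n : odd_perm (s ^+ n)%g = odd n && odd_perm s.
Proof. by elim: n => [|n IHn]; rewrite ?expg0 ?odd_perm1 // expgS odd_permM IHn /=; case: odd; case: odd_perm. Qed.

Lemma odd_order_even_perm (T : finType) (s : {perm T}) : odd #[s]%g -> ~~ odd_perm s.
Proof. by move=> os; have := odd_permX s #[s]%g; rewrite expg_order odd_perm1 os /= => <-. Qed.

(* The Frattini argument for the even permutations of G: a Sylow normalizer
   contains odd permutations, hence elements of even order. *)
Lemma normalizing_involution (T : finType) (G : {group {perm T}}) (t : {perm T}) p :
    t \in G -> odd_perm t -> prime p -> odd p ->
  exists2 P : {group {perm T}}, p.-Sylow(G) P &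
    exists s, [/\ s \in G, #[s]%g = 2 & s \in 'N(P)].
Proof.
move=> tG odd_t pp odd_p; have [P sylP] := Sylow_exists p G; exists P => //.
have [PG pP _] := and3P sylP; pose K := (G :&: 'Alt_T)%G.
have PK : P \subset K.
  rewrite subsetI PG; apply/subsetP => s sP; rewrite Alt_even odd_order_even_perm //.
  have [k ->] := p_natP (mem_p_elt pP sP).
  by rewrite oddX odd_p orbT.
have nK : K <| G := normalGI (subsetT G) (Alt_normal T).
have : t \in (K * 'N_G(P))%g by rewrite (Frattini_arg nK (pHall_subl PK (subsetIl _ _) sylP)).
case/mulsgP => k s; rewrite in_setI Alt_even => /andP[_ ev_k] /setIP[sG sN] tE.
have odd_s : odd_perm s by move: odd_t; rewrite tE odd_permM (negPf ev_k).
have d2 : 2 %| #|<[s]>%g|.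
  by rewrite dvdn2; apply/negP => /odd_order_even_perm; rewrite odd_s.
have [u us ou] := Cauchy (isT : prime 2) d2.
have sub (A : {group {perm T}}) : s \in A -> u \in A.
  by rewrite -cycle_subG => /subsetP; apply.
by exists u; split=> //; [apply: sub | apply: (sub 'N(P)%G)].
Qed.

(** * The nonabelian group of order 21 *)

Lemma card_metacyclic21 (hT : finGroupType) (a b : hT) :
  #[a]%g = 7 -> #[b]%g = 3 -> (a ^ b = a ^+ 2)%g -> #|<[a]> <*> <[b]>|%g = 21.
Proof.
move=> oa ob ab; rewrite norm_joinEr; last first.
  by rewrite cycle_subG inE -cycleJ ab cycle_subG mem_cycle.
by rewrite coprime_cardMg -!orderE oa ob.
Qed.

Lemma metacyclic21_gens (gT : finGroupType) (G : {group gT}) : #|G| = 21 -> ~~ abelian G ->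
  exists a b, [/\ #[a]%g = 7, #[b]%g = 3, (a ^ b = a ^+ 2)%g & G :=: (<[a]> <*> <[b]>)%g].
Proof.
move=> oG nabG.
have [P sylP nP] : exists2 P : {group gT}, 7.-Sylow(G) P & P <| G.
  apply/normal_sylowP; have := card_Syl_mod G (isT : prime 7); have := card_Syl_dvd 7 G.
  rewrite oG (dvdn_divisors _ (isT : 0 < 21)) -[divisors 21]/[:: 1; 3; 7; 21]%N.
  by rewrite !in_cons in_nil orbF => /or4P[]/eqP->.
have oP : #|P| = 7 by rewrite (card_Hall sylP) oG p_part.
have [a aP oa] := Cauchy (isT : prime 7) (eq_ind_r (dvdn 7) (dvdnn 7) oP).
have PE : P :=: <[a]>%g by apply/eqP; rewrite eq_sym eqEcard cycle_subG aP oP -orderE oa.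
have d3 : 3 %| #|G| by rewrite oG.
have [b bG ob] := Cauchy (isT : prime 3) d3.
have aG := subsetP (normal_sub nP) a aP.
have GE c : c \in G -> #[c]%g = 3 -> (a ^ c = a ^+ 2)%g -> G :=: (<[a]> <*> <[c]>)%g.
  move=> cG oc ac; apply/eqP; rewrite eq_sym eqEcard join_subG !cycle_subG aG cG.
  by rewrite oG card_metacyclic21.
have : (a ^ b)%g \in <[a]>%g by rewrite -PE memJ_norm // (subsetP (normal_norm nP)).
case/cyclePmin => k; rewrite oa => k7 ab.
have ab2 : (a ^ (b ^+ 2) = a ^+ (k ^ 2))%g.
  by rewrite expgS expg1 conjgM ab conjXg ab -expgM.
have : (a ^+ (k ^ 3) == a ^+ 1)%g.
  by rewrite expg1 -{2}(conjg1 a) -(expg_order b) ob expgSr conjgM ab2 conjXg ab -expgM -expnS.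
(* The exponent satisfies k^3 = 1 modulo 7, so k is 1, 2 or 4. The value 1 makes G abelian, and 4
   turns into 2 when b is replaced by b^2. *)
rewrite eq_expg_mod_order oa; case: k k7 ab ab2 => [|[|[|[|[|[|[|]]]]]]] // _ ab ab2 _.
- have cab : commute a b by apply/commgP/conjg_fixP.
  have abG : abelian (<[a]> <*> <[b]>)%g.
    by rewrite abelianY !cycle_abelian cent_cycle cycle_subG; apply/cent1P.
  case/negP: nabG; suff -> : G :=: (<[a]> <*> <[b]>)%G by [].
  apply/eqP; rewrite eq_sym eqEcard join_subG !cycle_subG aG bG oG /=.
  by rewrite cent_joinEr ?coprime_cardMg -?orderE ?oa ?ob // cent_cycle cycle_subG; apply/cent1P.
- by exists a, b; split=> //; apply: GE.
have ob2 : #[b ^+ 2]%g = 3 by rewrite orderXgcd ob.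
have abV : (a ^ (b ^+ 2) = a ^+ 2)%g.
  by rewrite ab2 -[(4 ^ 2)%N]/(7 * 2 + 2)%N expgD expgM -oa expg_order expg1n mul1g.
by exists a, (b ^+ 2)%g; split=> //; apply: GE; rewrite ?groupX.
Qed.

(** Generators with the same relations are paired in gT * rT: (a, a') and (b, b') again generate a
    group of order 21, so both of its projections are isomorphisms. *)
Lemma metacyclic21_isog (gT rT : finGroupType) (G : {group gT}) (H : {group rT}) :
    #|G| = 21 -> ~~ abelian G -> #|H| = 21 -> ~~ abelian H -> G \isog H.
Proof.
move=> oG nG oH nH; have [a [b [oa ob ab GE]]] := metacyclic21_gens oG nG.
have [a' [b' [oa' ob' ab' HE]]] := metacyclic21_gens oH nH.
pose A : (gT * rT)%type := (a, a'); pose B : (gT * rT)%type := (b, b').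
have proj (u v : (gT * rT)%type) : fst_morphism gT rT u = fst_morphism gT rT v ->
    snd_morphism gT rT u = snd_morphism gT rT v -> u = v.
  by case: u v => [? ?] [? ?] /= -> ->.
have prime_order n (u : (gT * rT)%type) : prime n -> #[u.1]%g = n -> #[u.2]%g = n -> #[u]%g = n.
  move=> pn o1 o2; apply: nt_prime_order => //.
    by apply: proj; rewrite morphX ?inE // morph1 /=; [rewrite -o1 | rewrite -o2]; apply: expg_order.
  by apply/eqP => u1; move: pn; rewrite -o1 u1 order1.
pose K := (<[A]> <*> <[B]>)%G.
have oK : #|K| = 21.
  apply: card_metacyclic21; [exact: prime_order | exact: prime_order |].
  by apply: proj; rewrite morphX ?inE // morphJ ?inE.
have fstK : G :=: (fst_morphism gT rT @* K)%g.
  by rewrite morphimY ?subsetT // !morphim_cycle ?inE.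
have sndK : H :=: (snd_morphism gT rT @* K)%g.
  by rewrite morphimY ?subsetT // !morphim_cycle ?inE.
have GK : G \isog K.
  by rewrite isogEcard oG oK leqnn andbT fstK morphim_homg ?subsetT.
have HK : H \isog K.
  by rewrite isogEcard oH oK leqnn andbT sndK morphim_homg ?subsetT.
by apply: isog_trans GK _; rewrite isog_sym.
Qed.

Lemma card_Frob21 : #|Frob21| = 21.
Proof.
pose to := [Aut [set: 'Z_7]]%gact.
have oZ : #|[set: 'Z_7]| = 7 by rewrite cardsT card_ord.
have oAut : #|Aut [set: 'Z_7]| = 6.
  by rewrite card_Aut_cyclic ?oZ // prime_cyclic ?oZ.
have oG : #|[set: hol7]| = 42.
  by rewrite -(sdprod_card (sdprod_sdpair to)) card_injm ?injm_sdpair1 // card_injm ?injm_sdpair2 // oZ oAut.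
have := Lagrange (subsetT Frob21); rewrite oG Frob21_index => /eqP.
by rewrite (@eqn_pmul2r 2 _ 21) // => /eqP.
Qed.

(** Elements of odd order are squares, so [Frob21] contains Z_7 and an automorphism of order 3,
    which would act trivially if they commuted. *)
Lemma Frob21_nonabelian : ~~ abelian Frob21.
Proof.
pose to := [Aut [set: 'Z_7]]%gact.
have oZ : #|[set: 'Z_7]| = 7 by rewrite cardsT card_ord.
have oAut : #|Aut [set: 'Z_7]| = 6.
  by rewrite card_Aut_cyclic ?oZ // prime_cyclic ?oZ.
apply/negP => /centsP ab; have d3 : 3 %| #|Aut [set: 'Z_7]| by rewrite oAut.
have [c cA oc] := Cauchy (isT : prime 3) d3.
have c4 : c = ((c ^+ 2) ^+ 2)%g.
  have c3 : (c ^+ 3 = 1)%g by apply/eqP; rewrite -order_dvdn oc.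
  by rewrite -expgM -[(2 * 2)%N]/(1 + 3)%N expgD c3 mulg1.
suff : c = 1%g by move=> c1; move: oc; rewrite c1 order1.
apply/permP => z; rewrite perm1.
have sq (u : hol7) : (u ^+ 2)%g \in Frob21 by apply/mem_gen/imset_f.
have zT : z \in [set: 'Z_7] by rewrite inE.
have act := sdpair_act to zT cA.
have z8 : z = ((z ^+ 4) ^+ 2)%g.
  have := expg_cardG zT; rewrite oZ => z7.
  by rewrite -expgM -[(4 * 2)%N]/(1 + 7)%N expgD z7 mulg1.
have zF : sdpair1 to z \in Frob21 by rewrite z8 morphX ?inE.
have cF : sdpair2 to c \in Frob21 by rewrite c4 (morphX _ _ (groupX 2 cA)); apply: sq.
have := ab _ zF _ cF => /commgP/conjg_fixP; rewrite -act => zc.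
have tz : to z c = z by apply: (injmP (injm_sdpair1 to)) zc; rewrite inE.
by rewrite -[RHS]tz.
Qed.

(** * Automorphisms of prime order *)

Section ConwayGraph.

Local Open Scope nat_scope.

Variables (T : finType) (e : rel T).
Hypothesis srg : strongly_regular e 99 14 1 2.

Implicit Types (x y z u v : T) (g h s t w : {perm T}) (X Y : {set T}).

Local Notation N := (neighbours e).

Definition deg y X := #|N y :&: X|.

Let e_sym : symmetric e. Proof. by case: srg => -[]. Qed.
Let e_irr : irreflexive e. Proof. by case: srg => -[]. Qed.

Lemma card_vertices : #|T| = 99. Proof. by case: srg. Qed.

Lemma card_nbrs x : #|N x| = 14. Proof. by case: srg. Qed.

Lemma adj_neq x y : e x y -> x != y.
Proof. by apply: contraTneq => ->; rewrite e_irr. Qed.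

(** The matrix identity A^2 + A = 12 + 2J, entry by entry. *)
Lemma card_common x y :
  #|N x :&: N y| + e x y = 12 * (x == y) + 2.
Proof.
case: srg => _ _ reg lam mu; have [<- | xny] := eqVneq x y.
  by rewrite setIid reg e_irr.
by case exy: (e x y); [rewrite lam | rewrite mu // exy].
Qed.

Lemma common_adj x y : e x y -> #|N x :&: N y| = 1.
Proof. by case: srg => _ _ _ lam _; apply: lam. Qed.

Lemma common_nonadj x y : x != y -> ~~ e x y -> #|N x :&: N y| = 2.
Proof. by case: srg => _ _ _ _; apply. Qed.

Lemma triangle_uniq x y z z' :
  e x y -> e x z -> e y z -> e x z' -> e y z' -> z = z'.
Proof.
move=> exy exz eyz exz' eyz'; have /card_le1_eqP le1 : #|N x :&: N y| <= 1 by rewrite common_adj.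
by apply: le1; rewrite !inE ?exz ?exz'.
Qed.

Lemma common_le2 x y z1 z2 z3 : x != y -> uniq [:: z1; z2; z3] ->
  all (fun z => e x z && e y z) [:: z1; z2; z3] -> False.
Proof.
move=> xny uz /allP az.
have: size [:: z1; z2; z3] <= #|N x :&: N y|.
  rewrite -(card_uniqP uz); apply: subset_leq_card; apply/subsetP => z /az.
  by rewrite !inE.
by have := card_common x y; rewrite (negPf xny) /=; lia.
Qed.

(** The identity A^2 + A = 12 + 2J applied to the indicator vector of X. *)
Lemma sum_nbr_deg y X :
  \sum_(z in N y) deg z X + deg y X = 12 * (y \in X) + 2 * #|X|.
Proof.
have degE z : deg z X = \sum_(x in X) e z x.
  by rewrite /deg -sum1_card big_mkcond [RHS]big_mkcond; apply: eq_bigr => x _;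
     rewrite !inE andbC; case: (x \in X); case: (e z x).
rewrite (eq_bigr _ (fun z _ => degE z)) exchange_big /= degE -big_split /=.
rewrite (eq_bigr (fun x => 12 * (y == x) + 2)); last first.
  move=> x _; rewrite -card_common; congr (_ + _).
  rewrite -sum1_card big_mkcond [RHS]big_mkcond; apply: eq_bigr => z _.
  rewrite !inE (e_sym z x); by case: (e y z); case: (e x z).
rewrite big_split /= sum_nat_const mulnC; congr (_ + _).
rewrite -big_distrr /=; congr (_ * _).
case: (boolP (y \in X)) => yX; last first.
  by rewrite big1 // => x xX; case: eqP => // yx; rewrite yx xX in yX.
rewrite (bigD1 y) //= eqxx big1 // => x /andP[_ xy].
by rewrite eq_sym (negPf xy).
Qed.

Local Notation G := (graph_aut e).

Definition fixpts g := [set y | g y == y].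
Definition shifted_adj g := [set y | e y (g y)].

Lemma aut_adj g x y : g \in G -> e (g x) (g y) = e x y.
Proof. by move/graph_autP. Qed.

Lemma nbrs_aut g x y : g \in G -> (g y \in N (g x)) = (y \in N x).
Proof. by move=> gG; rewrite !inE aut_adj. Qed.

Lemma card_aut_image g (A B : {set T}) :
  (forall y, (g y \in B) = (y \in A)) -> #|A| = #|B|.
Proof.
move=> AB; rewrite -(card_imset A (@perm_inj _ g)); apply: eq_card => y.
apply/imsetP/idP => [[z zA ->] | yB]; first by rewrite AB.
by exists (g^-1 y)%g; rewrite ?permKV // -AB permKV.
Qed.

Lemma deg_aut g y (X Y : {set T}) : g \in G ->
  (forall z, (g z \in Y) = (z \in X)) -> deg (g y) Y = deg y X.
Proof.
move=> gG XY; apply/esym/(@card_aut_image g) => z.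
by rewrite !in_setI XY nbrs_aut.
Qed.

Lemma deg_invariant (H : {group {perm T}}) h X y : H \subset G -> h \in H ->
  (forall k z, k \in H -> z \in X -> k z \in X) -> deg (h y) X = deg y X.
Proof.
move=> /subsetP HG hH HX; apply: deg_aut => [|z]; first exact: HG.
apply/idP/idP => [hz | ]; last exact: HX.
by rewrite -(permK h z); apply: HX; rewrite ?groupV.
Qed.

(* Modulo 7 the three eigenvalues 14, 3, -4 of the adjacency matrix A satisfy
   3 = -4, so that A - 3 + 3J squares to zero; it commutes with the permutation
   matrix P of an automorphism, hence P (A - 3 + 3J) is nilpotent. *)
Section TraceModulo7.

Local Open Scope ring_scope.
Import GRing.Theory.

(** With a rank factorization M = C R, tr M = tr (R C), and C R C R = 0 forces R C = 0 because C and
    R have full rank. *)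
Lemma mxtrace_square0 (F : fieldType) n (M : 'M[F]_n) : M *m M = 0 -> \tr M = 0.
Proof.
move=> M2; rewrite -(mulmx_base M) mxtrace_mulC.
suff -> : row_base M *m col_base M = 0 by rewrite mxtrace0.
apply: (row_full_inj (col_base_full M)); apply: (row_free_inj (row_base_free M)).
by rewrite mulmx0 mul0mx mulmxA mulmx_base -mulmxA mulmx_base.
Qed.

(** Here 4 stands for -3 modulo 7, and the multiple of J makes the constant row sum 14 + 4 + 3 * 99
    = 315 vanish modulo 7 as well. *)
Let w x y := (e x y + 4 * (x == y) + 3)%N.

Let sumM c (F : T -> nat) : (\sum_z F z * c = (\sum_z F z) * c)%N.
Proof. by rewrite big_distrl. Qed.

Let sum_delta y (F : T -> nat) : (\sum_z (z == y) * F z = F y)%N.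
Proof.
rewrite (bigD1 y) //= eqxx mul1n big1 ?addn0 // => z /negPf->.
by rewrite mul0n.
Qed.

Let sum_one y : (\sum_z (z == y) = 1)%N.
Proof. by rewrite -[RHS](sum_delta y (fun=> 1%N)); apply: eq_bigr => z; rewrite muln1. Qed.

Let sum_adj x : (\sum_z e x z = 14)%N.
Proof.
by rewrite -(card_nbrs x) -sum1_card [RHS]big_mkcond /=; apply: eq_bigr => z _; rewrite inE; case: (e x z).
Qed.

Let w_square x y : (7 %| \sum_z w x z * w z y)%N.
Proof.
have cn := card_common x y.
(* By A^2 + A = 12 + 2J and AJ = 14J, the square of A + 4 + 3J is 28 + 7A + 1001J, and 1001 = 7 *
   143. *)
suff -> : (\sum_z w x z * w z y = 7 * (4 * (x == y) + e x y + 143))%N by rewrite dvdn_mulr.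
pose F z := (e x z * e y z + ((z == y) * e x z) * 4 + e x z * 3
   + ((z == x) * e y z) * 4 + ((z == x) * (z == y)) * 16 + (z == x) * 12
   + e y z * 3 + (z == y) * 12 + 9)%N.
rewrite (eq_bigr F) => [|z _]; last first.
  rewrite /w /F (e_sym z y) (eq_sym x z).
  by case: (e x z); case: (e y z); case: (z == x); case: (z == y).
rewrite !big_split /= !sumM !sum_delta !sum_one !sum_adj sum_nat_const card_vertices.
have -> : (\sum_z e x z * e y z = #|N x :&: N y|)%N.
  rewrite -sum1_card [RHS]big_mkcond; apply: eq_bigr => z _.
  by rewrite !inE; case: (e x z); case: (e y z).
by rewrite (e_sym y x); lia.
Qed.

Lemma trace_mod7 g : g \in G ->
  (#|shifted_adj g| + 4 * #|fixpts g| = 4 %[mod 7])%N.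
Proof.
move=> gG; have wg x y : w (g x) (g y) = w x y by rewrite /w aut_adj // inj_eq //; apply: perm_inj.
pose M : 'M['F_7]_#|T| := \matrix_(i, j) (w (g (enum_val i)) (enum_val j))%:R.
have M2 : M *m M = 0.
  apply/matrixP => i j; rewrite !mxE; under eq_bigr do rewrite !mxE -natrM.
  rewrite -natr_sum; apply/eqP; rewrite -(dvdn_pcharf (pchar_Fp (isT : prime 7))).
  rewrite -(big_enum_val (A := T) (fun k => w (g (enum_val i)) k * w (g k) (enum_val j))%N) /=.
  (* Invariance of w under g moves g to the last index, and the sum becomes an entry of the square
     of w. *)
  rewrite (eq_bigr (fun k => w (g (enum_val i)) k * w k (g^-1%g (enum_val j)))%N) ?w_square //.
  by move=> k _; rewrite -(wg k (g^-1%g _)) permKV.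
have := mxtrace_square0 M2; rewrite /mxtrace.
under eq_bigr do rewrite mxE.
rewrite -natr_sum -(big_enum_val (A := T) (fun k => w (g k) k)) /=.
move/eqP; rewrite -(dvdn_pcharf (pchar_Fp (isT : prime 7))).
rewrite (eq_bigr (fun k => (k \in shifted_adj g) + (k \in fixpts g) * 4 + 3)%N); last first.
  by move=> k _; rewrite /w !inE e_sym mulnC.
rewrite !big_split /= sumM sum_nat_const card_vertices.
have sumI (A : {set T}) : (\sum_k (k \in A) = #|A|)%N.
  by rewrite -sum1_card [RHS]big_mkcond; apply: eq_bigr => z _; case: (z \in A).
rewrite !sumI; lia.
Qed.

End TraceModulo7.

Lemma mateP x y : e x y -> exists z, e x z /\ e y z.
Proof.
move=> exy; have : 0 < #|N x :&: N y| by rewrite common_adj.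
by case/card_gt0P => z; rewrite !inE => /andP[]; exists z.
Qed.

Lemma fix_mate g x u z : g \in G -> g x = x -> g u = u ->
  e x u -> e x z -> e u z -> g z = z.
Proof.
move=> gG gx gu exu exz euz; apply: (triangle_uniq exu) => //.
  by rewrite -{1}gx aut_adj.
by rewrite -{1}gu aut_adj.
Qed.

(* Two non-adjacent neighbours of x have exactly one common neighbour besides x,
   which is at distance two from x; conversely every vertex at distance two has
   two common neighbours with x. Hence the vertices of Z, fixed by g and at
   distance two from x, correspond to the g-stable pairs in Q. *)
Section FixedCount.

Variables (g : {perm T}) (x : T).
Hypotheses (gG : g \in G) (gx : g x = x).

Let f := #|N x :&: fixpts g|.
Let swapped := [set u in N x | [&& g u != u, g (g u) == u & ~~ e u (g u)]].
Let stable u v := (g u == u) && (g v == v) || (g u == v) && (g v == u).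
Let Q := [set p : T * T | [&& e x p.1, e x p.2, p.1 != p.2, ~~ e p.1 p.2 & stable p.1 p.2]].
Let Z := [set z in fixpts g | (x != z) && ~~ e x z].

Let pairs_of_vertex z : z \in Z ->
  \sum_(p in Q) (e z p.1 && e z p.2) = 2.
Proof.
rewrite !inE => /and3P[/eqP gz zx exz].
have /eqP/cards2P[p [q [pq Epq]]] := common_nonadj zx exz.
have inpq u : (u == p) || (u == q) = e x u && e z u.
  by move/setP/(_ u): Epq; rewrite !inE.
have /andP[exp ezp] : e x p && e z p by rewrite -inpq eqxx.
have /andP[exq ezq] : e x q && e z q by rewrite -inpq eqxx orbT.
have npq : ~~ e p q.
  apply: contra zx => epq; apply/eqP.
  by apply: (triangle_uniq epq); rewrite e_sym.
have gin u : e x u && e z u -> (g u == p) || (g u == q).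
  by case/andP=> xu zu; rewrite inpq -{1}gx aut_adj // xu -gz aut_adj.
have st : stable p q.
  have := gin p; rewrite exp ezp => /(_ isT) gp.
  have := gin q; rewrite exq ezq => /(_ isT) gq.
  rewrite /stable; case/orP: gp => /eqP gp; case/orP: gq => /eqP gq.
  - by have /perm_inj/eqP := etrans gp (esym gq); rewrite (negPf pq).
  - by rewrite gp gq !eqxx.
  - by rewrite gp gq !eqxx orbT.
  - by have /perm_inj/eqP := etrans gp (esym gq); rewrite (negPf pq).
have st' : stable q p by move: st; rewrite /stable andbC; case/orP=> [->|/andP[-> ->]]; rewrite ?orbT.
have -> : 2 = #|[set (p, q); (q, p)]|.
  by rewrite cards2 xpair_eqE (negPf pq).
rewrite -sum1_card big_mkcond [RHS]big_mkcond; apply: eq_bigr => -[u v] _ /=.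
have ifE (b c d : bool) : b && c = d -> (if b then c : nat else 0) = if d then 1 else 0.
  by move=> <-; case: b.
apply: ifE; rewrite !inE /= !xpair_eqE; apply/idP/idP; last first.
  case/orP=> /andP[/eqP-> /eqP->]; first by rewrite exp exq pq npq st ezp ezq.
  by rewrite exp exq eq_sym pq e_sym npq st' ezp ezq.
case/andP=> /and5P[exu exv uv _ _] /andP[ezu ezv].
have := inpq u; rewrite exu ezu => /orP[]/eqP uE;
  have := inpq v; rewrite exv ezv => /orP[]/eqP vE;
  by move: uv; rewrite uE vE ?eqxx ?orbT.
Qed.

Let vertex_of_pair p : p \in Q -> \sum_(z in Z) (e z p.1 && e z p.2) = 1.
Proof.
case: p => u v /=; rewrite inE /= => /and5P[exu exv uv euv st].
have /eqP/cards2P[a [b [ab Eab]]] := common_nonadj uv euv.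
have inab z : (z == a) || (z == b) = e u z && e v z.
  by move/setP/(_ z): Eab; rewrite !inE.
have [y xy Ey] : exists2 y, x != y & forall z, (z == x) || (z == y) = e u z && e v z.
  have : (x == a) || (x == b) by rewrite inab !(e_sym _ x) exu.
  case/orP => /eqP xE; [exists b | exists a]; rewrite ?xE // 1?eq_sym //.
  by move=> z; rewrite -inab orbC.
have /andP[euy evy] : e u y && e v y by rewrite -Ey eqxx orbT.
have exy : ~~ e x y.
  apply: contra uv => exy; apply/eqP; apply: (triangle_uniq exy) => //; by rewrite e_sym.
have gy : g y = y.
  have : (g y == x) || (g y == y).
    rewrite Ey; case/orP: st => /andP[/eqP gu /eqP gv].
      by rewrite -{1}gu -{1}gv !aut_adj // euy.
    by rewrite -{1}gv -{2}gu !aut_adj // euy evy.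
  case/orP => /eqP // gyx; have := etrans gx (esym gyx) => /perm_inj xE.
  by rewrite xE eqxx in xy.
rewrite (bigD1 y) /=; last by rewrite !inE gy eqxx xy.
rewrite (e_sym y u) (e_sym y v) euy evy big1 // => z /andP[].
rewrite !inE => /and3P[_ xz _] zy; rewrite !(e_sym z) -Ey (negPf zy) orbF.
by rewrite eq_sym (negPf xz).
Qed.

Let card_stable_pairs : #|Q| = f * (f - 2) + #|swapped|.
Proof.
(* A fixed u is paired with every fixed neighbour of x except u itself and the third vertex of the
   triangle on x and u, which is fixed too; a moved u can only be paired with g u. *)
have Q_at u : u \in N x ->
    \sum_(v in T) ((u, v) \in Q) = (g u == u) * (f - 2) + (u \in swapped).
  rewrite inE => exu; rewrite [in RHS]inE inE exu /=.
  have [gu | gu] := eqVneq (g u) u.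
    have [v [exv euv]] := mateP exu; have gv := fix_mate gG gx gu exu exv euv.
    have uF : u \in N x :&: fixpts g by rewrite !inE exu gu eqxx.
    have vF : v \in (N x :&: fixpts g) :\ u.
      by rewrite !inE exv gv eqxx eq_sym (adj_neq euv).
    have -> : f - 2 = #|(N x :&: fixpts g) :\ u :\ v|.
      by rewrite /f (cardsD1 u) uF (cardsD1 v) vF; lia.
    rewrite mul1n addn0 -sum1_card.
    rewrite [RHS]big_mkcond /=; apply: eq_bigr => w _; rewrite !inE /= exu /stable gu eqxx /=.
    have [<- | wu] /= := eqVneq u w; first by rewrite !andbF.
    case exw: (e x w) => //=; last by rewrite andbF.
    rewrite orbF.
    have -> : (w == v) = e u w.
      apply/eqP/idP => [-> // | euw]; exact: triangle_uniq exu _ _ _ _.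
    by case: (e u w); case: (g w == w).
  rewrite mul0n add0n (bigD1 (g u)) //= big1 ?addn0 => [|w wgu]; last first.
    by rewrite inE /= /stable (negPf gu) (eq_sym (g u)) (negPf wgu) !andbF.
  rewrite inE /= exu /stable (negPf gu) eqxx (eq_sym u) gu /=.
  have -> : e x (g u) by rewrite -{1}gx aut_adj.
  by case: (e u _); case: (g (g u) == u).
rewrite -sum1_card.
have -> : \sum_(p in Q) 1 = \sum_(u in N x) \sum_v ((u, v) \in Q).
  rewrite (eq_bigr (fun u => \sum_(v | (u, v) \in Q) 1)); last first.
    by move=> u _; rewrite [RHS]big_mkcond; apply: eq_bigr => v _; case: (_ \in Q).
  rewrite pair_big_dep /=; apply: eq_bigl => -[u v] /=.
  by rewrite !inE /=; case: (e x u).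
rewrite (eq_bigr _ Q_at) big_split /= -big_distrl /=; congr (_ * _ + _).
  rewrite /f -sum1_card big_mkcond [RHS]big_mkcond; apply: eq_bigr => u _.
  by rewrite !inE; case: (e x u); case: (g u == u).
rewrite -sum1_card big_mkcond [RHS]big_mkcond; apply: eq_bigr => u _.
by rewrite !inE; case: (e x u); case: (g u == u).
Qed.

Lemma fixed_count : 2 * #|fixpts g| = f ^ 2 + #|swapped| + 2.
Proof.
have EQ : #|Q| = 2 * #|Z|.
  transitivity (\sum_(p in Q) \sum_(z in Z) (e z p.1 && e z p.2)).
    by rewrite -sum1_card; apply: eq_bigr => p /vertex_of_pair->.
  rewrite exchange_big /= (eq_bigr (fun=> 2)); first by rewrite sum_nat_const mulnC.
  by move=> z /pairs_of_vertex.
have EF : #|fixpts g| = 1 + f + #|Z|.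
  rewrite -(cardsID (N x) (fixpts g)) (setIC _ (N x)) -/f (addnC 1) -addnA.
  congr (_ + _); rewrite (cardsD1 x) !inE gx eqxx e_irr /=; congr (_ + _).
  by apply: eq_card => z; rewrite !inE (eq_sym x); case: (z == x); case: (g z == z); case: (e x z).
(* Fixed neighbours come in adjacent pairs, so f is never 1 and the truncated f - 2 is correct for
   positive f. *)
have f2 : 0 < f -> 2 <= f.
  case/card_gt0P => u; rewrite !inE => /andP[exu /eqP gu].
  have [v [exv euv]] := mateP exu.
  have -> : 2 = #|[set u; v]| by rewrite cards2 (adj_neq euv).
  apply: subset_leq_card; apply/subsetP => z; rewrite !inE => /orP[]/eqP->.
    by rewrite exu gu eqxx.
  by rewrite exv (fix_mate gG gx gu exu) ?eqxx.
move: card_stable_pairs; rewrite EQ EF; case: (posnP f) f2 => [-> | f0 /(_ isT) f2]; nia.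
Qed.

End FixedCount.

Lemma degE y X : deg y X = \sum_(x in X) e y x.
Proof.
rewrite /deg -sum1_card big_mkcond [RHS]big_mkcond; apply: eq_bigr => x _.
by rewrite !inE andbC; case: (x \in X); case: (e y x).
Qed.

Lemma sum_deg_sym X Y : \sum_(x in X) deg x Y = \sum_(y in Y) deg y X.
Proof.
under eq_bigr do rewrite degE; under [RHS]eq_bigr do rewrite degE.
by rewrite exchange_big; apply: eq_bigr => y _; apply: eq_bigr => x _; rewrite e_sym.
Qed.

Lemma sum_deg_mul X Y :
  \sum_z deg z X * deg z Y + \sum_(y in X) deg y Y = \sum_(y in X) (12 * (y \in Y) + 2 * #|Y|).
Proof.
rewrite -(eq_bigr _ (fun y _ => sum_nbr_deg y Y)) big_split /=; congr (_ + _).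
under eq_bigr do rewrite degE big_distrl /=.
rewrite exchange_big /=; apply: eq_bigr => y _; rewrite [RHS]big_mkcond.
by apply: eq_bigr => z _; rewrite inE e_sym; case: (e y z); rewrite ?mul1n.
Qed.

Lemma sum_distance x (F : T -> nat) :
  \sum_y F y = F x + \sum_(y in N x) F y + \sum_(y | (y != x) && ~~ e x y) F y.
Proof.
rewrite (bigD1 x) //= -addnA; congr (_ + _).
rewrite (bigID (mem (N x))) /=; congr (_ + _); apply: eq_bigl => y; rewrite inE //.
by case: eqP => // ->; rewrite e_irr.
Qed.

Lemma deg_setC y X : deg y X + deg y (~: X) = 14.
Proof. by rewrite -(card_nbrs y) -(cardsID X (N y)) /deg setDE. Qed.

Lemma fixpts_full g : #|fixpts g| = 99 -> g = 1%g.
Proof.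
rewrite -card_vertices => F99; apply/permP => y; rewrite perm1.
have : y \in fixpts g.
  have /eqP-> : fixpts g == setT by rewrite eqEcard subsetT cardsT F99 leqnn.
  by rewrite inE.
by rewrite inE => /eqP.
Qed.

Lemma fixpts_le g : #|fixpts g| <= 99.
Proof. by rewrite -card_vertices; apply: max_card. Qed.

Lemma card_fixpts_mod (p : nat) g : p.-elt g -> 99 = #|fixpts g| %[mod p].
Proof.
move=> pg; rewrite -card_vertices -cardsT (card_fix_mod pg) => [|y]; last by rewrite inE.
by congr (#|pred_of_set _| %% p); apply/setP => y; rewrite !inE.
Qed.

Lemma deg_fixpts_mod (p : nat) g x :
  g \in G -> p.-elt g -> g x = x -> 14 = deg x (fixpts g) %[mod p].
Proof.
move=> gG pg gx; rewrite -(card_nbrs x) (card_fix_mod pg) => [|y].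
  by congr (#|pred_of_set _| %% p); apply/setP => y; rewrite !inE.
by rewrite -{2}gx nbrs_aut.
Qed.

Lemma dvdn_shifted_adj (p : nat) g : g \in G -> p.-elt g -> p %| #|shifted_adj g|.
Proof.
move=> gG pg; rewrite /dvdn (card_fix_mod pg) => [|y]; last by rewrite !inE aut_adj.
rewrite (_ : [set y in _ | _] = set0) ?cards0 ?mod0n //.
apply/setP => y; rewrite !inE; apply/negP => /andP[ey /eqP gy].
by rewrite gy e_irr in ey.
Qed.

Lemma odd_order_square_fix g y : odd #[g]%g -> g (g y) = y -> g y = y.
Proof.
move=> og gy; have : (g ^+ #[g])%g y = y by rewrite expg_order perm1.
rewrite -{1}(odd_double_half #[g]%g) og add1n expgSr permM -muln2 mulnC expgM permX.
rewrite (_ : iter _ _ y = y) //; elim: _./2 => //= i ->.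
by rewrite expgS permM expg1.
Qed.

Lemma fixed_count_odd g x : g \in G -> odd #[g]%g -> g x = x ->
  2 * #|fixpts g| = deg x (fixpts g) ^ 2 + 2.
Proof.
move=> gG og gx; rewrite (fixed_count gG gx) (_ : [set u in N x | _] = set0).
  by rewrite cards0 addn0.
apply/setP => u; rewrite !inE; apply/negP => /and4P[_ gu /eqP ggu _].
by rewrite (odd_order_square_fix og ggu) eqxx in gu.
Qed.

(** For two fixed neighbours u and v of y, the vertices y, g y and g (g y), distinct because the
    order is odd, would be three common neighbours of u and v. *)
Lemma deg_fixpts_le1 g y : g \in G -> odd #[g]%g -> g y != y -> deg y (fixpts g) <= 1.
Proof.
move=> gG og gy; rewrite leqNgt; apply/negP => /card_gt1P[u [v []]].
rewrite !inE => /andP[eyu /eqP gu] /andP[eyv /eqP gv] uv.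
have ggy : g (g y) != y by apply: contra gy => /eqP/(odd_order_square_fix og)->.
apply: (@common_le2 u v y (g y) (g (g y))) => //=.
  by rewrite !inE negb_or eq_sym gy eq_sym ggy eq_sym (inj_eq perm_inj) gy.
have adj (w : T) : g w = w -> e y w -> [&& e w y, e w (g y) & e w (g (g y))].
  move=> gw eyw; have eg z : e w (g z) = e w z by rewrite -{1}gw aut_adj.
  by rewrite !eg e_sym eyw.
have /and3P[-> -> ->] := adj u gu eyu.
by have /and3P[-> -> ->] := adj v gv eyv.
Qed.

Lemma fixed_count_prime_cases p f n :
    prime p -> odd p -> p <= 14 -> f <= 14 -> n != 99 -> 2 * n = f ^ 2 + 2 ->
    p %| 14 - f -> p %| 99 - n ->
  (p, f, n) \in [:: (3, 2, 3); (3, 8, 33); (5, 4, 9); (7, 0, 1)].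
Proof.
move=> pp op ple fle n99 E2.
have nE : n = (f ^ 2 + 2)./2 by rewrite -E2 mul2n doubleK.
have chk : all (fun p => all (fun f => let n := (f ^ 2 + 2)./2 in
    [&& prime p, odd p, n != 99, p %| 14 - f & p %| 99 - n] ==>
    ((p, f, n) \in [:: (3, 2, 3); (3, 8, 33); (5, 4, 9); (7, 0, 1)]))
    (iota 0 15)) (iota 0 15) by vm_compute.
move/allP/(_ p): chk; rewrite mem_iota ltnS ple => /(_ isT)/allP/(_ f).
rewrite mem_iota ltnS fle /= -nE => /(_ isT)/implyP chk d1 d2.
by apply: chk; rewrite pp op n99 d1 d2.
Qed.

(* Every fixed vertex has the same number f of fixed neighbours, and a moved
   vertex at most one; with 2 n = f^2 + 2 and the congruences modulo p this
   leaves the four cases of [fixed_count_prime_cases], of which (3, 8, 33) and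
   (5, 4, 9) are excluded by counting edges and by [trace_mod7]. *)
Lemma odd_prime_automorphism g p : g \in G -> #[g]%g = p -> prime p -> odd p ->
  [\/ p = 3 /\ (fixpts g = set0 \/ #|fixpts g| = 3),
      p = 7 /\ #|fixpts g| = 1 | p = 11 /\ fixpts g = set0].
Proof.
move=> gG og pp op; have og' : odd #[g]%g by rewrite og.
have pg : p.-elt g by rewrite /p_elt og pnat_id.
have n99 : #|fixpts g| != 99.
  apply/eqP => /fixpts_full g1; by rewrite -og g1 order1 in pp.
have nmod := card_fixpts_mod pg; have nle := fixpts_le g.
have [F0 | [x]] := set_0Vmem (fixpts g).
  have : p %| 99 by rewrite /dvdn nmod F0 cards0 mod0n.
  have -> : 99 = 3 * (3 * 11) by [].
  rewrite !Euclid_dvdM // !dvdn_prime2 // orbA orbb => /orP[]/eqP ->.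
    by constructor 1; split=> //; left.
  by constructor 3.
rewrite inE => /eqP gx.
have E2 y : g y = y -> 2 * #|fixpts g| = deg y (fixpts g) ^ 2 + 2.
  exact: fixed_count_odd.
set f := deg x (fixpts g); have fE y : g y = y -> deg y (fixpts g) = f.
  move=> gy; have := E2 y gy; rewrite (E2 x gx) -/f => /eqP.
  by rewrite eqn_add2r eqn_exp2r // => /eqP.
have fmod : 14 = f %[mod p] := deg_fixpts_mod gG pg gx.
have fle : f <= 14 by rewrite -(card_nbrs x); apply: subset_leq_card; apply: subsetIl.
have moved : #|fixpts g| * (14 - f) = \sum_(y in ~: fixpts g) deg y (fixpts g).
  rewrite -sum_deg_sym -sum_nat_const; apply: eq_bigr => y; rewrite inE => /eqP/fE <-.
  by rewrite -(deg_setC y (fixpts g)) addKn.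
have cC : #|fixpts g| + #|~: fixpts g| = 99 by rewrite cardsC card_vertices.
have le1 y : y \in ~: fixpts g -> deg y (fixpts g) <= 1.
  by rewrite !inE; apply: deg_fixpts_le1.
have moved_le : #|fixpts g| * (14 - f) <= #|~: fixpts g|.
  by rewrite moved -sum1_card; apply: leq_sum => y; apply: le1.
have Ex := E2 x gx; rewrite -/f in Ex.
have pdvd : p %| 14 - f.
  by rewrite -eqn_mod_dvd //; apply/eqP; rewrite fmod.
have pdvd2 : p %| 99 - #|fixpts g|.
  by rewrite -eqn_mod_dvd //; apply/eqP; rewrite nmod.
have ple : p <= 14.
  rewrite leqNgt; apply: contra n99 => p14; apply/eqP.
  have f14 : f = 14 by move: fmod; rewrite !modn_small // (leq_ltn_trans fle).
  by apply/eqP; rewrite -(eqn_pmul2l (isT : 0 < 2)) Ex f14.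
have := fixed_count_prime_cases pp op ple fle n99 Ex pdvd pdvd2.
rewrite !inE !xpair_eqE => /or4P[] /andP[/andP[/eqP pE /eqP fE'] /eqP nE].
- by constructor 1; split=> //; right; rewrite nE.
(* Here 33 * 6 = 198 edges leave the fixed set, but the 66 moved vertices receive at most one
   each. *)
- by move: moved_le cC; rewrite nE fE'; clear => ? ?; lia.
(* Here 9 * 10 = 90 edges reach 90 moved vertices, exactly one each. The trace provides some y
   adjacent to g y; its fixed neighbour u is adjacent to g y and g^-1 y as well, so both are the
   third vertex of the triangle on y and u. *)
- exfalso; rewrite nE fE' in moved cC.
  have each y : y \in ~: fixpts g -> 0 < deg y (fixpts g).
    move=> yC; rewrite lt0n; apply/eqP => y0; move: moved.
    rewrite (bigD1 y) //= y0 add0n => moved.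
    have : \sum_(z in ~: fixpts g | z != y) deg z (fixpts g) <= #|(~: fixpts g) :\ y|.
      apply: leq_trans (_ : \sum_(z in ~: fixpts g | z != y) 1 <= _).
        by apply: leq_sum => z /andP[zC _]; apply: le1.
      rewrite sum1_card; apply: eq_leq; apply: eq_card => z.
      by rewrite in_setD1 andbC.
    by rewrite -moved; have := cardsD1 y (~: fixpts g); rewrite yC; clear -cC; lia.
  have : 0 < #|shifted_adj g|.
    by rewrite lt0n; apply/eqP => s0; have := trace_mod7 gG; rewrite s0 nE.
  case/card_gt0P => y; rewrite inE => ey.
  have gy : g y != y by rewrite eq_sym (adj_neq ey).
  have /card_gt0P[u] : 0 < deg y (fixpts g) by apply: each; rewrite !inE.
  rewrite !inE => /andP[eyu /eqP gu].
  have eyg : e y (g^-1 y)%g by rewrite -(aut_adj _ _ gG) permKV e_sym.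
  have eug z : e u (g z) = e u z by rewrite -{1}gu aut_adj.
  have gyE : g y = (g^-1 y)%g.
    apply: (triangle_uniq eyu) => //; first by rewrite eug e_sym.
    by rewrite -eug permKV e_sym.
  by case/eqP: gy; apply: (odd_order_square_fix og'); rewrite gyE permKV.
by constructor 2; split; rewrite ?pE.
Qed.

(** * Involutions and their fixed vertices *)

Lemma dvd3_fixed_edges g : g \in G -> 3 %| \sum_(x in fixpts g) deg x (fixpts g).
Proof.
move=> gG; pose third x u := odflt x [pick z | e x z && e u z].
have thirdP x u z : e x u -> e x z -> e u z -> third x u = z.
  move=> exu exz euz; rewrite /third; case: pickP => [w /andP[exw euw] | /(_ z)].
    exact: triangle_uniq exu _ _ _ _.
  by rewrite exz euz.
pose A := [set p : T * T | [&& g p.1 == p.1, g p.2 == p.2 & e p.1 p.2]].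
have -> : \sum_(x in fixpts g) deg x (fixpts g) = #|A|.
  rewrite -sum1_card (eq_bigr (fun x => \sum_(u in N x :&: fixpts g) 1)); last first.
    by move=> x _; rewrite sum1_card.
  rewrite pair_big_dep /=; apply: eq_bigl => -[x u].
  by rewrite !inE /= [e x u && _]andbC.
(* The rotation (x, u), (u, z), (z, x) of a fixed triangle acts freely on the ordered fixed edges.
   The default in [third] only concerns pairs that are not edges. *)
pose phi (p : T * T) := (p.2, third p.1 p.2).
have AP p : p \in A -> exists z, [/\ [&& e p.1 p.2, e p.1 z & e p.2 z],
    g p.1 = p.1, g p.2 = p.2 & g z = z].
  rewrite inE => /and3P[/eqP g1 /eqP g2 e12]; have [z [e1z e2z]] := mateP e12.
  by exists z; split; rewrite ?e12 ?e1z ?e2z // (fix_mate gG g1 g2 e12).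
have phiE x u z : e x u -> e x z -> e u z -> phi (x, u) = (u, z).
  by move=> exu exz euz; rewrite /phi /= (thirdP _ _ z).
apply: (@dvdn_card_cyclic_map _ 3 phi) => // -[x u] /AP[z [/= /and3P[exu exz euz] gx gu gz]].
- by rewrite (phiE x u z) // inE /= gu gz !eqxx.
- by rewrite /= (phiE x u z) // (phiE u z x) 1?(phiE z x u) // e_sym.
by rewrite (phiE x u z) // xpair_eqE eq_sym (negPf (adj_neq exu)).
Qed.

(** Here n counts all fixed vertices, f the fixed neighbours of one of them, and g its neighbours
    that are mapped to an adjacent vertex. The other 14 - f - g neighbours are interchanged with a
    non-neighbour, whence 2n = f^2 + (14 - f - g) + 2. *)
Definition involution_counts : seq (nat * nat * nat) :=
  [:: (1, 0, 14); (3, 0, 10); (3, 2, 12); (5, 0, 6); (5, 2, 8);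
    (7, 0, 2); (7, 2, 4); (9, 2, 0); (9, 4, 10); (11, 4, 6); (13, 4, 2);
    (19, 6, 8); (21, 6, 4); (23, 6, 0); (33, 8, 6); (35, 8, 2); (51, 10, 4);
    (53, 10, 0); (73, 12, 2)].

Lemma involution_count_cases (n f g : nat) :
    odd n -> n != 99 -> ~~ odd f -> f + g <= 14 -> 2 * n + f + g = f ^ 2 + 16 ->
  (n, f, g) \in involution_counts.
Proof.
move=> on n99 ef fg14 E.
have nE : n = (f ^ 2 + 16 - f - g)./2 by rewrite -E; lia.
have chk : all (fun f => all (fun g : nat => let n := (f ^ 2 + 16 - f - g)./2 in
    [&& odd n, n != 99, ~~ odd f & f + g <= 14] && (2 * n + f + g == f ^ 2 + 16) ==>
    ((n, f, g) \in involution_counts))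
    (iota 0 15)) (iota 0 15) by vm_compute.
have [fle gle] : f < 15 /\ g < 15 by lia.
move/allP/(_ f): chk; rewrite mem_iota fle => /(_ isT)/allP/(_ g).
rewrite mem_iota gle /= -nE => /(_ isT)/implyP; apply.
by rewrite on n99 ef fg14 E eqxx.
Qed.

(** The third vertex of the triangle on u and t u is fixed by t; conversely a fixed neighbour of u
    is also adjacent to t u. *)
Lemma deg_shifted_fixpts t u : t \in G -> (forall y, t (t y) = y) ->
  u \in shifted_adj t -> deg u (fixpts t) = 1.
Proof.
move=> tG t2;
rewrite inE => eu; rewrite -(common_adj eu); apply: eq_card => z.
rewrite !inE; apply: andb_id2l => euz; apply/eqP/idP => [<- | etz].
  by rewrite aut_adj.
apply: (triangle_uniq eu) => //; last by rewrite aut_adj.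
by rewrite -(aut_adj _ _ tG) t2.
Qed.

Section Involution.

Variable t : {perm T}.
Hypotheses (tG : t \in G) (t2 : forall y, t (t y) = y) (t1 : t != 1%g).

Let F := fixpts t.
Let S := shifted_adj t.

Let t_elt2 : 2.-elt t.
Proof.
rewrite /p_elt (@pnat_dvd _ 2) ?pnat_id // order_dvdn; apply/eqP/permP => y.
by rewrite expgS expg1 permM t2 perm1.
Qed.

Let card_shifted : #|S| = \sum_(x in F) deg x S.
Proof.
by rewrite sum_deg_sym -sum1_card; apply: eq_bigr => u /(deg_shifted_fixpts tG t2)->.
Qed.

Let fixed_count2 x : x \in F -> 2 * #|F| + deg x F + deg x S = deg x F ^ 2 + 16.
Proof.
rewrite inE => /eqP tx; rewrite (fixed_count tG tx) -/(deg x F).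
set H := [set _ in _ | _]; suff : deg x F + deg x S + #|H| = 14 by lia.
rewrite -(card_nbrs x) -(cardsID F (N x)) -addnA; congr (_ + _).
rewrite -(cardsID S (N x :\: F)); congr (_ + _); apply: eq_card => u; rewrite !inE ?t2 ?eqxx.
  by case: eqP => [->|_]; rewrite ?e_irr ?andbF.
by case: (e x u); case: (t u == u); case: (e u (t u)).
Qed.

(* Apart from n = 1 the triples (n, f, g) with a given number n of fixed points
   lie on a line a f + b = c g + d with A <= f <= B, the arguments of [key]
   below. Summing over the fixed points, such a line contradicts the divisibility
   of the number of fixed edges by 3, the value of the trace modulo 7 or the
   bound 99 on the number of vertices. *)
Lemma card_fixpts_involution : #|F| = 1.
Proof.
have le99 : #|S| + #|F| <= 99.
  rewrite -card_vertices -(cardC (mem F)) addnC leq_add2l; apply: subset_leq_card.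
  apply/subsetP => u; rewrite !inE => eu; apply: contraTneq eu => ->.
  by rewrite e_irr.
have tr : #|S| + 4 * #|F| = 4 %[mod 7] := trace_mod7 tG.
have d3 : 3 %| \sum_(x in F) deg x F := dvd3_fixed_edges tG.
have nodd : odd #|F| by have := card_fixpts_mod t_elt2; rewrite !modn2 -/F; case: (odd #|F|).
have fodd x : x \in F -> ~~ odd (deg x F).
  by rewrite inE => /eqP tx; have := deg_fixpts_mod tG t_elt2 tx; rewrite !modn2 -/F; case: (odd (deg x F)).
have f14 x : deg x F + deg x S <= 14.
  rewrite -(deg_setC x F) leq_add2l; apply: subset_leq_card; apply: setIS.
  apply/subsetP => u; rewrite !inE => eu; apply: contraTneq eu => ->.
  by rewrite e_irr.
have n99 : #|F| != 99 by apply: contra t1 => /eqP/fixpts_full->.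
have cnt := fixed_count2.
rewrite card_shifted in le99 tr.
pose Sf := \sum_(x in F) deg x F; pose Sg := \sum_(x in F) deg x S.
have d2 : 2 %| Sf by apply: dvdn_sum => y /fodd; rewrite dvdn2.
rewrite -/Sf -/Sg in d3 le99 tr.
have lin a b c d : (forall x, x \in F -> a * deg x F + b = c * deg x S + d) ->
    a * Sf + #|F| * b = c * Sg + #|F| * d.
  move=> E; rewrite /Sf /Sg !big_distrr /= -!sum_nat_const -!big_split /=.
  exact: eq_bigr.
have bnd a b : (forall x, x \in F -> a <= deg x F <= b) ->
    #|F| * a <= Sf <= #|F| * b.
  by move=> B; rewrite -!sum_nat_const !leq_sum // => x /B/andP[].
have key x : x \in F -> _ := fun xF =>
  involution_count_cases nodd n99 (fodd x xF) (f14 x) (cnt x xF).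
have [x xF] : exists x, x \in F by apply/card_gt0P; case: #|F| nodd.
have nin : #|F| \in [:: 1; 3; 5; 7; 9; 11; 13; 19; 21; 23; 33; 35; 51; 53; 73].
  by have := map_f (fun p => p.1.1) (key x xF); rewrite -mem_undup.
have {}key a b c d A B :
    (forall f g : nat, (#|F|, f, g) \in
      involution_counts -> a * f + b = c * g + d /\ A <= f <= B) ->
    a * Sf + #|F| * b = c * Sg + #|F| * d /\ #|F| * A <= Sf <= #|F| * B.
  move=> H; split; first by apply: lin => y /key/H[].
  by apply: bnd => y /key/H[].
clear -nin key d2 d3 le99 tr; move: #|F| nin key le99 tr => n nin key le99 tr.
move: nin; rewrite !inE; do ![case/orP]; move/eqP=> nE; rewrite nE in key le99 tr *.
- by [].
- have [f g | E B] := key 1 10 1 0 0 2; first by rewrite !inE !xpair_eqE /=; clear; lia.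
  by clear -E B d2 d3 le99 tr; lia.
- have [f g | E B] := key 1 6 1 0 0 2; first by rewrite !inE !xpair_eqE /=; clear; lia.
  by clear -E B d2 d3 le99 tr; lia.
- have [f g | E B] := key 1 2 1 0 0 2; first by rewrite !inE !xpair_eqE /=; clear; lia.
  by clear -E B d2 d3 le99 tr; lia.
- have [f g | E B] := key 5 0 1 10 2 4; first by rewrite !inE !xpair_eqE /=; clear; lia.
  by clear -E B d2 d3 le99 tr; lia.
- have [f g | E B] := key 0 6 1 0 0 14; first by rewrite !inE !xpair_eqE /=; clear; lia.
  by clear -E B d2 d3 le99 tr; lia.
- have [f g | E B] := key 0 2 1 0 0 14; first by rewrite !inE !xpair_eqE /=; clear; lia.
  by clear -E B d2 d3 le99 tr; lia.
- have [f g | E B] := key 0 8 1 0 0 14; first by rewrite !inE !xpair_eqE /=; clear; lia.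
  by clear -E B d2 d3 le99 tr; lia.
- have [f g | E B] := key 0 4 1 0 0 14; first by rewrite !inE !xpair_eqE /=; clear; lia.
  by clear -E B d2 d3 le99 tr; lia.
- have [f g | E B] := key 0 0 1 0 0 14; first by rewrite !inE !xpair_eqE /=; clear; lia.
  by clear -E B d2 d3 le99 tr; lia.
- have [f g | E B] := key 0 6 1 0 0 14; first by rewrite !inE !xpair_eqE /=; clear; lia.
  by clear -E B d2 d3 le99 tr; lia.
- have [f g | E B] := key 0 2 1 0 0 14; first by rewrite !inE !xpair_eqE /=; clear; lia.
  by clear -E B d2 d3 le99 tr; lia.
- have [f g | E B] := key 0 4 1 0 0 14; first by rewrite !inE !xpair_eqE /=; clear; lia.
  by clear -E B d2 d3 le99 tr; lia.
- have [f g | E B] := key 0 0 1 0 0 14; first by rewrite !inE !xpair_eqE /=; clear; lia.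
  by clear -E B d2 d3 le99 tr; lia.
- have [f g | E B] := key 0 2 1 0 0 14; first by rewrite !inE !xpair_eqE /=; clear; lia.
  by clear -E B d2 d3 le99 tr; lia.
Qed.

End Involution.

Lemma fixpts1_fix g x : fixpts g = [set x] -> g x = x.
Proof. by move/setP/(_ x); rewrite !inE eqxx => /eqP. Qed.

Lemma order2_involutive t : #[t]%g = 2 -> forall y, t (t y) = y.
Proof.
by move=> ot y; have := expg_order t; rewrite ot expgS expg1 => t2; rewrite -permM t2 perm1.
Qed.

Lemma order2_fix t : t \in G -> #[t]%g = 2 -> exists x, fixpts t = [set x].
Proof.
move=> tG ot; apply/cards1P; rewrite card_fixpts_involution //.
  exact: order2_involutive.
by apply/eqP => t1; rewrite t1 order1 in ot.
Qed.

Lemma order2_fix_uniq t x y : t \in G -> #[t]%g = 2 -> t x = x -> t y = y -> y = x.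
Proof.
move=> tG ot tx ty; have [z Fz] := order2_fix tG ot.
have inF u : t u = u -> u = z by move=> tu; apply/set1P; rewrite -Fz inE tu.
by rewrite (inF x tx) (inF y ty).
Qed.

(** With a single fixed vertex [fixed_count] reads 2 = 0 + s + 2, so no neighbour of x is
    interchanged with a non-neighbour. The converse is [order2_shifted]. *)
Lemma order2_flip t x y : t \in G -> #[t]%g = 2 -> t x = x -> e x y -> e y (t y).
Proof.
move=> tG ot tx exy; have [z Fz] := order2_fix tG ot.
have ty : t y != y.
  apply/eqP => ty; have xy := order2_fix_uniq tG ot tx ty.
  by rewrite xy e_irr in exy.
have := fixed_count tG tx; rewrite Fz cards1; set H := [set _ in _ | _] => E.
have /cards0_eq/setP/(_ y) : #|H| = 0 by lia.
by rewrite !inE exy ty order2_involutive // eqxx /= => /negbFE.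
Qed.

Lemma fix_nbrs_trivial g x : g \in G -> g x = x -> (forall y, e x y -> g y = y) -> g = 1%g.
Proof.
move=> gG gx gN; apply: fixpts_full; apply/eqP; rewrite eqn_leq fixpts_le /=.
have := fixed_count gG gx.
have -> : #|N x :&: fixpts g| = 14.
  rewrite -(card_nbrs x); apply: eq_card => y; rewrite !inE.
  by case exy: (e x y); rewrite // gN ?eqxx.
lia.
Qed.

Lemma order2_uniq t t' x : t \in G -> t' \in G -> #[t]%g = 2 -> #[t']%g = 2 ->
  t x = x -> t' x = x -> t = t'.
Proof.
move=> tG tG' ot ot' tx tx'; apply/eqP; rewrite eq_mulgV1; apply/eqP.
apply: (@fix_nbrs_trivial _ x); first by rewrite groupM ?groupV.
  by rewrite permM tx -{1}tx' permK.
move=> y exy; suff tyE : t y = t' y by rewrite permM tyE permK.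
apply: (triangle_uniq exy).
- by rewrite -tx aut_adj.
- exact: order2_flip exy.
- by rewrite -tx' aut_adj.
- exact: order2_flip exy.
Qed.

Lemma order2_central t g x : t \in G -> g \in G -> #[t]%g = 2 -> t x = x -> g x = x ->
  commute t g.
Proof.
move=> tG gG ot tx gx; apply/commgP/conjg_fixP.
apply: (@order2_uniq _ _ x); rewrite ?groupJ ?orderJ //.
have gVx : (g^-1)%g x = x by rewrite -{1}gx permK.
by rewrite /conjg !permM gVx tx gx.
Qed.

(* A 2-subgroup permutes the 14 neighbours of a vertex freely, because an
   involution has a single fixed vertex. *)
Lemma not_dvd4 : ~~ (4 %| #|G|).
Proof.
apply/negP => d4; have [S sylS] := Sylow_exists 2 (graph_aut_group e).
have [sSG pS _] := and3P sylS.
have d4S : 4 %| #|S| by rewrite (card_Hall sylS) -(@part_pnat_id 2 4) // partn_dvd.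
have ntS : S :!=: 1%g by apply: contraTneq d4S => ->; rewrite cards1.
have [z zZ oz] : exists2 z, z \in 'Z(S)%g & #[z]%g = 2.
  have pZ : 2.-group 'Z(S)%g := pgroupS (center_sub S) pS.
  have ntZ : ('Z(S) != 1)%g by rewrite center_nil_eq1 // (pgroup_nil pS).
  have [_ d2 _] := pgroup_pdiv pZ ntZ.
  by have [z] := Cauchy (isT : prime 2) d2; exists z.
have zG : z \in G by apply: (subsetP sSG); apply: (subsetP (center_sub S)).
have [x Fx] := order2_fix zG oz.
have zx := fixpts1_fix Fx.
have Sx s : s \in S -> s x = x.
  move=> sS; have /centerP[_ /(_ s sS) cz] := zZ.
  apply: (order2_fix_uniq zG oz zx).
  by rewrite -!permM -cz permM zx.
suff : #|S| %| #|N x|.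
  by rewrite card_nbrs => /(dvdn_trans d4S).
apply: dvdn_card_free => s y sS; rewrite inE => exy.
  by rewrite inE -(Sx s sS) aut_adj // (subsetP sSG).
move=> sy; apply/eqP; rewrite -order_eq1; apply/negPn/negP => os.
have ps : 2.-elt s by apply: mem_p_elt pS sS.
have d2s : 2 %| #[s]%g.
  have nts : (<[s]> != 1)%g by rewrite cycle_eq1 -order_eq1.
  by have [_ d2 _] := pgroup_pdiv ps nts.
have [i /cycleP[k iE] oi] := Cauchy (isT : prime 2) d2s.
have iS : i \in S by rewrite iE groupX.
have iy : i y = y by rewrite iE permX; elim: k {iE} => //= k ->.
have yx := order2_fix_uniq (subsetP sSG i iS) oi (Sx i iS) iy.
by rewrite yx e_irr in exy.
Qed.

Lemma order2_odd_perm t : t \in G -> #[t]%g = 2 -> odd_perm t.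
Proof.
move=> tG ot; have [x Fx] := order2_fix tG ot.
have tx := fixpts1_fix Fx.
have po y : porbit t y = orbit 'P <[t]>%g y by rewrite porbit.unlock.
have pp : partition (porbits t) [set: T].
  have po' : porbits t = orbit 'P <[t]>%g @: setT by apply/setP => O; apply/imsetP/imsetP => -[y _ ->]; exists y; rewrite ?inE ?po.
  rewrite po'; have := @orbit_partition _ _ _ 'P%act <[t]>%G [set: T].
  by apply; apply/acts_permP => h y _ _; rewrite inE.
have cy y : y != x -> #|porbit t y| = 2.
  move=> yx; rewrite po card_orbit_free -?orderE // => h.
  rewrite /= (cycle2g ot) !inE => /orP[]/eqP-> // ty.
  by rewrite (order2_fix_uniq tG ot tx ty) eqxx in yx.
have cx : #|porbit t x| = 1.
  apply/eqP/cards1P; exists x; apply/setP => y; rewrite inE.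
  apply/idP/eqP => [/porbitP[i ->] | ->]; last exact: porbit_id.
  by rewrite permX; elim: i => //= i ->.
have := card_partition pp; rewrite cardsT card_vertices (bigD1 (porbit t x)) /=; last first.
  exact: imset_f.
rewrite cx (eq_bigr (fun=> 2)) => [|O /andP[/imsetP[y _ ->] Oy]]; last first.
  by apply: cy; apply: contraNneq Oy => ->.
rewrite sum_nat_const => E.
(* The sign compares the parity of 99 with that of the number of cycles, 1 + 49. *)
rewrite /odd_perm card_vertices /=.
have -> : #|porbits t| = 50; last by [].
rewrite (cardD1 (porbit t x)) imset_f //.
have -> : #|[predD1 porbits t & porbit t x]| = 49; last by [].
have : 1 + #|[predD1 porbits t & porbit t x]| * 2 = 99; last by clear; lia.
rewrite [RHS]E; congr (1 + _ * 2); apply: eq_card => O.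
by rewrite !inE andbC.
Qed.

(** * Automorphism groups of order 14, 18 and 22 *)

Section OrbitQuotient.

Variables (H : {group {perm T}}) (X : seq T) (x0 : T).
Hypotheses (HG : H \subset G)
  (sumX : forall F : T -> nat,
     \sum_y F y = \sum_(r <- X) \sum_(y in orbit 'P H r) F y)
  (disjX : pairwise (fun x y => y \notin orbit 'P H x) X).

Let O i := orbit 'P H (nth x0 X i).

Let degO y z i : z \in orbit 'P H y -> deg z (O i) = deg y (O i).
Proof.
case/orbitP => h hH <-; apply: (deg_invariant _ HG hH) => k u kH.
case/orbitP => l lH <-; apply/orbitP; exists (l * k)%g; first exact: groupM.
by rewrite /= /aperm permM.
Qed.

(** By [degO] the orbits form an equitable partition. The three conditions are the valency, the
    count of edges between two orbits, and [sum_nbr_deg]. *)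
Lemma orbit_quotient_matrix :
  quotient_matrix [seq #|orbit 'P H r| | r <- X] (fun i j => deg (nth x0 X i) (O j)).
Proof.
have sumO (F : T -> nat) : \sum_y F y = \sum_(k < size X) \sum_(y in O k) F y.
  by rewrite sumX (big_nth x0) big_mkord.
have mE i : i < size X -> nth 0 [seq #|orbit 'P H r| | r <- X] i = #|O i|.
  by move=> iX; rewrite (nth_map x0).
have memO i j : i < size X -> j < size X -> (nth x0 X i \in O j) = (i == j).
  move=> iX jX; apply/idP/eqP => [iO | ->]; last exact: orbit_refl.
  have disj := pairwiseP x0 disjX.
  case: (ltngtP i j) => // ij.
    by have := disj i j iX jX ij; rewrite orbit_sym iO.
  by have := disj j i jX iX ij; rewrite iO.
split; rewrite size_map.
- move=> i iX; rewrite -(card_nbrs (nth x0 X i)) -sum1_card [RHS]big_mkcond [RHS]sumO /=.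
  by apply: eq_bigr => k _; rewrite degE; apply: eq_bigr => y _; rewrite inE; case: (e _ y).
- move=> i j iX jX; rewrite !mE // -!sum_nat_const.
  rewrite (eq_bigr (fun y => deg y (O j))) => [|y /degO-> //].
  rewrite [RHS](eq_bigr (fun y => deg y (O i))) => [|y /degO-> //].
  exact: sum_deg_sym.
move=> i j iX jX; rewrite mE // -(memO i j iX jX) -sum_nbr_deg; congr (_ + _).
rewrite [RHS]big_mkcond [RHS]sumO; apply: eq_bigr => k _.
rewrite degE big_distrl /=; apply: eq_bigr => y yO.
by rewrite (degO j yO) inE; case: (e _ y); rewrite ?mul1n.
Qed.

End OrbitQuotient.

Lemma order2_shifted t x y : t \in G -> #[t]%g = 2 -> t x = x -> e y (t y) -> e x y.
Proof.
move=> tG ot tx ey; have [z Fz] := order2_fix tG ot.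
have t1 : t != 1%g by apply/eqP => t1; rewrite t1 order1 in ot.
have /card_gt0P[u] : 0 < deg y (fixpts t).
  by rewrite (deg_shifted_fixpts tG (order2_involutive ot)) ?inE.
by rewrite !inE => /andP[eyu /eqP tu]; rewrite -(order2_fix_uniq tG ot tx tu) e_sym.
Qed.

Lemma deg_free_orbit (H : {group {perm T}}) y z :
    (forall h, h \in H -> h y = y -> h = 1%g) ->
  deg z (orbit 'P H y) = #|[set h in H | e z (h y)]|.
Proof.
move=> fr; have inj : {in H &, injective (fun h : {perm T} => h y)}.
  move=> g h gH hH /= gh; apply/eqP; rewrite eq_mulgV1; apply/eqP/fr.
    by rewrite groupM ?groupV.
  by rewrite permM gh permK.
rewrite -(card_in_imset (f := fun h : {perm T} => h y)) => [|g h].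
  apply: eq_card => u; rewrite !inE; apply/andP/imsetP => [[ezu /orbitP[h hH hE]] | [h]].
    by exists h; rewrite // inE hH /=; move: ezu; rewrite -hE.
  by rewrite inE => /andP[hH ezh] ->; split=> //; apply: mem_orbit.
by rewrite !inE => /andP[gH _] /andP[hH _]; apply: inj.
Qed.

(** Inversion acts on the set of h with y adjacent to h y, and its fixed points there would be
    involutions. *)
Lemma even_free_orbit_deg (H : {group {perm T}}) y :
    (forall h, h \in H -> h y = y -> h = 1%g) ->
    (forall h, h \in H -> #[h]%g = 2 -> ~~ e y (h y)) ->
    H \subset G ->
  2 %| deg y (orbit 'P H y).
Proof.
move=> fr n2 HG; rewrite deg_free_orbit //.
apply: (@dvdn_card_cyclic_map _ 2 (fun h => h^-1)%g) => // h; rewrite inE => /andP[hH ey].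
- rewrite inE groupV hH -(aut_adj _ _ (subsetP HG h hH)) permKV e_sym.
  exact: ey.
- by rewrite /= invgK.
apply/eqP => hV; have h2 : (h ^+ 2 = 1)%g by rewrite expgS expg1 -{1}hV mulVg.
have : #[h]%g %| 2 by rewrite order_dvdn h2.
rewrite dvdn_divisors // !inE => /orP[]; last by move/eqP/(n2 h hH); rewrite ey.
by rewrite order_eq1 => /eqP h1; rewrite h1 perm1 e_irr in ey.
Qed.

(** The orbits are x, its neighbourhood and six regular orbits at distance two. A vertex of the
    latter has two neighbours in the neighbourhood of x, which leaves twelve for the six orbits. *)
Definition order14_sizes := [:: 1; 14; 14; 14; 14; 14; 14; 14].

Definition order14_rows :=
  [:: [:: [:: 0; 14; 0; 0; 0; 0; 0; 0]]; [:: [:: 1; 1; 2; 2; 2; 2; 2; 2]]]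
  ++ nseq 6 [seq [:: 0, 2 & r] | r <- compositions 12 6].

Definition bitseqs n : seq bitseq :=
  iter n (fun L => [seq b :: l | b <- [:: true; false], l <- L]) [:: [::]].

Lemma mem_bitseqs n (l : bitseq) : size l = n -> l \in bitseqs n.
Proof.
elim: n l => [|n IHn] [|b l] // -[szl]; rewrite /bitseqs iterS.
by apply/allpairsP; exists (b, l); split; rewrite ?IHn //; case: b.
Qed.

(* Three of the six orbits at distance two are split evenly by a bipartition of
   the neighbourhood; every vertex has an even number of neighbours in them. *)
Definition order14_parity (M : seq (seq nat)) :=
  has (fun mu => (count id mu == 3) &&
                 all (fun r => ~~ odd (sumn (mask mu (drop 2 r)))) (drop 2 M))
      (bitseqs 6).

(** The diagonal entries from index 2 on are even by [even_free_orbit_deg]: an involution maps only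
    the neighbours of its fixed vertex to adjacent vertices. *)
Lemma order14_refute :
  refute order14_sizes order14_parity
    (mkseq (fun i => [seq r <- nth [::] order14_rows i |
       diagonal_ok order14_sizes i r && ((i < 2) || ~~ odd (nth 0 r i))]) 8) [::].
Proof. by vm_compute. Qed.

Lemma order7_fix g : g \in G -> #[g]%g = 7 -> exists x, fixpts g = [set x].
Proof.
move=> gG og; apply/cards1P.
by case: (odd_prime_automorphism gG og) => // -[] // _ ->.
Qed.

Section Order14.

Variables s t : {perm T}.
Hypotheses (sG : s \in G) (tG : t \in G) (os : #[s]%g = 7) (ot : #[t]%g = 2)
  (cst : commute s t).

Let H : {group {perm T}} := <[(s * t)%g]>%G.

Let HG : H \subset G. Proof. by rewrite cycle_subG groupM. Qed.

Let oH : #|H| = 14.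
Proof. by rewrite -orderE orderM ?os ?ot. Qed.

Lemma no_order14 : False.
Proof.
have [x Fx] := order7_fix sG os; have sx := fixpts1_fix Fx.
have tx : t x = x.
  by apply/set1P; rewrite -Fx inE -!permM -cst permM sx.
have hx h : h \in H -> h x = x.
  case/cycleP => i ->; rewrite permX; elim: i => //= i ->.
  by rewrite permM sx tx.
(* The square of h lies in <s>. If it is nontrivial, its only fixed vertex is x; otherwise h is 1 or
   an involution fixing x. *)
have free h y : y != x -> h \in H -> h y = y -> h = 1%g.
  move=> yx hH hy; have hG := subsetP HG h hH.
  have h2s : (h ^+ 2 \in <[s]>)%g.
    case/cycleP: hH => i ->; rewrite -expgM mulnC expgM (expgMn 2 cst).
    have -> : (t ^+ 2 = 1)%g by rewrite -ot expg_order.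
    by rewrite mulg1 -expgM mem_cycle.
  have h2y : (h ^+ 2)%g y = y by rewrite permX /= !hy.
  have h21 : (h ^+ 2 = 1)%g.
    apply/eqP; rewrite -order_eq1; apply/negPn/negP => o1.
    have o7 : #[h ^+ 2]%g = 7.
      have : #[h ^+ 2]%g %| 7 by rewrite -os orderE order_dvdG.
      by rewrite dvdn_divisors // !inE (negPf o1) => /eqP.
    have [z Fz] := order7_fix (groupX 2 hG) o7.
    have inz u : (h ^+ 2)%g u = u -> u = z by move=> hu; apply/set1P; rewrite -Fz inE hu.
    case/eqP: yx; rewrite (inz y h2y) (inz x) // permX /= !hx //.
  apply/eqP; rewrite -order_eq1; apply/negPn/negP => o1.
  have o2 : #[h]%g = 2.
    have : #[h]%g %| 2 by rewrite order_dvdn h21.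
    by rewrite dvdn_divisors // !inE (negPf o1) => /eqP.
  by case/eqP: yx; apply: (order2_fix_uniq hG o2 (hx h hH) hy).
have cardO y : y != x -> #|orbit 'P H y| = 14.
  by move=> yx; rewrite card_orbit_free ?oH // => h; apply: free.
have orbx : orbit 'P H x = [set x].
  apply/setP => y; rewrite inE; apply/idP/eqP => [/orbitP[h hH <-] | ->].
    exact: hx.
  exact: orbit_refl.
have [a] : exists a, e x a.
  by have /card_gt0P[a] : 0 < #|N x| by [rewrite card_nbrs]; rewrite inE; exists a.
move=> exa; have ax : a != x by rewrite eq_sym adj_neq.
have orba : orbit 'P H a = N x.
  apply/eqP; rewrite eqEcard card_nbrs cardO // leqnn andbT.
  apply/subsetP => _ /orbitP[h hH <-]; rewrite inE -(hx h hH).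
  by rewrite [e _ _](aut_adj _ _ (subsetP HG h hH)).
pose G2 := [set y | (y != x) && ~~ e x y].
have G2H h y : h \in H -> y \in G2 -> h y \in G2.
  move=> hH; rewrite !inE -{3 4}(hx h hH) (inj_eq perm_inj) aut_adj //.
  exact: (subsetP HG).
have [X [XG2 pX sX]] := orbit_reps G2H.
have X2 y : y \in X -> (y != x) * (y != a) * ~~ e x y.
  move=> /XG2; rewrite inE => /andP[-> nxy]; split=> //; split=> //.
  by apply: contraNneq nxy => ->.
pose Y := [:: x, a & X].
have sumY (F : T -> nat) : \sum_y F y = \sum_(r <- Y) \sum_(y in orbit 'P H r) F y.
  by rewrite !big_cons -sX orbx orba big_set1 addnA (sum_distance x); congr (_ + _); apply: eq_bigl => y; rewrite inE.
have disjY : pairwise (fun y z => z \notin orbit 'P H y) Y.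
  rewrite /= orbx orba pX inE ax andbT /=; apply/andP; split.
    by apply/allP => y /X2[[yx _] _]; rewrite inE.
  by apply/allP => y /X2[_ nxy]; rewrite inE.
have cardX : size X = 6.
  have := sumY (fun=> 1); rewrite sum1_card card_vertices !big_cons orbx orba.
  rewrite !sum1_card cards1 card_nbrs big_seq.
  rewrite (eq_bigr (fun=> 14)) => [|r /X2[[rx _] _]]; last by rewrite sum1_card cardO.
  rewrite -big_seq big_const_seq count_predT iter_addn_0; move: (size X); lia.
have sizes : [seq #|orbit 'P H r| | r <- Y] = order14_sizes.
  rewrite /= orbx orba cards1 card_nbrs /order14_sizes; congr [:: _, _ & _].
  have : {in X, forall r, #|orbit 'P H r| = 14} by move=> r /X2[[rx _] _]; apply: cardO.
  move/eq_in_map->.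
  have -> : [seq 14 | _ <- X] = nseq (size X) 14 by elim: (X) => //= ? l ->.
  by rewrite cardX.
pose b i j := deg (nth x Y i) (orbit 'P H (nth x Y j)).
have Q : quotient_matrix order14_sizes b.
  by rewrite -sizes; apply: orbit_quotient_matrix.
have sizeY : size Y = 8 by rewrite /= cardX.
have X_nth i : nth x Y i.+2 \in X = (i < 6).
  rewrite /=; case: ltnP => i6; first by rewrite mem_nth ?cardX.
  by rewrite nth_default ?cardX //; apply/negP => /X2[[]]; rewrite eqxx.
have degx y : deg y [set x] = e x y.
  by rewrite degE big_set1 e_sym.
have degNx y : y \in G2 -> deg y (N x) = 2.
  rewrite inE => /andP[yx nxy]; rewrite /deg setIC common_nonadj // eq_sym //.
(* E is one half of the neighbourhood; t exchanges it with the other half, and every edge inside the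
   neighbourhood joins some y to t y. This is the bipartition behind [order14_parity]. *)
pose E := orbit 'P <[s]>%G a.
have sH : s \in H.
  have -> : s = ((s * t) ^+ 8)%g.
    have s7 : (s ^+ 7 = 1)%g by rewrite -os expg_order.
    have t2 : (t ^+ 2 = 1)%g by rewrite -ot expg_order.
    by rewrite (expgMn 8 cst) (expgS s 7) s7 (expgM t 2 4) t2 expg1n !mulg1.
  exact: mem_cycle.
have tH : t \in H by rewrite -[t](mulKg s) groupM ?groupV //; apply: cycle_id.
have Es y : (s y \in E) = (y \in E).
  by rewrite -[s y]/(aperm y s) (orbit_actr _ _ _ (cycle_id s)).
have sxN y : (s y \in N x) = (y \in N x) by rewrite -{1}sx nbrs_aut.
have txN y : (t y \in N x) = (y \in N x) by rewrite -{1}tx nbrs_aut.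
have aE : a \in E := orbit_refl _ _ _.
have EN : E \subset N x.
  apply/subsetP => _ /orbitP[h /cycleP[k ->] <-]; rewrite /= /aperm.
  elim: k => [|k IHk]; first by rewrite expg0 perm1 inE.
  by rewrite expgSr permM sxN.
have sEsub h : h \in <[s]>%g -> h \in H by apply/subsetP; rewrite cycle_subG.
have cardE : #|E| = 7.
  by rewrite card_orbit_free -?orderE // => h /sEsub; apply: free.
have taE : t a \notin E.
  apply/negP => /orbitP[h hs ha].
  have hta : (t * h^-1)%g a = a by rewrite permM -ha /aperm permK.
  have thH : (t * h^-1)%g \in H by rewrite groupM // groupV sEsub.
  have /eqP := free _ a ax thH hta.
  rewrite -eq_mulgV1 => /eqP th; rewrite -th in hs.
  by have := order_dvdG hs; rewrite ot -orderE os.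
have tE y : y \in E -> t y \notin E.
  case/orbitP => h hs <-; apply: contra taE => /orbitP[k ks kE].
  apply/orbitP; exists (k * h^-1)%g; first by rewrite groupM ?groupV.
  move: kE; rewrite /= /aperm permM => ->; have cth : commute t h.
    by case/cycleP: hs => l ->; apply/commuteX/commute_sym.
  by rewrite -[t (h a)]permM -cth permM permK.
have EtE y : y \in N x -> (t y \in E) = (y \notin E).
  move=> yN; apply/idP/idP => [tyE | yE].
    by have := tE _ tyE; rewrite order2_involutive.
  have : #|[set t z | z in E] :|: E| = 14.
    have disj : [set t z | z in E] :&: E = set0.
      apply/setP => z; rewrite !inE; apply/negP => /andP[/imsetP[u uE ->]].
      by rewrite (negPf (tE u uE)).
    by rewrite cardsU disj cards0 (card_imset _ (@perm_inj _ t)) cardE.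
  have sub : [set t z | z in E] :|: E \subset N x.
    rewrite subUset EN andbT; apply/subsetP => _ /imsetP[u uE ->].
    by rewrite txN (subsetP EN).
  move=> c14; have /setP/(_ y) : [set t z | z in E] :|: E = N x.
    by apply/eqP; rewrite eqEcard sub c14 card_nbrs.
  rewrite yN inE (negPf yE) orbF => /imsetP[u uE ->].
  by rewrite order2_involutive.
(* The vertices at distance two with one neighbour in each half; H preserves the bipartition and
   therefore M. *)
pose M := [set z in G2 | odd (deg z E)].
have degE2 y : y \in G2 -> deg y E + deg y (N x :\: E) = 2.
  by move=> yG; rewrite -(degNx y yG) /deg -(cardsID E (N y :&: N x)) -setIA (setIidPr EN) setIDA.
have stM z : z \in M -> (s * t)%g z \in M.
  rewrite !inE -!andbA => /and3P[zx nxz oz].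
  have stG : (s * t)%g \in G by rewrite groupM.
  have stx : (s * t)%g x = x by rewrite permM sx tx.
  have zG : z \in G2 by rewrite inE zx.
  apply/and3P; split.
  - by rewrite -stx (inj_eq perm_inj).
  - by rewrite -{1}stx (aut_adj _ _ stG).
  suff -> : deg ((s * t)%g z) E = deg z (N x :\: E).
    by have := degE2 z zG; move: oz; case: (deg z E) => [|[|[|]]] //= _; case: (deg z _) => [|[|]].
  apply: (deg_aut _ stG) => u; rewrite permM in_setD.
  have [uN | uN] := boolP (u \in N x); first by rewrite EtE ?sxN // Es andbT.
  by rewrite andbF; apply: contraNF uN => /(subsetP EN); rewrite txN sxN.
have MH h z : h \in H -> z \in M -> h z \in M.
  case/cycleP => i ->; elim: i z => [|i IHi] z zM; first by rewrite expg0 perm1.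
  by rewrite expgSr permM stM ?IHi.
have degEE y : y \in N x -> deg y E = (y \notin E).
  move=> yN; have exy : e x y by rewrite inE in yN.
  have mate u : u \in E -> e y u = (u == t y).
    move=> uE; apply/idP/eqP => [eyu | ->]; last exact: order2_flip exy.
    apply: (triangle_uniq exy) => //.
    - by have := subsetP EN u uE; rewrite inE.
    - by rewrite -tx aut_adj.
    exact: order2_flip exy.
  rewrite degE (eq_bigr _ (fun u uE => congr1 nat_of_bool (mate u uE))).
  rewrite -(EtE y yN); have [tyE | tyE] := boolP (t y \in E).
    by rewrite (bigD1 (t y)) //= eqxx big1 // => u /andP[_ /negPf->].
  by rewrite big1 // => u uE; case: eqP => // uty; rewrite -uty uE in tyE.
have degxE : deg x E = 7 by rewrite /deg (setIidPr EN) cardE.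
have degE0 y : y \in E -> deg y E = 0.
  by move=> yE; rewrite degEE ?yE //; apply: (subsetP EN).
have sumNE : \sum_(y in N x) (y \notin E) = 7.
  have -> : \sum_(y in N x) (y \notin E) = #|N x :\: E|.
    rewrite -sum1_card big_mkcond [RHS]big_mkcond; apply: eq_bigr => y _.
    by rewrite in_setD; case: (y \in N x); case: (y \in E).
  by have := cardsID E (N x); rewrite (setIidPr EN) cardE card_nbrs -[14]/(7 + 7) => /addnI.
have sum1 : \sum_(z in G2) deg z E = 84.
  have : \sum_z deg z E = 98.
    rewrite (eq_bigl (fun z => z \in [set: T])) => [|z]; last by rewrite inE.
    rewrite sum_deg_sym (eq_bigr (fun=> 14)) ?sum_nat_const ?cardE // => y _.
    by rewrite /deg setIT card_nbrs.
  rewrite (sum_distance x) degxE (eq_bigr _ degEE) sumNE.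
  by rewrite (eq_bigl (fun z => z \in G2)) => [|z]; [move: (\sum_(z in G2) _); clear; lia | rewrite inE].
have sum2 : \sum_(z in G2) deg z E * deg z E = 126.
  have := sum_deg_mul E E; rewrite (sum_distance x) degxE.
  have -> : \sum_(y in N x) deg y E * deg y E = 7.
    by rewrite -sumNE; apply: eq_bigr => y /degEE->; case: (y \in E).
  rewrite [\sum_(y in E) deg y E]big1 //.
  have -> : \sum_(y in E) (12 * (y \in E) + 2 * #|E|) = 182.
    by rewrite (eq_bigr (fun=> 26)) => [|y ->]; rewrite ?sum_nat_const cardE.
  rewrite (eq_bigl (fun z => z \in G2)) => [|z]; last by rewrite inE.
  by move: (\sum_(z in G2) _); clear; lia.
(* For d = 0, 1, 2 the parity of d is 2d - d^2, so the two sums give 168 - 126 = 42, three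
   orbits. *)
have cardM : #|M| = 42.
  have : #|M| + \sum_(z in G2) deg z E * deg z E = \sum_(z in G2) deg z E * 2.
    rewrite -sum1_card (eq_bigl (fun z => (z \in G2) && odd (deg z E))) => [|z]; last by rewrite inE.
    rewrite big_mkcondr -big_split /=; apply: eq_bigr => z /degE2.
    by case: (deg z E) => [|[|[|]]].
  by rewrite sum2 -big_distrl /= sum1; clear; lia.
(* Over the neighbours z of y at distance two, the numbers [deg z E] have the even sum 12, so an
   even number of them are odd. *)
have evenM y : y \in G2 -> ~~ odd (deg y M).
  move=> yG; have /andP[yx nxy] : (y != x) && ~~ e x y by rewrite inE in yG.
  have yE : y \notin E by apply: contra nxy => /(subsetP EN); rewrite inE.
  have tot : \sum_(z in G2) e y z * deg z E = 12.
    have := sum_nbr_deg y E; rewrite (negPf yE) cardE.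
    have -> : \sum_(z in N y) deg z E = \sum_z e y z * deg z E.
      by rewrite big_mkcond; apply: eq_bigr => z _; rewrite inE; case: (e y z); rewrite ?mul1n.
    rewrite (sum_distance x) e_sym (negPf nxy) mul0n add0n.
    have -> : \sum_(z in N x) e y z * deg z E = deg y (N x :\: E).
      rewrite degE big_mkcond [RHS]big_mkcond; apply: eq_bigr => z _.
      rewrite in_setD; case: (boolP (z \in N x)) => zN; rewrite ?andbF // andbT.
      by rewrite degEE //; case: (z \in E); rewrite ?muln0 ?muln1.
    rewrite (eq_bigl (fun z => z \in G2)) => [|z]; last by rewrite inE.
    by have := degE2 y yG; move: (\sum_(z in G2) _) (deg y E) (deg y (_ :\: _)); clear; lia.
  have : deg y M + (\sum_(z in G2) e y z * (deg z E)./2) * 2 = 12.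
    rewrite -tot big_distrl /= degE (eq_bigl (fun z => (z \in G2) && odd (deg z E))) => [|z]; last by rewrite inE.
    rewrite big_mkcondr -big_split /=; apply: eq_bigr => z _.
    rewrite -{3}(odd_double_half (deg z E)) -muln2; case: (e y z); case: odd; rewrite ?mul0n ?mul1n //.
  by move: (deg y M) (\sum_(z in G2) _); clear => u v; lia.
have := quotient_matrix_refute (m := order14_sizes) (gens := order14_rows)
  (extra := fun i r => (i < 2) || ~~ odd (nth 0 r i)) (final := order14_parity) isT Q erefl.
rewrite order14_refute => H'; suff : ~~ true by [].
apply: H' => // [i i8|i i8|].
- have [Q1 Q2 _] := Q.
  have b00 : b 0 0 = 0 by rewrite /b /= orbx degx e_irr.
  have b01 : b 0 1 = 14 by rewrite /b /= orba /deg setIid card_nbrs.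
  have b11 : b 1 1 = 1 by rewrite /b /= orba /deg setIC common_adj.
  have b10 : b 1 0 = 1 by have := Q2 1 0 isT isT; rewrite b01; move: (b 1 0) => /= u; clear; lia.
  have bi0 k : k < 6 -> b k.+2 0 = 0.
    by rewrite -X_nth => /X2[_ nxy]; rewrite /b /= orbx degx (negPf nxy).
  have bi1 k : k < 6 -> b k.+2 1 = 2.
    by rewrite -X_nth => /XG2; rewrite /b {2}/nth orba; apply: degNx.
  have b1i k : k < 6 -> b 1 k.+2 = 2.
    move=> k6; have e14 : nth 0 order14_sizes k.+2 = 14.
      by case: k k6 => [|[|[|[|[|[|]]]]]].
    have := Q2 1 k.+2 isT k6; rewrite bi1 // e14; move: (b 1 _) => u; clear.
    by rewrite /order14_sizes /=; lia.
  have b0i k : k < 6 -> b 0 k.+2 = 0.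
    move=> k6; have := Q1 0 isT; rewrite !big_ord_recl big_ord0 /= b00 b01.
    move: (b 0) => b0; clear -k6; case: k k6 => [|[|[|[|[|[|]]]]]] //= _; rewrite /bump /= ?add1n; lia.
  case: i i8 => [|[|i]] i8.
  + by rewrite inE /mkseq /= b00 b01 !b0i.
  + by rewrite inE /mkseq /= b10 b11 !b1i.
  have -> : nth [::] order14_rows i.+2 = [seq [:: 0, 2 & r] | r <- compositions 12 6].
    by case: i i8 => [|[|[|[|[|[|]]]]]].
  apply/mapP; exists (mkseq (fun k => b i.+2 k.+2) 6); last by rewrite /mkseq /= bi0 // bi1.
  have := mem_compositions (mkseq (fun k => b i.+2 k.+2) 6); rewrite size_mkseq.
  suff -> : sumn (mkseq (fun k => b i.+2 k.+2) 6) = 12 by [].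
  have := Q1 i.+2 i8; rewrite !big_ord_recl big_ord0 /= bi0 // bi1 // /bump /= !add1n.
  by move: (b i.+2) => b0; clear; lia.
- case: i i8 => [//|[//|i]] i8; rewrite nth_mkseq // -dvdn2 orFb.
  have := X_nth i; rewrite (i8 : i < 6) => /X2[[yx _] nxy].
  apply: even_free_orbit_deg => // [h|h hH oh]; first exact: free.
  apply: contra nxy; apply: (order2_shifted _ oh (hx h hH)).
  exact: (subsetP HG).
apply/hasP; exists [seq z \in M | z <- X]; first by apply: mem_bitseqs; rewrite size_map.
have MO r z : z \in orbit 'P H r -> (z \in M) = (r \in M).
  case/orbitP => h hH <-; apply/idP/idP => [hr | ]; last exact: MH.
  by rewrite -(permK h r); apply: MH; rewrite ?groupV.
apply/andP; split.
  have := cardM; rewrite -sum1_card (eq_bigl (fun z => (z \in G2) && (z \in M))) => [|z].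
    rewrite big_mkcondr sX big_seq (eq_bigr (fun r => (r \in M) * 14)) => [|r /X2[[rx _] _]].
      have cE : \sum_(r <- X) (r \in M) = count (fun r => r \in M) X.
        by rewrite -sum1_count [RHS]big_mkcond; apply: eq_bigr => r _; case: (r \in M).
      rewrite -big_seq -big_distrl /= cE count_map -[42]/(3 * 14).
      by move=> /eqP; rewrite eqn_pmul2r.
    rewrite (eq_bigr (fun=> (r \in M) : nat)) => [|z /MO->].
      by rewrite sum_nat_const cardO // mulnC.
    by case: (r \in M).
  by rewrite [z \in M]inE andbA andbb.
have -> : drop 2 (mkseq (fun i => mkseq (b i) (size order14_sizes)) (size order14_sizes))
    = mkseq (fun i => mkseq (b i.+2) 8) 6 by [].
apply/allP => row /mapP[k]; rewrite mem_iota /= add0n => k6 ->.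
have := k6; rewrite -X_nth; set y := nth x Y k.+2 => /XG2/evenM; congr (~~ odd _).
have -> : drop 2 (mkseq (b k.+2) 8) = [seq deg y (orbit 'P H r) | r <- X].
  rewrite -[in RHS](mkseq_nth x X) /mkseq -map_comp cardX.
  by [].
have -> : mask [seq z \in M | z <- X] [seq deg y (orbit 'P H r) | r <- X]
    = [seq deg y (orbit 'P H r) | r <- X & r \in M].
  by elim: (X) => //= r X' ->; case: (r \in M).
rewrite sumnE big_map big_filter degE.
rewrite (eq_bigl (fun z => (z \in G2) && (z \in M))) => [|z].
  rewrite big_mkcondr sX big_seq [RHS]big_mkcond [RHS]big_seq; apply: eq_bigr => r rX.
  rewrite degE; case: ifP => rM.
    by apply: eq_bigr => z /MO->; rewrite rM.
  by rewrite big1 // => z /MO->; rewrite rM.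
by rewrite [z \in M]inE andbA andbb.
Qed.

End Order14.

(** * Elements inverted by an involution, and order 22 *)

Lemma inverted_act t g y : (g ^ t = g^-1)%g -> t (g y) = (g^-1)%g (t y).
Proof. by move=> gt; rewrite -!permM -gt -conjgC. Qed.

Section Inverted.

Variables (t : {perm T}) (x : T).
Hypotheses (tG : t \in G) (ot : #[t]%g = 2) (tx : t x = x).

Lemma mul_conj_fix (W : {group {perm T}}) w :
    abelian W -> w \in W -> t \in 'N(W)%g -> W \subset G ->
  (w * w ^ t)%g x = x.
Proof.
move=> abW wW tW WG; have wtW : (w ^ t)%g \in W by rewrite memJ_norm.
have c : commute (w * w ^ t)%g t.
  have tt : (t * t = 1)%g by apply/permP => y; rewrite permM order2_involutive ?perm1.
  by apply/commgP/conjg_fixP; rewrite conjMg -conjgM tt conjg1 (centsP abW _ wtW _ wW).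
by apply: (order2_fix_uniq tG ot tx); rewrite -permM c permM tx.
Qed.

(** Since t maps g x to g^-1 x, the vertices x, g x and g^-1 x form a triangle. Its image under g
    also contains the edge from x to g x, so the third vertices g^2 x and g^-1 x agree. *)
Lemma inverted_adj g : g \in G -> (g ^ t = g^-1)%g -> e x (g x) -> (g ^+ 3)%g x = x.
Proof.
move=> gG gt exg; have gVG : (g^-1)%g \in G by rewrite groupV.
have egV : e (g x) (g^-1 x)%g.
  by rewrite -{2}tx -inverted_act //; apply: order2_flip exg.
have gE y : e (g^-1 y)%g x = e y (g x) by rewrite -(aut_adj _ x gG) permKV.
have -> : (g ^+ 3)%g x = g (g (g x)) by rewrite permX.
suff -> : g (g x) = (g^-1 x)%g by rewrite permKV.
apply: (triangle_uniq exg); last exact: egV.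
- by rewrite -(aut_adj x (g (g x)) gVG) permK e_sym.
- by rewrite aut_adj.
- by rewrite e_sym gE.
Qed.

(** The involution t acts on this set, and x is the only vertex that it can fix there. *)
Lemma odd_shifted_adj g : g \in G -> (g ^ t = g^-1)%g ->
  odd #|shifted_adj g| = e x (g x).
Proof.
move=> gG gt; have t2 : 2.-elt t by rewrite /p_elt ot.
have tS y : y \in shifted_adj g -> t y \in shifted_adj g.
  rewrite !inE => ey; have -> : g (t y) = t ((g^-1)%g y).
    have gVt : (g^-1 ^ t = g^-1^-1)%g by rewrite conjVg gt.
    by rewrite (inverted_act y gVt) invgK.
  by rewrite aut_adj // -(aut_adj _ _ gG) permKV e_sym.
have := card_fix_mod t2 tS; rewrite !modn2.
suff -> : #|[set y in shifted_adj g | t y == y]| = e x (g x) by case: (odd #|shifted_adj g|); case: (e x (g x)).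
have [exg | nxg] := boolP (e x (g x)).
  have -> : [set y in shifted_adj g | t y == y] = [set x]; last exact: cards1.
  apply/setP => y; rewrite !inE; apply/andP/eqP => [[_ /eqP ty] | ->].
    exact: order2_fix_uniq ty.
  by rewrite tx.
rewrite (_ : [set y in _ | _] = set0) ?cards0 //; apply/setP => y; rewrite !inE.
by apply/negP => /andP[ey /eqP ty]; rewrite (order2_fix_uniq tG ot tx ty) (negPf nxg) in ey.
Qed.

End Inverted.

Lemma order11_free (u : {perm T}) : u \in G -> #[u]%g = 11 -> forall y, u y != y.
Proof.
move=> uG ou y; apply/eqP => uy.
case: (odd_prime_automorphism uG ou) => // -[] // _ /setP/(_ y).
by rewrite !inE uy eqxx.
Qed.

Lemma no_order11_normalized (u : {perm T}) t : u \in G -> t \in G -> #[u]%g = 11 -> #[t]%g = 2 ->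
  t \in 'N(<[u]>)%g -> False.
Proof.
move=> uG tG ou ot tN; have [x Fx] := order2_fix tG ot; have tx := fixpts1_fix Fx.
have uG' : <[u]>%g \subset G by rewrite cycle_subG.
have o11 (v : {perm T}) : v \in <[u]>%g -> v != 1%g -> #[v]%g = 11.
  move=> vu v1; have : #[v]%g %| 11 by rewrite -ou orderE order_dvdG.
  by rewrite dvdn_divisors // !inE order_eq1 (negPf v1) => /eqP.
have inv (v : {perm T}) : v \in <[u]>%g -> (v ^ t = v^-1)%g.
  move=> vu; have := mul_conj_fix tG ot tx (cycle_abelian u) vu tN uG'.
  move=> vx; apply/eqP; rewrite eq_sym eq_invg_mul; apply/negPn/negP => v1.
  have vtu : (v * v ^ t)%g \in <[u]>%g by rewrite groupM // memJ_norm.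
  by have := order11_free (subsetP uG' _ vtu) (o11 _ vtu v1) x; rewrite vx eqxx.
(* The number is congruent to 4 modulo 7, divisible by 11, even and at most 99. *)
have card88 (v : {perm T}) : v \in <[u]>%g -> v != 1%g -> #|shifted_adj v| = 88.
  move=> vu v1; have vG := subsetP uG' v vu; have ov := o11 v vu v1.
  have F0 : fixpts v = set0.
    by apply/setP => y; rewrite !inE (negPf (order11_free vG ov y)).
  have := trace_mod7 vG; rewrite F0 cards0 => tr.
  have d11 : 11 %| #|shifted_adj v| by apply: dvdn_shifted_adj; rewrite // /p_elt ov.
  have := odd_shifted_adj tG ot tx vG (inv v vu).
  have -> : e x (v x) = false.
    apply: contraTF (order11_free (groupX 3 vG) _ x) => [exv | ].
      by rewrite negbK; apply/eqP/(inverted_adj tG ot tx) => //; apply: inv.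
    by rewrite orderXgcd ov.
  have le : #|shifted_adj v| <= 99 by rewrite -card_vertices; apply: max_card.
  by move: #|_| tr d11 le => n; clear; lia.
have u1 : u != 1%g by rewrite -order_eq1 ou.
have u2 : (u ^+ 2 != 1)%g by rewrite -order_eq1 orderXgcd ou.
(* Two sets of 88 among 99 vertices meet. If y is adjacent to u y and u^2 y, then u^2 y and u^-1 y
   are both the third vertex of the triangle on y and u y, so u^3 fixes y. *)
have : 0 < #|shifted_adj u :&: shifted_adj (u ^+ 2)%g|.
  have := cardsUI (shifted_adj u) (shifted_adj (u ^+ 2)%g).
  rewrite !card88 ?cycle_id ?mem_cycle //.
  have : #|shifted_adj u :|: shifted_adj (u ^+ 2)%g| <= 99.
    by rewrite -card_vertices; apply: max_card.
  by move: #|_| #|_| => a b; clear; lia.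
case/card_gt0P => y; rewrite !inE => /andP[e1 e2].
have uVG : (u^-1)%g \in G by rewrite groupV.
have e2' : e y (u (u y)) by move: e2; rewrite permX.
have o3 : #[u ^+ 3]%g = 11 by rewrite orderXgcd ou.
have /eqP := order11_free (groupX 3 uG) o3 y; apply; rewrite permX /=.
suff -> : u (u y) = (u^-1)%g y by rewrite permKV.
apply: (triangle_uniq e1) => //; first by rewrite aut_adj.
  by rewrite -(aut_adj _ _ uG) permKV e_sym.
by rewrite -(aut_adj _ _ uG) permKV e_sym.
Qed.

(** * Fixed triangles of elements of order 3, and order 18 *)

Lemma order3_fix_triangle w y z : w \in G -> #[w]%g = 3 ->
  w y = y -> w z = z -> (#|fixpts w| = 3) * (deg y (fixpts w) = 2) * (y != z -> e y z).
Proof.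
move=> wG ow wy wz; have yF : y \in fixpts w by rewrite inE wy.
have c3 : #|fixpts w| = 3.
  case: (odd_prime_automorphism wG ow) => // -[] // _ [F0|//].
  by rewrite F0 inE in yF.
have f2 : deg y (fixpts w) = 2.
  have ow' : odd #[w]%g by rewrite ow.
  have := fixed_count_odd wG ow' wy; rewrite c3; move: (deg y _) => f; clear; nia.
split=> // yz; have : N y :&: fixpts w = fixpts w :\ y.
  have e2 : #|fixpts w :\ y| = 2 by have := cardsD1 y (fixpts w); rewrite c3 yF => -[].
  apply/eqP; rewrite eqEcard -/(deg y _) f2 e2 leqnn andbT.
  apply/subsetP => u; rewrite in_setI in_setD1 inE => /andP[eyu ->]; rewrite andbT.
  by rewrite eq_sym adj_neq.
by move/setP/(_ z); rewrite in_setI in_setD1 !inE wz eqxx (eq_sym z) yz !andbT => ->.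
Qed.

Lemma cycle_fix g h y : g y = y -> h \in <[g]>%g -> h y = y.
Proof. by move=> gy /cycleP[i ->]; rewrite permX; elim: i => //= i ->. Qed.

(** Let g be central of order 3 in Q. As 3-elements fixing x, the members of Q fix the whole
    triangle of g. None but 1 fixes a further vertex, so Q acts freely on the other 96 vertices, and
    the 3-part of 96 is 3. *)
Lemma card_3group_fix (Q : {group {perm T}}) x :
  Q \subset G -> 3.-group Q -> (forall h, h \in Q -> h x = x) -> #|Q| %| 3.
Proof.
move=> QG pQ Qx; have [-> | ntQ] := eqVneq Q 1%G; first by rewrite cards1.
have [g gZ og] : exists2 g, g \in 'Z(Q)%g & #[g]%g = 3.
  have pZ : 3.-group 'Z(Q)%g := pgroupS (center_sub Q) pQ.
  have ntZ : ('Z(Q) != 1)%g by rewrite center_nil_eq1 // (pgroup_nil pQ).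
  have [_ d3 _] := pgroup_pdiv pZ ntZ.
  by have [g] := Cauchy (isT : prime 3) d3; exists g.
have gQ : g \in Q := subsetP (center_sub Q) g gZ.
have gG := subsetP QG g gQ; have gx := Qx g gQ.
have [[c3 _] _] := order3_fix_triangle gG og gx gx.
have QF h y : h \in Q -> y \in fixpts g -> h y = y.
  move=> hQ yF; have [-> | yx] := eqVneq y x; first exact: Qx.
  have hF z : z \in fixpts g :\ x -> h z \in fixpts g :\ x.
    rewrite !inE => /andP[zx /eqP gz]; apply/andP; split.
      by rewrite -(Qx h hQ) (inj_eq perm_inj).
    have /centerP[_ /(_ h hQ) cgh] := gZ.
    by rewrite -permM -cgh permM gz.
  have ph : 3.-elt h := mem_p_elt pQ hQ.
  have := card_fix_mod ph hF; have xF : x \in fixpts g by rewrite inE gx.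
  have c2 : #|fixpts g :\ x| = 2 by have := cardsD1 x (fixpts g); rewrite c3 xF => -[].
  rewrite c2 => E2.
  have sub : [set z in fixpts g :\ x | h z == z] \subset fixpts g :\ x.
    by apply/subsetP => z; rewrite inE => /andP[].
  have : [set z in fixpts g :\ x | h z == z] = fixpts g :\ x.
    apply/eqP; rewrite eqEcard sub c2.
    by move: E2; case: #|_| => [|[|]].
  by move/setP/(_ y); rewrite in_set in_setD1 yx yF /= => /eqP.
have free h y : h \in Q -> y \in ~: fixpts g -> h y = y -> h = 1%g.
  move=> hQ yF hy; apply/eqP/negPn/negP => h1.
  have ph : 3.-group <[h]>%g := mem_p_elt pQ hQ.
  have nth : (<[h]> != 1)%g by rewrite cycle_eq1.
  have [_ d3 _] := pgroup_pdiv ph nth.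
  have [k kh ok] := Cauchy (isT : prime 3) d3.
  have kQ : k \in Q by apply: (subsetP _ k kh); rewrite cycle_subG.
  have kG := subsetP QG k kQ.
  have sub : y |: fixpts g \subset fixpts k.
    rewrite subUset sub1set inE (cycle_fix hy kh) eqxx.
    by apply/subsetP => z zF; rewrite inE QF.
  have := subset_leq_card sub; rewrite cardsU1 -in_setC yF c3.
  by rewrite (order3_fix_triangle kG ok (Qx k kQ) (Qx k kQ)).1.1.
have d96 : #|Q| %| 96.
  have -> : 96 = #|~: fixpts g|.
    by have := cardsC (fixpts g); rewrite c3 card_vertices => -[].
  apply: dvdn_card_free => h y hQ; last exact: free.
  rewrite !inE; apply: contra => /eqP ghy; apply/eqP.
  have /centerP[_ /(_ h hQ) cgh] := gZ.
  by apply: (@perm_inj _ h); rewrite -permM cgh permM ghy.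
have : #|Q| %| 96`_3 by rewrite -(part_pnat_id pQ) partn_dvd.
by have -> : 96`_3 = 3 by rewrite p_part.
Qed.

Lemma prime_cycle_fix g h y : prime #[g]%g -> h \in <[g]>%g -> h != 1%g ->
  h y = y -> g y = y.
Proof.
move=> pg hg h1 hy; apply: (cycle_fix hy); suff -> : <[h]>%g = <[g]>%g by exact: cycle_id.
apply/eqP; rewrite eqEcard cycle_subG hg -!orderE.
have [_ dp] := primeP pg; have hg' : #[h]%g %| #[g]%g by rewrite [#[g]%g]orderE order_dvdG.
by have := dp _ hg'; rewrite order_eq1 (negPf h1) => /eqP->; rewrite leqnn.
Qed.

Lemma in_nbrs x y : (y \in N x) = e x y.
Proof. by rewrite inE. Qed.

(* Here w, w v and w v^2 fix disjoint triangles and v moves every vertex. The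
   other 90 vertices are classified by the triangles they are adjacent to; v maps
   72 of them to a neighbour, which has to be in the same class, and this is
   incompatible with the sizes of the classes. *)
Section MixedOrder18.

Variables (W : {group {perm T}}) (t w v : {perm T}).
Hypotheses (WG : W \subset G) (oW : #|W| = 9) (abW : abelian W) (tG : t \in G)
  (ot : #[t]%g = 2) (wW : w \in W) (vW : v \in W) (ow : #[w]%g = 3) (ov : #[v]%g = 3)
  (cwt : commute w t) (vt : (v ^ t = v^-1)%g) (vnw : v \notin <[w]>%g).

Let wG : w \in G := subsetP WG w wW.
Let vG : v \in G := subsetP WG v vW.
Let cwv : commute w v. Proof. exact: (centsP abW). Qed.
Let w3 : (w ^+ 3 = 1)%g. Proof. by rewrite -ow expg_order. Qed.
Let v3 : (v ^+ 3 = 1)%g. Proof. by rewrite -ov expg_order. Qed.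

Let W_elt h : h \in W -> exists i j, [/\ i < 3, j < 3 & h = (w ^+ i * v ^+ j)%g].
Proof.
have EW : (<[w]> * <[v]>)%g = W.
  apply/eqP; rewrite eqEcard mul_subG ?cycle_subG // TI_cardMg -?orderE ?ow ?ov ?oW //.
  rewrite setIC prime_TIg -?orderE ?ov //.
  by rewrite cycle_subG.
rewrite -EW => /mulsgP[_ _ /cycleP[i ->] /cycleP[j ->] ->].
exists (i %% 3), (j %% 3); rewrite !ltn_mod; split=> //.
by rewrite -{1}ow -{1}ov !expg_mod_order.
Qed.

Let tv y : t (v y) = (v^-1)%g (t y). Proof. exact: inverted_act. Qed.
Let tw y : t (w y) = w (t y). Proof. by rewrite -!permM cwt. Qed.

Let Fix j := fixpts (w * v ^+ j)%g.

(** Otherwise t, inverting v, permutes the three fixed vertices of v and fixes one of them; w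
    commutes with t and fixes it too, so W has a fixed vertex, contrary to [card_3group_fix]. *)
Let v_free y : v y != y.
Proof.
apply/negP => /eqP vy; have [x Fx] := order2_fix tG ot; have tx := fixpts1_fix Fx.
have v2 : 2.-elt t by rewrite /p_elt ot.
have tF z : z \in fixpts v -> t z \in fixpts v.
  rewrite !inE => /eqP vz; apply/eqP; rewrite -{1}vz tv permKV //.
have := card_fix_mod v2 tF.
rewrite (order3_fix_triangle vG ov vy vy).1.1 !modn2 => odd_fix.
have : 0 < #|[set z in fixpts v | t z == z]| by case: #|_| odd_fix.
case/card_gt0P => z; rewrite !inE => /andP[/eqP vz /eqP tz].
have wz : w z = z by apply: (order2_fix_uniq tG ot tz); rewrite tw tz.
have : #|W| %| 3.
  apply: (card_3group_fix (x := z)) => // [|h]; first by rewrite /pgroup oW.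
  case/W_elt => i [j [_ _ ->]]; rewrite permM.
  by rewrite (cycle_fix wz (mem_cycle w i)) (cycle_fix vz (mem_cycle v j)).
by rewrite oW.
Qed.

(** Powers of v other than 1 act freely, and every element outside <v> is some w v^k or has such an
    element as its square. *)
Let W_fix h y : h \in W -> h != 1%g -> h y = y ->
  [|| y \in Fix 0, y \in Fix 1 | y \in Fix 2].
Proof.
case/W_elt=> i [j [i3 j3 hE]] h1 hy.
case: i i3 hE => [|[|[|]]] // _ hE.
- have := v_free y; rewrite (prime_cycle_fix (h := h)) ?ov //.
    by rewrite eqxx.
  by rewrite hE mul1g mem_cycle.
- rewrite expg1 in hE; rewrite !inE.
  by case: j j3 hE => [|[|[|]]] // _ <-; rewrite hy eqxx ?orbT.
have hhy : (h ^+ 2)%g y = y by rewrite permX /= !hy.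
have hh : (h ^+ 2 = w * v ^+ (j * 2))%g.
  rewrite hE expgMn; last by apply/commuteX/commute_sym/commuteX/commute_sym.
  by rewrite -!expgM -[(2 * 2)%N]/(3 + 1)%N expgD w3 mul1g expg1.
have hhE k : (h ^+ 2 = w * v ^+ k)%g -> y \in Fix k by move=> hk; rewrite inE -hk hhy.
case: j j3 hh {hE} => [|[|[|]]] // _ /hhE.
- by move->.
- by move->; rewrite !orbT.
have -> : Fix (2 * 2) = Fix 1.
  by rewrite /Fix -[(2 * 2)%N]/(3 + 1)%N expgD v3 mul1g.
by move->; rewrite orbT.
Qed.

Let Fix_disjoint i j y : i < 3 -> j < 3 -> y \in Fix i -> y \in Fix j -> i = j.
Proof.
have main k l : k < l < 3 -> y \in Fix k -> y \in Fix l -> False.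
  rewrite !inE !permM => kl /eqP wk /eqP.
  have -> : (v ^+ l = v ^+ k * v ^+ (l - k))%g.
    by case/andP: kl => kl _; rewrite -expgD subnKC // ltnW.
  rewrite permM wk => vy; have := v_free y.
  rewrite (prime_cycle_fix (g := v) (h := v ^+ (l - k)) (y := y)) ?eqxx ?ov ?mem_cycle //.
  by rewrite -order_dvdn ov; move: kl; clear; lia.
move=> i3 j3 yi yj; case: (ltngtP i j) => // ij.
  by case: (main i j) => //; rewrite ij.
by case: (main j i) => //; rewrite ij.
Qed.

Let Fix_W i h y : h \in W -> (h y \in Fix i) = (y \in Fix i).
Proof.
move=> hW; have gW : (w * v ^+ i)%g \in W by rewrite groupM ?groupX.
rewrite !inE; move: (w * v ^+ i)%g gW => g gW.
by rewrite -(permM h g) (centsP abW _ hW _ gW) permM (inj_eq perm_inj).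
Qed.

Let Fix_t0 y : (t y \in Fix 0) = (y \in Fix 0).
Proof. by rewrite !inE expg0 mulg1 -tw (inj_eq perm_inj). Qed.

Let Fix_t12 y : (t y \in Fix 1) = (y \in Fix 2).
Proof.
have vV : (v^-1 = v ^+ 2)%g by apply/eqP; rewrite eq_invg_mul -expgS v3.
have tvV z : v (t z) = t ((v^-1)%g z) by rewrite -{1}(permKV v z) tv permKV.
by rewrite !inE expg1 !(permM w) -tw tvV vV (inj_eq perm_inj).
Qed.

Let Fix_t21 y : (t y \in Fix 2) = (y \in Fix 1).
Proof. by rewrite -Fix_t12 order2_involutive. Qed.

Let Fix_order i : i < 3 -> #[w * v ^+ i]%g = 3.
Proof.
move=> i3; have gn : (w * v ^+ i != 1)%g.
  apply: contra vnw => /eqP; case: i i3 => [|[|[|]]] // _ wv1.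
  - by move: ow; rewrite -(mulg1 w) wv1 order1.
  - have -> : v = (w^-1)%g by apply/eqP; rewrite eq_sym eq_invg_mul -[X in (w * X)%g]expg1 wv1.
    by rewrite groupV cycle_id.
  have -> : v = w by apply: (mulIg (v ^+ 2)%g); rewrite wv1 -expgS v3.
  exact: cycle_id.
have : #[w * v ^+ i]%g %| 3.
  rewrite order_dvdn expgMn; last exact: commuteX.
  by rewrite w3 mul1g -expgM mulnC expgM v3 expg1n.
by rewrite dvdn_divisors // !inE order_eq1 (negPf gn) => /eqP.
Qed.

Let FixG i : (w * v ^+ i)%g \in G. Proof. by rewrite groupM ?groupX. Qed.

(** The fixed vertex of t lies in [Fix 0], and t exchanges [Fix 1] and [Fix 2]. If these two were
    empty, W would act freely on 96 vertices. *)
Let card_Fix i : i < 3 -> #|Fix i| = 3.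
Proof.
suff [c0 c1 c2] : [/\ #|Fix 0| = 3, #|Fix 1| = 3 & #|Fix 2| = 3].
  by case: i => [|[|[|]]].
have c12 : #|Fix 1| = #|Fix 2|.
  by apply/esym; apply: (@card_aut_image t) => y; apply: Fix_t12.
have c3 j y : j < 3 -> y \in Fix j -> #|Fix j| = 3.
  move=> j3; rewrite inE => /eqP gy.
  by rewrite (order3_fix_triangle (FixG j) (Fix_order j3) gy gy).1.1.
have [x Fx] := order2_fix tG ot; have tx := fixpts1_fix Fx.
have x0 : x \in Fix 0.
  rewrite inE mulg1; apply/eqP; apply: (order2_fix_uniq tG ot tx).
  by rewrite tw tx.
have c0 : #|Fix 0| = 3 by apply: c3 x0.
have [F1 | [y y1]] := set_0Vmem (Fix 1); last first.
  have c1 := c3 1 y isT y1.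
  by rewrite -c12 c1.
have F2 : Fix 2 = set0 by apply/eqP; rewrite -cards_eq0 -c12 F1 cards0.
have : 9 %| #|~: Fix 0|.
  rewrite -oW; apply: dvdn_card_free => h y hW; rewrite !in_setC ?Fix_W //.
  move=> y0 hy; apply/eqP/negPn/negP => h1.
  by have := W_fix hW h1 hy; rewrite F1 F2 (negPf y0) !in_set0.
have := cardsC (Fix 0); rewrite c0 card_vertices -[99]/(3 + 96) => /addnI->.
by [].
Qed.

Let Fix_adj i y z : i < 3 -> y \in Fix i -> z \in Fix i -> y != z -> e y z.
Proof.
move=> i3; rewrite !inE => /eqP gy /eqP gz.
exact: (order3_fix_triangle (FixG i) (Fix_order i3) gy gz).2.
Qed.

Let deg_Fix_self i y : i < 3 -> y \in Fix i -> deg y (Fix i) = 2.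
Proof.
move=> i3; rewrite inE => /eqP gy.
exact: (order3_fix_triangle (FixG i) (Fix_order i3) gy gy).1.2.
Qed.

(** Let g = w v^i, which fixes y. If y is adjacent to z in the other triangle, it is adjacent to z,
    g z and g^2 z, which form that triangle; but z and g z have only one common neighbour. *)
Let deg_Fix_other i j y : i < 3 -> j < 3 -> i != j -> y \in Fix i -> deg y (Fix j) = 0.
Proof.
move=> i3 j3 ij yi; apply: eq_card0 => z; rewrite in_setI inE; apply/negP => /andP[eyz zj].
pose g := (w * v ^+ i)%g; have gW : g \in W by rewrite groupM ?groupX.
have gy : g y = y by apply/eqP; move: yi; rewrite inE.
have gz : g z != z.
  apply: contraNneq ij => gz; apply/eqP/(Fix_disjoint i3 j3 _ zj).
  by rewrite inE; apply/eqP.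
have ggz : g (g z) != z.
  by apply: contra gz => /eqP/odd_order_square_fix->; rewrite // Fix_order.
have eyg u : e y (g u) = e y u by rewrite -{1}gy (aut_adj _ _ (FixG i)).
have ezg : e z (g z) by apply: (Fix_adj j3) => //; rewrite ?Fix_W // eq_sym.
have yE : y = g (g z).
  apply: (triangle_uniq ezg); rewrite ?(e_sym _ y) ?eyg //.
    by apply: (Fix_adj j3) => //; rewrite ?Fix_W // eq_sym.
  by rewrite (aut_adj _ _ (FixG i)).
by case/eqP: ij; apply: (Fix_disjoint i3 j3 yi); rewrite yE !Fix_W.
Qed.

Let deg_Fix_le1 i y : i < 3 -> y \notin Fix i -> deg y (Fix i) <= 1.
Proof.
move=> i3 yi; rewrite leqNgt; apply/negP => /card_gt1P[p [q []]].
rewrite !in_setI !in_nbrs => /andP[eyp pi] /andP[eyq qi] pq.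
have epq := Fix_adj i3 pi qi pq.
have [r [epr eqr]] := mateP epq.
have ri : r \in Fix i.
  have gp : (w * v ^+ i)%g p = p by apply/eqP; move: pi; rewrite inE.
  have gq : (w * v ^+ i)%g q = q by apply/eqP; move: qi; rewrite inE.
  by rewrite inE (fix_mate (FixG i) gp gq epq epr eqr).
by case/negP: yi; rewrite (triangle_uniq epq (_ : e p y) (_ : e q y) epr eqr) // e_sym.
Qed.

Let R := [set y | [&& y \notin Fix 0, y \notin Fix 1 & y \notin Fix 2]].

Let in_R y : y \in R = [&& y \notin Fix 0, y \notin Fix 1 & y \notin Fix 2].
Proof. by rewrite [LHS]inE. Qed.

Let sum_split (F : T -> nat) :
  \sum_y F y = \sum_(y in Fix 0) F y + \sum_(y in Fix 1) F y + \sum_(y in Fix 2) F y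
             + \sum_(y in R) F y.
Proof.
rewrite (bigID (mem (Fix 0))) /= -!addnA; congr (_ + _).
rewrite (bigID (mem (Fix 1))) /=; congr (_ + _).
  apply: eq_bigl => y; case: (boolP (y \in Fix 1)) => y1; rewrite ?andbF // andbT.
  by apply/negP => /(Fix_disjoint (isT : 0 < 3) (isT : 1 < 3))/(_ y1).
rewrite (bigID (mem (Fix 2))) /=; congr (_ + _).
  apply: eq_bigl => y; case: (boolP (y \in Fix 2)) => y2; rewrite ?andbF // andbT.
  apply/andP; split; apply/negP.
    by move/(Fix_disjoint (isT : 0 < 3) (isT : 2 < 3))/(_ y2).
  by move/(Fix_disjoint (isT : 1 < 3) (isT : 2 < 3))/(_ y2).
by apply: eq_bigl => y; rewrite in_R andbA.
Qed.

Let card_R : #|R| = 90.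
Proof.
have := sum_split (fun=> 1); rewrite !sum1_card !card_Fix // card_vertices.
by rewrite -[99]/(3 + 3 + 3 + 90) => /addnI.
Qed.

Let dvd18 (S : {set T}) : S \subset R ->
    (forall h y, h \in W -> y \in S -> h y \in S) -> (forall y, y \in S -> t y \in S) ->
  18 %| #|S|.
Proof.
move=> /subsetP SR SW St; rewrite -[18]/(9 * 2) Gauss_dvd //; apply/andP; split.
  rewrite -oW; apply: dvdn_card_free => // h y hW yS hy; apply/eqP/negPn/negP => h1.
  have := W_fix hW h1 hy; have := SR y yS; rewrite in_R => /and3P[].
  by move=> /negPf-> /negPf-> /negPf->.
have t2 : 2.-elt t by rewrite /p_elt ot.
rewrite /dvdn (card_fix_mod t2 St) (_ : [set y in S | _] = set0) ?cards0 //.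
apply/setP => y; rewrite in_set in_set0; apply/negP => /andP[yS /eqP ty].
have := SR y yS; rewrite in_R => /and3P[+ _ _]; rewrite inE expg0 mulg1.
by case/negP; apply/eqP/(order2_fix_uniq tG ot ty); rewrite tw ty.
Qed.

(* Outside the three triangles a vertex has at most one neighbour in each;
   [cl a b c] is the set of vertices adjacent to exactly the triangles marked. *)
Let cl (a b c : bool) :=
  [set z in R | [&& deg z (Fix 0) == a, deg z (Fix 1) == b & deg z (Fix 2) == c]].

Let le1 z : z \in R -> [/\ deg z (Fix 0) <= 1, deg z (Fix 1) <= 1 & deg z (Fix 2) <= 1].
Proof. by rewrite in_R => /and3P[z0 z1 z2]; split; apply: deg_Fix_le1. Qed.

(** The weight [wt] is left open so that one decomposition into eight classes yields the equations
    of both [class_equations] and [card_equations]. *)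
Let sum_cl (F : T -> nat) (wt : bool -> bool -> bool -> nat) :
  \sum_(z in R) F z * wt (0 < deg z (Fix 0)) (0 < deg z (Fix 1)) (0 < deg z (Fix 2))
  = \sum_(z in cl true true true) F z * wt true true true
  + \sum_(z in cl true true false) F z * wt true true false
  + \sum_(z in cl true false true) F z * wt true false true
  + \sum_(z in cl true false false) F z * wt true false false
  + \sum_(z in cl false true true) F z * wt false true true
  + \sum_(z in cl false true false) F z * wt false true false
  + \sum_(z in cl false false true) F z * wt false false true
  + \sum_(z in cl false false false) F z * wt false false false.
Proof.
have clE a b c : \sum_(z in cl a b c) F z * wt a b c = \sum_(z in R)
    [&& deg z (Fix 0) == a, deg z (Fix 1) == b & deg z (Fix 2) == c] * (F z * wt a b c).
  rewrite big_mkcond [RHS]big_mkcond; apply: eq_bigr => z _; rewrite in_set.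
  by case: (z \in R) => //=; case: [&& _, _ & _]; rewrite ?mul1n.
rewrite !clE -!big_split /=; apply: eq_bigr => z /le1[].
case: (deg z (Fix 0)) => [|[|]] //; case: (deg z (Fix 1)) => [|[|]] //;
  by case: (deg z (Fix 2)) => [|[|]] // _ _ _; rewrite !mul0n !mul1n ?addn0.
Qed.

Let sum_FixE i (F : T -> nat) : i < 3 ->
  \sum_(z in R) F z * (0 < deg z (Fix i)) = \sum_(z in R) F z * deg z (Fix i).
Proof.
move=> i3; apply: eq_bigr => z /le1[l0 l1 l2]; congr (_ * _).
case: i i3 => [|[|[|]]] // _.
- by case: (deg z _) l0 => [|[|]].
- by case: (deg z _) l1 => [|[|]].
by case: (deg z _) l2 => [|[|]].
Qed.

(** The total in [sum_nbr_deg] is 2 * 3; a neighbour of y in the triangle contributes 1 directly and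
    2 through its own neighbours there. *)
Let nbr_eq i y : i < 3 -> y \in R ->
  \sum_(z in R) e y z * (0 < deg z (Fix i)) + 3 * deg y (Fix i) = 6.
Proof.
move=> i3 yR; rewrite (sum_FixE _ i3).
have yi : y \in Fix i = false.
  by move: yR; rewrite in_R => /and3P[/negPf y0 /negPf y1 /negPf y2]; case: i i3 => [|[|[|]]].
have := sum_nbr_deg y (Fix i); rewrite yi card_Fix //.
have -> : \sum_(z in N y) deg z (Fix i) = \sum_z e y z * deg z (Fix i).
  by rewrite big_mkcond; apply: eq_bigr => z _; rewrite in_nbrs; case: (e y z); rewrite ?mul1n.
have own : \sum_(z in Fix i) e y z * deg z (Fix i) = 2 * deg y (Fix i).
  rewrite [deg y _]degE mulnC big_distrl; apply: eq_bigr => z zi.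
  by rewrite (deg_Fix_self i3 zi).
have oth j : j < 3 -> j != i -> \sum_(z in Fix j) e y z * deg z (Fix i) = 0.
  by move=> j3 ji; apply: big1 => z zj; rewrite (deg_Fix_other j3 i3 ji zj) muln0.
rewrite sum_split; case: i i3 yi own oth => [|[|[|]]] // _ _ own oth.
- by rewrite own (oth 1) // (oth 2) //; clear; lia.
- by rewrite own (oth 0) // (oth 2) //; clear; lia.
- by rewrite own (oth 0) // (oth 1) //; clear; lia.
Qed.

Let n y a b c := deg y (cl a b c).

Let class_equations y : y \in R ->
  [/\ n y true true true + n y true true false + n y true false true + n y true false false
        + 3 * deg y (Fix 0) = 6,
      n y true true true + n y true true false + n y false true true + n y false true false
        + 3 * deg y (Fix 1) = 6,
      n y true true true + n y true false true + n y false true true + n y false false true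
        + 3 * deg y (Fix 2) = 6 &
      n y true true true + n y true true false + n y true false true + n y true false false
      + n y false true true + n y false true false + n y false false true
      + n y false false false + deg y (Fix 0) + deg y (Fix 1) + deg y (Fix 2) = 14].
Proof.
move=> yR; have nE a b c k : \sum_(z in cl a b c) e y z * k = n y a b c * k.
  by rewrite /n degE big_distrl.
have sumE k := sum_cl (fun z => e y z) k.
split.
- rewrite -(nbr_eq (isT : 0 < 3) yR) (sumE (fun a _ _ => nat_of_bool (a))) !nE; clear; lia.
- rewrite -(nbr_eq (isT : 1 < 3) yR) (sumE (fun _ b _ => nat_of_bool (b))) !nE; clear; lia.
- rewrite -(nbr_eq (isT : 2 < 3) yR) (sumE (fun _ _ c => nat_of_bool (c))) !nE; clear; lia.
have := card_nbrs y; rewrite -(setIT (N y)) -/(deg y setT) degE.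
rewrite (eq_bigl (fun=> true)) => [|z]; last by rewrite in_setT.
rewrite sum_split -!degE => <-; rewrite (degE y R).
have := sumE (fun _ _ _ => 1); rewrite !nE !muln1.
rewrite (eq_bigr (fun z => e y z : nat)) => [->|z _]; last by rewrite muln1.
clear; lia.
Qed.

Let m a b c := #|cl a b c|.

(** Each triangle sends 3 * 14 - 3 * 2 = 36 edges to R, and the 3 * 3 nonadjacent pairs from two
    triangles have 2 common neighbours each, 18 in all. *)
Let card_equations :
  [/\ m true true true + m true true false = 18, m true true true + m true false true = 18,
      m true true true + m false true true = 18 &
   [/\ m true true true + m true true false + m true false true + m true false false = 36,
      m true true true + m true true false + m false true true + m false true false = 36,
      m true true true + m true false true + m false true true + m false false true = 36 &
      m true true true + m true true false + m true false true + m true false false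
      + m false true true + m false true false + m false false true + m false false false = 90]].
Proof.
have mE a b c k : \sum_(z in cl a b c) 1 * k = m a b c * k by rewrite mul1n sum_nat_const.
have sumE k := sum_cl (fun=> 1) k.
have tot i : i < 3 -> \sum_(z in R) deg z (Fix i) = 36.
  move=> i3; have : \sum_z deg z (Fix i) = 42.
    rewrite (eq_bigl (fun z => z \in setT)) => [|z]; last by rewrite in_setT.
    rewrite sum_deg_sym (eq_bigr (fun=> 14)) ?sum_nat_const ?card_Fix // => y _.
    by rewrite /deg setIT card_nbrs.
  have own : \sum_(z in Fix i) deg z (Fix i) = 6.
    rewrite (eq_bigr (fun=> 2)) ?sum_nat_const ?card_Fix // => z.
    exact: deg_Fix_self.
  have oth j : j < 3 -> j != i -> \sum_(z in Fix j) deg z (Fix i) = 0.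
    by move=> j3 ji; apply: big1 => z zj; rewrite (deg_Fix_other j3 i3 ji zj).
  rewrite sum_split; case: i i3 own oth => [|[|[|]]] // _ own oth.
  - by rewrite own (oth 1) // (oth 2) // -[42]/(6 + 36) addn0 addn0 => /addnI.
  - by rewrite own (oth 0) // (oth 2) // -[42]/(6 + 36) addn0 add0n => /addnI.
  - by rewrite own (oth 0) // (oth 1) // -[42]/(6 + 36) add0n => /addnI.
have mix i j : i < 3 -> j < 3 -> i != j -> \sum_(z in R) deg z (Fix i) * deg z (Fix j) = 18.
  move=> i3 j3 ij; have := sum_deg_mul (Fix i) (Fix j).
  have zero k : k < 3 -> \sum_(z in Fix k) deg z (Fix i) * deg z (Fix j) = 0.
    move=> k3; apply: big1 => z zk; have [ki | ki] := eqVneq k i.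
      by rewrite (deg_Fix_other k3 j3 _ zk) ?muln0 ?ki.
    by rewrite (deg_Fix_other k3 i3 ki zk).
  have z0 : \sum_(z in Fix i) deg z (Fix j) = 0.
    by apply: big1 => z zi; apply: deg_Fix_other zi.
  rewrite sum_split !zero // !add0n z0 addn0 => ->.
  rewrite (eq_bigr (fun=> 6)) ?sum_nat_const ?card_Fix // => z zi.
  have -> // : z \in Fix j = false.
  by apply: contraNF ij => /(Fix_disjoint i3 j3 zi)->.
have totE i : i < 3 -> \sum_(z in R) 1 * (0 < deg z (Fix i)) = 36.
  by move=> i3; rewrite (sum_FixE _ i3) -(tot i i3); apply: eq_bigr => z _; rewrite mul1n.
have mixE i j : i < 3 -> j < 3 -> i != j ->
    \sum_(z in R) 1 * ((0 < deg z (Fix i)) && (0 < deg z (Fix j)) : nat) = 18.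
  move=> i3 j3 ij; rewrite -(mix i j i3 j3 ij) -(sum_FixE _ j3).
  rewrite (eq_bigr (fun z => (0 < deg z (Fix j)) * (0 < deg z (Fix i)))) => [|z _].
    by rewrite (sum_FixE _ i3); apply: eq_bigr => z _; rewrite mulnC.
  by rewrite mul1n mulnb andbC.
split; last split.
- by rewrite -(mixE 0 1) // (sumE (fun a b _ => nat_of_bool (a && b))) !mE; clear; lia.
- by rewrite -(mixE 0 2) // (sumE (fun a _ c => nat_of_bool (a && c))) !mE; clear; lia.
- by rewrite -(mixE 1 2) // (sumE (fun _ b c => nat_of_bool (b && c))) !mE; clear; lia.
- by rewrite -(totE 0) // (sumE (fun a _ _ => nat_of_bool (a))) !mE; clear; lia.
- by rewrite -(totE 1) // (sumE (fun _ b _ => nat_of_bool (b))) !mE; clear; lia.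
- by rewrite -(totE 2) // (sumE (fun _ _ c => nat_of_bool (c))) !mE; clear; lia.
have := sumE (fun _ _ _ => 1); rewrite !mE sum_nat_const card_R.
by clear; lia.
Qed.

Let good := [set y in R | e y (v y)].

Let in_good y : (y \in good) = (y \in R) && e y (v y).
Proof. by rewrite [LHS]in_set. Qed.

Let in_cl a b c y : (y \in cl a b c) =
  (y \in R) && [&& deg y (Fix 0) == a, deg y (Fix 1) == b & deg y (Fix 2) == c].
Proof. by rewrite [LHS]in_set. Qed.

Let R_W h y : h \in W -> y \in R -> h y \in R.
Proof. by move=> hW; rewrite !in_R !Fix_W. Qed.

Let R_t y : y \in R -> t y \in R.
Proof. by rewrite !in_R Fix_t0 Fix_t12 Fix_t21 [(_ \notin Fix 2) && _]andbC. Qed.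

Let cl_W a b c h y : h \in W -> y \in cl a b c -> h y \in cl a b c.
Proof.
move=> hW; have hG := subsetP WG h hW.
have degh i : deg (h y) (Fix i) = deg y (Fix i).
  by apply: (deg_aut _ hG) => z; apply: Fix_W.
by rewrite !in_cl !degh => /andP[/(R_W hW)->].
Qed.

Let good_W h y : h \in W -> y \in good -> h y \in good.
Proof.
move=> hW; rewrite !in_good => /andP[yR ey]; rewrite R_W //=.
by rewrite -permM (centsP abW _ hW _ vW) permM (aut_adj _ _ (subsetP WG h hW)).
Qed.

Let good_t y : y \in good -> t y \in good.
Proof.
rewrite !in_good => /andP[yR ey]; rewrite R_t //=.
have -> : v (t y) = t ((v^-1)%g y) by rewrite -{1}(permKV v y) tv permKV.
by rewrite aut_adj // -(aut_adj _ _ vG) permKV e_sym.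
Qed.

(** Among the multiples of 18 up to 90 only 72 makes 9 + |good| congruent to 4 modulo 7. The 9 are
    the vertices of the three triangles, which v rotates. *)
Let card_good : #|good| = 72.
Proof.
have F0 : fixpts v = set0 by apply/setP => y; rewrite in_set in_set0 (negPf (v_free y)).
have := trace_mod7 vG; rewrite F0 cards0 => tr.
have d18 : 18 %| #|good|.
  by apply: dvd18 good_W good_t; apply/subsetP => y; rewrite in_good => /andP[].
have : #|shifted_adj v| = 9 + #|good|.
  rewrite -!sum1_card.
  transitivity (\sum_y (e y (v y) : nat)).
    by rewrite big_mkcond; apply: eq_bigr => y _; rewrite in_set; case: (e _ _).
  have one i : i < 3 -> \sum_(y in Fix i) (e y (v y) : nat) = 3.
    move=> i3; rewrite -(card_Fix i3) -sum1_card; apply: eq_bigr => y yi.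
    by rewrite (Fix_adj i3) ?Fix_W // eq_sym v_free.
  rewrite sum_split !one // -[3 + 3 + 3]/9; congr (_ + _).
  rewrite big_mkcond [RHS]big_mkcond; apply: eq_bigr => y _; rewrite in_good.
  by case: (y \in R); case: (e _ _).
have : #|good| <= 90.
  by rewrite -card_R; apply: subset_leq_card; apply/subsetP => y; rewrite in_good => /andP[].
by move: #|_| #|_| d18 tr => a b; clear; lia.
Qed.

Let good_nbrs a b c y : y \in cl a b c -> y \in good -> 2 <= n y a b c.
Proof.
move=> yc; rewrite in_good => /andP[_ ey].
have vVy : (v^-1)%g y != v y.
  apply: contraNneq (v_free y) => vV; apply/eqP; apply: (@odd_order_square_fix v); rewrite ?ov //.
  by rewrite -vV permKV.
have -> : 2 = #|[set v y; (v^-1)%g y]| by rewrite cards2 eq_sym vVy.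
apply: subset_leq_card; apply/subsetP => z; rewrite in_set2 in_setI in_nbrs.
case/orP => /eqP->; rewrite cl_W ?groupV // andbT //.
by rewrite -(aut_adj _ _ vG) permKV e_sym.
Qed.

Let cl111_t y : y \in cl true true true -> t y \in cl true true true.
Proof.
rewrite !in_cl => /andP[/R_t-> /and3P[y0 y1 y2]].
rewrite (deg_aut y tG Fix_t0) (deg_aut y tG Fix_t12) (deg_aut y tG Fix_t21).
by rewrite y0 y1 y2.
Qed.

Let cl_sub a b c : cl a b c \subset R.
Proof. by apply/subsetP => y; rewrite in_cl => /andP[]. Qed.

Let cl_deg a b c y : y \in cl a b c ->
  [/\ y \in R, deg y (Fix 0) = a, deg y (Fix 1) = b & deg y (Fix 2) = c].
Proof. by rewrite in_cl => /andP[-> /and3P[/eqP-> /eqP-> /eqP->]]. Qed.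

Let empty_class a b c y : m a b c = 0 -> n y a b c = 0.
Proof. by move/cards0_eq => c0; rewrite /n /deg c0 setI0 cards0. Qed.

Let bad := R :\: good.

Let card_bad : #|bad| = 18.
Proof.
have := cardsID good R; rewrite card_R (_ : R :&: good = good); last first.
  by apply/setIidPr/subsetP => y; rewrite in_good => /andP[].
by rewrite card_good -/bad -[90]/(72 + 18) => /addnI.
Qed.

Let bad_cl a b c y : y \in cl a b c -> n y a b c < 2 -> y \in bad.
Proof.
move=> yc ny; rewrite in_setD (subsetP (cl_sub a b c)) // andbT.
by apply: contraL ny => /(good_nbrs yc); rewrite -leqNgt.
Qed.

Lemma no_order18_mixed : False.
Proof.
have d18 : 18 %| m true true true.
  by apply: dvd18 (cl_sub _ _ _) _ cl111_t => h y; apply: cl_W.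
have [] := card_equations; set k111 := m true true true => m110 m101 m011 [e0 e1 e2 e3].
have [m0 | m18] : k111 = 0 \/ k111 = 18.
- by have := d18; have := m110; rewrite -/k111; move: (k111) (m true true false) => a b; clear; lia.
- rewrite m0 !add0n in m110 m101 m011 e0 e1 e2 e3.
  have z100 : m true false false = 0 by move: e0 m110 m101; clear; lia.
  have z010 : m false true false = 0 by move: e1 m110 m011; clear; lia.
  have z001 : m false false true = 0 by move: e2 m101 m011; clear; lia.
  (* For y in class 110 the equations give n110 + n101 = 3, n110 + n011 = 3 and n101 + n011 = 6, so
     y has no neighbour in its own class and is bad. The same holds for class 101, which then
     consists of all 18 bad vertices and cannot be disjoint from class 110. *)
  have sub1 : cl true true false \subset bad.
    apply/subsetP => y yc; apply: (bad_cl yc); have [yR d0 d1 d2] := cl_deg yc.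
    have := class_equations yR; rewrite d0 d1 d2 (empty_class y m0).
    rewrite (empty_class y z100) (empty_class y z010) (empty_class y z001).
    case; move: (n y true true false) (n y true false true) (n y false true true)
      (n y false false false) => a b c k; clear; lia.
  have sub2 : cl true false true \subset bad.
    apply/subsetP => y yc; apply: (bad_cl yc); have [yR d0 d1 d2] := cl_deg yc.
    have := class_equations yR; rewrite d0 d1 d2 (empty_class y m0).
    rewrite (empty_class y z100) (empty_class y z010) (empty_class y z001).
    case; move: (n y true true false) (n y true false true) (n y false true true)
      (n y false false false) => a b c k; clear; lia.
  have E2 : cl true false true = bad.
    by apply/eqP; rewrite eqEcard sub2 card_bad -[#|cl _ _ _|]/(m true false true) m101.
  have /card_gt0P[y yc] : 0 < #|cl true true false| by rewrite -/(m _ _ _) m110.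
  have := subsetP sub1 y yc; rewrite -E2 => /cl_deg[_ _ + _].
  by have [_ _ -> _] := cl_deg yc.
rewrite m18 in m110 m101 m011 e0 e1 e2 e3.
have z110 : m true true false = 0 by move: m110; clear; lia.
have z101 : m true false true = 0 by move: m101; clear; lia.
have z011 : m false true true = 0 by move: m011; clear; lia.
have c100 : m true false false = 18 by move: e0; rewrite z110 z101; clear; lia.
have c010 : m false true false = 18 by move: e1; rewrite z110 z011; clear; lia.
have c001 : m false false true = 18 by move: e2; rewrite z101 z011; clear; lia.
have c000 : m false false false = 18.
  by move: e3; rewrite z110 z101 z011 c100 c010 c001; clear; lia.
have eq111 y : y \in cl true true true -> n y true false false + n y true true true = 3.
  move=> yc; have [yR d0 d1 d2] := cl_deg yc.
  have := class_equations yR; rewrite d0 d1 d2 (empty_class y z110) (empty_class y z101) (empty_class y z011).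
  case; move: (n y true true true) (n y true false false) (n y false true false)
    (n y false false true) (n y false false false) => a b c d k; clear; lia.
have eq100 y : y \in cl true false false ->
    n y true false false + n y true true true = 3 /\
    n y false false false + 2 = 2 * n y true true true.
  move=> yc; have [yR d0 d1 d2] := cl_deg yc.
  have := class_equations yR; rewrite d0 d1 d2 (empty_class y z110) (empty_class y z101) (empty_class y z011).
  case; move: (n y true true true) (n y true false false) (n y false true false)
    (n y false false true) (n y false false false) => a b c d k; clear; lia.
have ge1 y : y \in cl true false false -> 1 <= n y true true true.
  by case/eq100=> _; move: (n y _ _ _) (n y true true true) => a b; clear; lia.
(* If all of class 111 is good, each of its 18 vertices has at most one neighbour in class 100, and
   double counting against [ge1] gives equality. Otherwise, by divisibility by 18, class 111 is the
   set of bad vertices, so y is good and has two neighbours in class 100 already. *)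
have one y : y \in cl true false false -> n y true true true = 1.
  have [sub | nsub] := boolP (cl true true true \subset good).
    have le : \sum_(z in cl true false false) n z true true true <= 18.
      rewrite -[18]m18 /k111 /m -sum1_card [X in X <= _]sum_deg_sym; apply: leq_sum => z zc.
      have := eq111 z zc; have := good_nbrs zc (subsetP sub z zc).
      by rewrite /n; move: (deg z _) (deg z _) => a b; clear; lia.
    move=> yc; apply/eqP; rewrite eqn_leq ge1 // andbT leqNgt; apply/negP => gt1.
    move: le; rewrite (bigD1 y) //=.
    have : \sum_(z in cl true false false | z != y) 1 <=
           \sum_(z in cl true false false | z != y) n z true true true.
      by apply: leq_sum => z /andP[/ge1].
    have : \sum_(z in cl true false false) 1 = 18 by rewrite sum1_card -/(m _ _ _).
    rewrite (bigD1 y) //=; move: gt1.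
    by move: (n y _ _ _) (bigop _ _ _) (bigop _ _ _) => a b c; clear; lia.
  have bad111 : cl true true true :\: good = cl true true true.
    have d18' : 18 %| #|cl true true true :\: good|.
      apply: dvd18 => [|h z hW|z].
      - exact: subset_trans (subsetDl _ _) (cl_sub _ _ _).
      - rewrite !in_setD => /andP[ng /(cl_W hW)->]; rewrite andbT.
        by apply: contra ng => /(good_W (groupVr hW)); rewrite permK.
      rewrite !in_setD => /andP[ng /cl111_t->]; rewrite andbT.
      by apply: contra ng => /good_t; rewrite order2_involutive.
    apply/eqP; rewrite eqEcard subsetDl -/(m true true true) -/k111 m18.
    by apply: dvdn_leq d18'; rewrite card_gt0 setD_eq0.
  have E : cl true true true = bad.
    apply/eqP; rewrite eqEcard card_bad -[#|_|]/k111 m18 leqnn andbT.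
    by rewrite -bad111 setSD ?cl_sub.
  move=> yc; have : y \in good.
    apply/negPn/negP => ng; have : y \in bad by rewrite in_setD ng (subsetP (cl_sub _ _ _) y yc).
    rewrite -E => /cl_deg[_ _ + _]; by have [_ _ -> _] := cl_deg yc.
  move/(good_nbrs yc); have [+ _] := eq100 y yc; have := ge1 y yc.
  by move: (n y _ _ _) (n y _ _ _) => a b; clear; lia.
have zero y : y \in cl false false false -> n y true false false = 0.
  move=> yc; have : \sum_(z in cl false false false) n z true false false = 0.
    rewrite [LHS]sum_deg_sym; apply: big1 => z zc; have [_] := eq100 z zc.
    by rewrite one // /n; move: (deg z _) => a; clear; lia.
  by move/eqP; rewrite sum_nat_eq0 => /forall_inP/(_ y yc)/eqP.
have eq000 y : y \in cl false false false -> n y false false false = 8.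
  move=> yc; have [yR d0 d1 d2] := cl_deg yc.
  have := class_equations yR.
  rewrite d0 d1 d2 (zero y yc) (empty_class y z110) (empty_class y z101) (empty_class y z011).
  case; move: (n y true true true) (n y false true false)
    (n y false false true) (n y false false false) => a b c k; clear; lia.
have /card_gt0P[y yc] : 0 < #|cl false false false| by rewrite -/(m _ _ _) c000.
(* Eight neighbours in the class with eight neighbours each give 64 + 8, more than 12 + 2 * 18. *)
have := sum_nbr_deg y (cl false false false).
rewrite yc -[#|cl _ _ _|]/(m false false false) c000 -/(n y false false false) (eq000 y yc).
rewrite (bigID (mem (cl false false false))) /=.
have -> : \sum_(z in N y | z \in cl false false false) deg z (cl false false false) = 64.
  rewrite (eq_bigr (fun=> 8)) => [|z /andP[_ /eq000] //].
  rewrite sum_nat_const -[64]/(8 * 8) -{2}(eq000 y yc); congr (_ * _).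
  by rewrite /n /deg; apply: eq_card => z; rewrite in_setI.
by move: (bigop _ _ _) => k; clear; lia.
Qed.

End MixedOrder18.

(** The W-orbit of x is invariant under t; the other ten are exchanged in pairs. *)
Definition order18_sizes := [:: 9; 18; 18; 18; 18; 18].

(* In row [i > 0] entry [0] is c and the diagonal entry is p + c, where p counts
   the neighbours in the same orbit of the subgroup of order 9. *)
Definition order18_row i (r : seq nat) :=
  if i is 0 then nth 0 r 0 < 4 else
  [&& nth 0 r 0 <= nth 0 r i, nth 0 r i - nth 0 r 0 \in [:: 0; 2; 4]
    & (nth 0 r i - nth 0 r 0 == 4) ==> (nth 0 r 0 == 1)].

(** Row 0 assumes fewer than four neighbours of x in its own orbit, the case to be excluded. *)
Lemma order18_refute :
  refute order18_sizes xpredT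
    (mkseq (fun i => [seq r <- nth [::] (nseq 6 (compositions 14 6)) i |
       diagonal_ok order18_sizes i r && order18_row i r]) 6) [::].
Proof. by vm_compute. Qed.

(* With S y the set of w in W mapping y to a neighbour, all S y have four
   elements and any two W-orbits are joined by a perfect matching. Most S y equal
   S x, and two such orbits produce too many common neighbours. *)
Section InvertedOrder9.

Variables (W : {group {perm T}}) (t : {perm T}) (x : T).
Hypotheses (WG : W \subset G) (oW : #|W| = 9) (tG : t \in G) (ot : #[t]%g = 2)
  (tx : t x = x) (Wt : forall w, w \in W -> (w ^ t = w^-1)%g).

Let abW : abelian W. Proof. exact: (@card_p2group_abelian _ 3). Qed.
Let Wc g h : g \in W -> h \in W -> commute g h.
Proof. by move=> gW hW; apply: (centsP abW). Qed.
Let t2 y : t (t y) = y. Proof. exact: order2_involutive. Qed.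
Let tW w y : w \in W -> t (w y) = (w^-1)%g (t y).
Proof. by move=> wW; apply/inverted_act/Wt. Qed.
Let W9 w : w \in W -> (w ^+ 9 = 1)%g.
Proof. by move=> wW; rewrite -oW expg_cardG. Qed.
Let WadjE w y z : w \in W -> e (w y) (w z) = e y z.
Proof. by move=> wW; rewrite aut_adj // (subsetP WG). Qed.
Let W2 w : w \in W -> (w ^+ 2 = 1)%g -> w = 1%g.
Proof.
by move=> wW w2; have := W9 wW; rewrite -[9]/(2 * 4 + 1)%N expgD expgM w2 expg1n mul1g.
Qed.

(** A fixed vertex gives an element k of order 3 with three fixed vertices; t permutes these and
    fixes one, so it commutes with k, although it inverts k. *)
Let free h y : h \in W -> h y = y -> h = 1%g.
Proof.
move=> hW hy; apply/eqP/negPn/negP => h1.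
have ph : 3.-group <[h]>%g.
  by apply: (@pgroupS _ _ W); rewrite ?cycle_subG // /pgroup oW.
have nth : (<[h]> != 1)%g by rewrite cycle_eq1.
have [_ d3 _] := pgroup_pdiv ph nth.
have [k kh ok] := Cauchy (isT : prime 3) d3.
have kW : k \in W by apply: (subsetP _ k kh); rewrite cycle_subG.
have kG := subsetP WG k kW; have ky := cycle_fix hy kh.
have tF z : z \in fixpts k -> t z \in fixpts k.
  by rewrite !inE => /eqP kz; rewrite -{1}kz tW // permKV.
have t2e : 2.-elt t by rewrite /p_elt ot.
have := card_fix_mod t2e tF.
rewrite (order3_fix_triangle kG ok ky ky).1.1 !modn2 => odd_fix.
have : 0 < #|[set z in fixpts k | t z == z]| by case: #|_| odd_fix.
case/card_gt0P => z; rewrite !inE => /andP[/eqP kz /eqP tz].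
have := order2_central tG kG ot tz kz => /commgP/conjg_fixP.
move=> ktk; have kk : (k ^ t)%g = k.
  by apply/conjg_fixP/commgP/commute_sym/commgP/conjg_fixP.
have k2 : (k ^+ 2 = 1)%g by rewrite expgS expg1 -{2}kk Wt // mulgV.
by have := order_dvdn k 2; rewrite k2 ok eqxx.
Qed.

Let orb y := orbit 'P W y.

Let orbP y z : reflect (exists2 w, w \in W & z = w y) (z \in orb y).
Proof. by apply: (iffP orbitP) => -[w wW wE]; exists w. Qed.

Let card_orb y : #|orb y| = 9.
Proof. by rewrite card_orbit_free // => h; apply: free. Qed.

Let orb_W w y z : w \in W -> (w z \in orb y) = (z \in orb y).
Proof. by move=> wW; rewrite -[w z]/(aperm z w) orbit_actr. Qed.

Let orb_sym y z : (y \in orb z) = (z \in orb y). Proof. exact: orbit_sym. Qed.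

Let orb_trans y z u : y \in orb z -> z \in orb u -> y \in orb u.
Proof. by case/orbP=> w wW ->; rewrite orb_W. Qed.

Let orb_tt y z : (t y \in orb (t z)) = (y \in orb z).
Proof.
have main u v : u \in orb v -> t u \in orb (t v).
  by case/orbP => w wW ->; apply/orbP; exists (w^-1)%g; rewrite ?groupV ?tW.
by apply/idP/idP => /main; rewrite ?t2.
Qed.

Let orb_t y : y \notin orb x -> t y \notin orb y.
Proof.
apply: contra => ty; have t2e : 2.-elt t by rewrite /p_elt ot.
have tO z : z \in orb y -> t z \in orb y.
  by move=> zy; apply: orb_trans ty; rewrite orb_tt.
have := card_fix_mod t2e tO; rewrite card_orb !modn2 => odd_fix.
have : 0 < #|[set z in orb y | t z == z]| by case: #|_| odd_fix.
case/card_gt0P => z; rewrite inE => /andP[zy /eqP tz].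
by rewrite -(order2_fix_uniq tG ot tx tz) orb_sym.
Qed.

Let S y := [set w in W | e y (w y)].
Let cnt y z := deg y (orb z).

Let in_S w y : (w \in S y) = (w \in W) && e y (w y). Proof. by rewrite inE. Qed.

Let card_S y : #|S y| = cnt y y.
Proof. by rewrite /cnt deg_free_orbit // => h; apply: free. Qed.

Let cntE y z : cnt y z = \sum_(w in W) e y (w z).
Proof.
rewrite /cnt deg_free_orbit => [|h]; last exact: free.
by rewrite -sum1_card big_mkcond [RHS]big_mkcond; apply: eq_bigr => w _;
   rewrite inE; case: (w \in W); case: (e _ _).
Qed.

Let cnt_sym y z : cnt y z = cnt z y.
Proof.
rewrite !cntE (reindex_inj invg_inj) /=; apply: eq_big => [w|w wW]; first by rewrite groupV.
by rewrite groupV in wW; rewrite -(WadjE y _ wW) permKV e_sym.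
Qed.

Let cnt_Wr w y z : w \in W -> cnt y (w z) = cnt y z.
Proof. by move=> wW; rewrite /cnt; congr (deg y _); apply/orbit_eqP; rewrite -/(orb _) orb_W // orbit_refl. Qed.

Let S_W w y : w \in W -> S (w y) = S y.
Proof.
move=> wW; apply/setP => g; rewrite !in_S; apply: andb_id2l => gW.
by rewrite -permM (Wc wW gW) permM WadjE.
Qed.

Let even_S y : ~~ odd #|S y|.
Proof.
rewrite card_S -dvdn2; apply: even_free_orbit_deg => // [h|h hW oh]; first exact: free.
by have := order_dvdG hW; rewrite oh oW.
Qed.

Let p y := #|S y|.

Let sum_cnt y : \sum_z cnt y z = 126.
Proof.
under eq_bigr do rewrite cntE.
rewrite exchange_big /= (eq_bigr (fun=> 14)) ?sum_nat_const ?oW // => w wW.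
rewrite -(card_nbrs y) -(card_imset _ (@perm_inj _ (w^-1)%g)) -sum1_card [RHS]big_mkcond.
apply: eq_bigr => z _; rewrite -{2}(permK w z) mem_imset ?in_nbrs; last exact: perm_inj.
by case: (e _ _).
Qed.

(** The value of [sum_nbr_deg] for the orbit of y is 12 + 2 * 9 = 30; the factor 9 comes from
    expanding one factor [cnt y z] into a sum over W. *)
Let sum_cnt_sq y : \sum_z cnt y z ^ 2 = 9 * (30 - p y).
Proof.
have -> : \sum_z cnt y z ^ 2 = \sum_(w in W) \sum_z e y (w z) * cnt y (w z).
  rewrite exchange_big; apply: eq_bigr => z _; rewrite /= -mulnn {1}cntE big_distrl /=.
  by apply: eq_bigr => w wW; rewrite cnt_Wr.
rewrite (eq_bigr (fun=> \sum_z e y z * cnt y z)) => [|w wW]; last first.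
  by rewrite [RHS](reindex_inj (@perm_inj _ w)).
rewrite sum_nat_const oW; congr (_ * _).
have := sum_nbr_deg y (orb y); rewrite /orb orbit_refl -/(orb y) card_orb -/(cnt y y) -card_S -/(p y).
have -> : \sum_(z in N y) deg z (orb y) = \sum_z e y z * cnt y z.
  rewrite big_mkcond; apply: eq_bigr => z _; rewrite in_nbrs cnt_sym.
  by case: (e y z); rewrite ?mul1n.
by move: (bigop _ _ _) (p y) => a b; clear; lia.
Qed.

(* The variance of the numbers [cnt y z] over all z, to which the orbit of y
   alone contributes (p - 1)^2 for each of its 9 points. *)
Let p_le4 y : p y <= 4 /\ (p y = 4 -> forall z, z \notin orb y -> cnt y z = 1).
Proof.
(* The square of the integer k - 1: the second summand corrects the truncated subtraction at k =
   0. *)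
have [d dD] : exists d, forall k, d k = (k - 1) ^ 2 + (1 - k).
  by exists (fun k => (k - 1) ^ 2 + (1 - k)).
have dE k : k ^ 2 + 1 = k * 2 + d k.
  by rewrite dD; case: k => [|k] //; rewrite subSS subn0; clear; nia.
have sum_d : 9 * (30 - p y) + 99 = 252 + \sum_z d (cnt y z).
  have : \sum_z (cnt y z ^ 2 + 1) = \sum_z (cnt y z * 2 + d (cnt y z)).
    by apply: eq_bigr => z _; apply: dE.
  by rewrite !big_split /= -big_distrl /= sum_cnt sum_cnt_sq sum1_card card_vertices.
have own : \sum_(z in orb y) d (cnt y z) = 9 * d (p y).
  rewrite -(card_orb y) -sum_nat_const; apply: eq_bigr => z /orbP[w wW ->].
  by rewrite cnt_Wr // -card_S.
move: sum_d; rewrite (bigID (mem (orb y))) /= own => sum_d.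
(* The total 117 - 9p bounds 9 (p - 1)^2, so p is at most 4, and p = 4 leaves nothing for the other
   orbits. *)
have p4 : p y <= 4.
  by move: sum_d; rewrite dD; move: (bigop _ _ _) (p y) => a b; clear; nia.
split=> // py z zy; move: sum_d; rewrite py => sum_d.
have : \sum_(z | z \notin orb y) d (cnt y z) = 0.
  by move: sum_d; move: (bigop _ _ _) => a; rewrite dD; clear; lia.
move/eqP; rewrite sum_nat_eq0 => /forall_inP/(_ z zy); rewrite dD.
by move: (cnt y z) => k; clear; nia.
Qed.

(** Being divisible by 9, congruent to 4 modulo 7 and at most 99, the number is 18 or 81, and its
    parity decides. *)
Let card_shifted_W w : w \in W -> w != 1%g -> #|shifted_adj w| = 18 + 63 * (w \in S x).
Proof.
move=> wW w1; have wG := subsetP WG w wW.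
have F0 : fixpts w = set0.
  apply/setP => y; rewrite in_set in_set0; apply/negP => /eqP/(free wW) w1'.
  by rewrite w1' eqxx in w1.
have := trace_mod7 wG; rewrite F0 cards0 => tr.
have d9 : 9 %| #|shifted_adj w|.
  rewrite -oW; apply: dvdn_card_free => h y hW; last by move=> _; apply: free.
  by rewrite !inE -permM (Wc hW wW) permM WadjE.
have := odd_shifted_adj tG ot tx wG (Wt wW); rewrite in_S wW /=.
have le : #|shifted_adj w| <= 99 by rewrite -card_vertices; apply: max_card.
by move: #|_| (e x _) tr d9 le => a b; clear => tr d9 le o; case: b o; lia.
Qed.

Let sum_p : \sum_y p y = 144 + 63 * p x.
Proof.
have -> : \sum_y p y = \sum_(w in W) #|shifted_adj w|.
  have -> : \sum_y p y = \sum_y \sum_(w in W) (e y (w y) : nat).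
    by apply: eq_bigr => y _; rewrite /p card_S cntE.
  rewrite exchange_big; apply: eq_bigr => w _ /=; rewrite -sum1_card [RHS]big_mkcond.
  by apply: eq_bigr => y _; rewrite inE; case: (e _ _).
rewrite (bigD1 1%g) //= (_ : #|shifted_adj 1| = 0) ?add0n; last first.
  by apply: eq_card0 => y; rewrite inE perm1 e_irr.
rewrite (eq_bigr (fun w => 18 + 63 * (w \in S x))); last first.
  by move=> w /andP[wW w1]; apply: card_shifted_W.
rewrite big_split /= -big_distrr /=; congr (_ + _ * _).
  rewrite sum_nat_const; have -> : #|[pred w in W | w != 1%g]| = 8; last by [].
  have := cardsD1 1%g W; rewrite group1 oW -[9]/(1 + 8) => /addnI->.
  by apply: eq_card => w; rewrite !inE andbC.
rewrite /p -sum1_card big_mkcond [RHS]big_mkcond; apply: eq_bigr => w _; rewrite in_S.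
by have [-> | w1] := eqVneq w 1%g; [rewrite perm1 e_irr !andbF | rewrite andbT; case: (w \in W); case: (e _ _)].
Qed.

(* The permutations t w with w in W are the conjugates of t under W, and their
   fixed points form orb x. *)
Let cnt_t y : cnt y (t y) = cnt y x.
Proof.
have W10 w : w \in W -> (w ^+ 5 * w ^+ 5 = w)%g.
  by move=> wW; rewrite -expgD -[(5 + 5)%N]/(9 + 1)%N expgD W9 // mul1g.
(* Squaring is bijective on W with inverse w ^+ 5. For w = u^2 the conjugate t ^ u maps y to w (t y)
   and has the fixed vertex u x. *)
rewrite !cntE (reindex_onto (fun u : {perm T} => u * u)%g (fun w : {perm T} => w ^+ 5)%g) /=; last exact: W10.
have PW (u : {perm T}) : ((u * u)%g \in W) && (((u * u) ^+ 5)%g == u) = (u \in W).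
  apply/andP/idP => [[uuW /eqP <-] | uW]; first exact: groupX.
  by rewrite groupM // expgMn // W10.
apply: eq_big => [u|u]; first exact: PW.
rewrite PW => uW; have uG := subsetP WG u uW.
have dG : (t ^ u)%g \in G by rewrite groupJ.
have od : #[t ^ u]%g = 2 by rewrite orderJ.
have dE z : (t ^ u)%g z = (u * u)%g (t z).
  by rewrite /conjg !permM tW ?groupV // invgK.
have dx : (t ^ u)%g (u x) = u x by rewrite /conjg !permM permK tx.
rewrite -dE; congr nat_of_bool; apply/idP/idP => [ey | exy].
  by rewrite e_sym; apply: (order2_shifted dG od dx).
by apply: (order2_flip dG od dx); rewrite e_sym.
Qed.

Let D : {group {perm T}} := (W <*> <[t]>)%G.

Let DE : D :=: (W * <[t]>)%g.
Proof.
rewrite /= norm_joinEr // cycle_subG inE; apply/subsetP => _ /imsetP[w wW ->].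
by rewrite Wt ?groupV.
Qed.

Let DG : D \subset G.
Proof. by rewrite DE mul_subG // cycle_subG. Qed.

Let oD : #|D| = 18.
Proof. by rewrite DE coprime_cardMg -?orderE oW ot. Qed.

Let D_elt d : d \in D -> exists2 w, w \in W & d = w \/ forall y, d y = t (w y).
Proof.
rewrite DE => /mulsgP[w h wW]; rewrite (cycle2g ot) !inE => /orP[]/eqP-> ->; exists w => //.
  by left; rewrite mulg1.
by right=> y; rewrite permM.
Qed.

Let WD w : w \in W -> w \in D.
Proof. by move=> wW; rewrite DE -(mulg1 w) mem_mulg. Qed.

Let tD : t \in D.
Proof. by rewrite DE; have := mem_mulg (group1 W) (cycle_id t); rewrite mul1g. Qed.

Let orbD_x : orbit 'P D x = orb x.
Proof.
apply/setP => y; apply/orbitP/orbP => [[d dD <-] | [w wW ->]]; last first.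
  by exists w; rewrite ?WD.
have [w wW [-> | dE]] := D_elt dD; first by exists w.
by exists (w^-1)%g; rewrite ?groupV // /= /aperm dE tW // tx.
Qed.

Let free_D d y : y \notin orb x -> d \in D -> d y = y -> d = 1%g.
Proof.
move=> yx dD dy; have [w wW [dw | dE]] := D_elt dD.
  by rewrite dw; apply: (@free w y) => //; rewrite -dw.
have [// | d1] := eqVneq d 1%g; case/orbP: yx.
(* The involution d fixes w^4 x because w^-5 = w^4. *)
exists (w ^+ 4)%g; first exact: groupX.
have od : #[d]%g = 2.
  apply: nt_prime_order => //; apply/permP => z.
  by rewrite permX /= !dE tW // t2 permK perm1.
apply: (order2_fix_uniq (subsetP DG d dD) od) => //.
rewrite dE -(permM (w ^+ 4) w) -expgSr tW ?groupX // tx.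
suff -> : (w ^- 5 = w ^+ 4)%g by [].
by apply/eqP; rewrite eq_invg_mul -expgD W9.
Qed.

(* Normalized by t, the group W has orbits of D = W <t> of sizes 9, 18, ..., 18,
   whose quotient matrix only exists when x has four neighbours in its orbit. *)
Let p_x : p x = 4.
Proof.
have [p4 _] := p_le4 x; have := even_S x; rewrite -/(p x).
case: (ltngtP (p x) 4) p4 => // px _ _; exfalso.
pose B := ~: orb x.
have BD d y : d \in D -> y \in B -> d y \in B.
  move=> dD; rewrite !in_setC; have [w wW [->|->]] := D_elt dD; first by rewrite orb_W.
  by rewrite -{2}tx orb_tt orb_W.
have [X [XB pX sX]] := orbit_reps BD.
have cB y : y \in B -> #|orbit 'P D y| = 18.
  by rewrite in_setC => yB; rewrite card_orbit_free ?oD // => h; apply: free_D.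
have sumY (F : T -> nat) : \sum_y F y = \sum_(r <- x :: X) \sum_(y in orbit 'P D r) F y.
  rewrite big_cons -sX orbD_x (bigID (mem (orb x))) /=; congr (_ + _).
  by apply: eq_bigl => y; rewrite in_setC.
have disjY : pairwise (fun y z => z \notin orbit 'P D y) (x :: X).
  by rewrite /= orbD_x pX andbT; apply/allP => y /XB; rewrite in_setC.
have cardX : size X = 5.
  have := sumY (fun=> 1); rewrite sum1_card card_vertices big_cons sum1_card orbD_x card_orb.
  rewrite big_seq (eq_bigr (fun=> 18)) => [|r /XB rB]; last by rewrite sum1_card cB.
  by rewrite -big_seq big_const_seq count_predT iter_addn_0; move: (size X); clear; lia.
have sizes : [seq #|orbit 'P D r| | r <- x :: X] = order18_sizes.
  rewrite /= orbD_x card_orb /order18_sizes; congr (_ :: _).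
  have : {in X, forall r, #|orbit 'P D r| = 18} by move=> r /XB; apply: cB.
  move/eq_in_map->.
  have -> : [seq 18 | _ <- X] = nseq (size X) 18 by elim: (X) => //= ? l ->.
  by rewrite cardX.
pose b i j := deg (nth x (x :: X) i) (orbit 'P D (nth x (x :: X) j)).
have Q : quotient_matrix order18_sizes b.
  by rewrite -sizes; apply: orbit_quotient_matrix.
have := quotient_matrix_refute (m := order18_sizes) (gens := nseq 6 (compositions 14 6))
  (extra := order18_row) (final := xpredT) isT Q erefl.
rewrite order18_refute => H'; suff : ~~ true by [].
apply: H' => // [i i6|i i6].
- have -> : nth [::] (nseq 6 (compositions 14 6)) i = compositions 14 6 by rewrite nth_nseq i6.
  have := mem_compositions (mkseq (b i) 6); rewrite size_mkseq.
  suff -> : sumn (mkseq (b i) 6) = 14 by [].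
  have [Q1 _ _] := Q; rewrite -(Q1 i i6) sumnE big_map -(big_mkord xpredT) /index_iota.
  by [].
have bi0 : b i 0 = cnt (nth x (x :: X) i) x by rewrite /b /= orbD_x.
case: i i6 bi0 => [|i] i6 bi0; first by rewrite /order18_row nth_mkseq // bi0 -card_S.
have yB : nth x (x :: X) i.+1 \in B by apply: XB; rewrite /= mem_nth // cardX.
set y := nth x (x :: X) i.+1 in bi0 yB; have yx : y \notin orb x by rewrite -in_setC.
have bii : b i.+1 i.+1 = p y + b i.+1 0.
  rewrite bi0 -cnt_t /p card_S /b -/y /cnt /deg.
  have EO : orbit 'P D y = orb y :|: orb (t y).
    apply/setP => z; rewrite in_setU; apply/orbitP/orP => [[d dD <-] | [] /orbP[w wW ->]].
    - have [w wW [-> | dE]] := D_elt dD; first by left; apply/orbP; exists w.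
      right; apply/orbP; exists (w^-1)%g; first by rewrite groupV.
      by rewrite /= /aperm dE tW.
    - by exists w; rewrite ?WD.
    exists (t * w)%g; first exact: (groupM tD (WD wW)).
    by rewrite /= /aperm permM.
  have dis : (N y :&: orb y) :&: (N y :&: orb (t y)) = set0.
    apply/setP => z; rewrite !in_setI in_set0; apply/negP => /andP[/andP[_ zy] /andP[_ zty]].
    have zy' : y \in orb z by rewrite orb_sym.
    by have := orb_t yx; rewrite orb_sym (orb_trans zy' zty).
  by rewrite EO setIUr cardsU dis cards0 subn0.
rewrite /order18_row !nth_mkseq // bii leq_addl addnK andTb.
have [py4 py4E] := p_le4 y; have := even_S y; rewrite -/(p y) => evp.
apply/andP; split; first by move: py4 evp; case: (p y) => [|[|[|[|[|]]]]].
by apply/implyP => /eqP py; rewrite bi0 py4E // orb_sym.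
Qed.

(** The sum 144 + 63 * 4 equals 99 * 4, the maximum allowed by [p_le4]. *)
Let p4 y : p y = 4.
Proof.
have H : \sum_y (4 - p y) + \sum_y p y = 99 * 4.
  rewrite -big_split /= (eq_bigr (fun=> 4)) => [|z _]; last by rewrite subnK //; case: (p_le4 z).
  by rewrite sum_nat_const card_vertices.
move: H; rewrite sum_p p_x -[99 * 4]add0n => /addIn/eqP.
rewrite sum_nat_eq0 => /forallP/(_ y); rewrite implyTb subn_eq0 => le4.
by apply/eqP; rewrite eqn_leq le4 (p_le4 y).1.
Qed.

Let cnt1 y z : z \notin orb y -> cnt y z = 1.
Proof. exact: (p_le4 y).2. Qed.

Let adj1 y z : z \notin orb y -> exists2 w, w \in W & e y (w z).
Proof.
move/cnt1/eqP/cards1P => [u Nu].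
have : u \in N y :&: orb z by rewrite Nu set11.
by rewrite in_setI in_nbrs => /andP[yu /orbP[w wW uE]]; exists w; rewrite -?uE.
Qed.

Let S_inv y w : (w^-1 \in S y)%g = (w \in S y).
Proof.
rewrite !in_S groupV; apply: andb_id2l => wW.
by rewrite -(WadjE y _ wW) permKV e_sym.
Qed.

Let S1 y : 1%g \notin S y.
Proof. by rewrite in_S perm1 e_irr andbF. Qed.

(** By [inverted_adj] the cubes of the four elements of [S x] fix x and hence are 1. Together with 1
    these are five elements in the subgroup of elements with trivial cube, which must be W. *)
Let cube w : w \in W -> (w ^+ 3 = 1)%g.
Proof.
have cS a : a \in S x -> (a ^+ 3 = 1)%g.
  rewrite in_S => /andP[uW xu].
  apply: (@free _ x); first exact: groupX.
  by apply: (inverted_adj tG ot tx) => //; [apply: (subsetP WG) | apply: Wt].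
have gK : group_set [set a in W | a ^+ 3 == 1]%g.
  apply/group_setP; split=> [|a b]; first by rewrite inE group1 expg1n eqxx.
  rewrite !inE => /andP[uW /eqP u3] /andP[vW /eqP v3].
  by rewrite groupM // expgMn ?u3 ?v3 ?mulg1 ?eqxx //; apply: Wc.
pose K := Group gK.
have KW : K \subset W by apply/subsetP => a; rewrite inE => /andP[].
have : 5 <= #|K|.
  have -> : 5 = #|1%g |: S x| by rewrite cardsU1 S1 [#|S x|]p4.
  apply/subset_leq_card/subsetP => a; rewrite in_setU1 => /predU1P[-> | uS]; first exact: group1.
  by rewrite inE cS // eqxx andbT; move: uS; rewrite in_S => /andP[].
have := cardSg KW; rewrite oW (dvdn_divisors _ (isT : 0 < 9)).
rewrite -[divisors 9]/[:: 1; 3; 9] !in_cons in_nil orbF => /or3P[]/eqP cK; rewrite cK // => _.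
move=> wW; have /eqP KWE : K :==: W by rewrite eqEcard KW cK oW.
by move: wW; rewrite -KWE inE => /andP[_ /eqP].
Qed.

Let neqV w : w \in W -> w != 1%g -> w != (w^-1)%g.
Proof.
move=> wW; apply: contra => /eqP wV; apply/eqP/W2 => //.
by rewrite expgS expg1 {2}wV mulgV.
Qed.

Let Good := [set y | S y == S x].

(** [S x] consists of some a, b and their inverses. At most 18 + 18 vertices y have a or b missing
    from [S y]; for all others [S y] has the same four elements. *)
Let card_Good : 63 <= #|Good|.
Proof.
have four a b : a \in W -> b \in W -> a != 1%g -> b != 1%g -> b != a -> b != (a^-1)%g ->
    uniq [:: a; a^-1; b; b^-1]%g.
  move=> aW bW a1 b1 ba ba'; have aVb : (a^-1)%g != b by rewrite eq_sym.
  have abV : a != (b^-1)%g by rewrite -(inj_eq invg_inj) invgK.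
  have aVbV : (a^-1)%g != (b^-1)%g by rewrite (inj_eq invg_inj) eq_sym.
  by rewrite /= !in_cons !in_nil !orbF !negb_or !neqV // [a == b]eq_sym ba abV aVb aVbV.
have SW a : a \in S x -> a \in W by rewrite in_S => /andP[].
have S_neq1 a : a \in S x -> a != 1%g by apply: contraTneq => ->.
have [a uS] : exists a, a \in S x by apply/card_gt0P; rewrite [#|S x|]p4.
have [b] : exists b, b \in S x :\: [set a; a^-1]%g.
  apply/card_gt0P; have := cardsID [set a; a^-1]%g (S x); rewrite [#|S x|]p4.
  have := subset_leq_card (subsetIr (S x) [set a; a^-1]%g).
  have := cards2 a (a^-1)%g; case: (_ != _) => ->;
    by move: #|_ :&: _| #|_ :\: _| => m n; clear; lia.
rewrite in_setD in_set2 negb_or => /andP[/andP[ba ba'] bS].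
have sh w : w \in S x -> #|~: shifted_adj w| = 18.
  move=> wS; have := cardsC (shifted_adj w).
  by rewrite card_vertices card_shifted_W ?SW ?S_neq1 // wS => /(@addnI 81 _ 18).
have : ~: Good \subset ~: shifted_adj a :|: ~: shifted_adj b.
  rewrite -setCI setCS; apply/subsetP => y; rewrite in_setI => /andP[].
  rewrite /shifted_adj /Good !in_set => yu yv.
  have sub z : a \in S z -> b \in S z -> [set w in [:: a; a^-1; b; b^-1]%g] = S z.
    move=> az bz; apply/eqP; rewrite eqEcard.
    have -> : #|[set w in [:: a; a^-1; b; b^-1]%g]| = 4.
      by rewrite cardsE; apply/card_uniqP; rewrite four ?SW ?S_neq1.
    rewrite [#|S z|]p4 andbT; apply/subsetP => w.
    by rewrite in_set !in_cons in_nil orbF => /or4P[]/eqP->; rewrite ?S_inv.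
  by rewrite -(sub y) ?(sub x) // in_S ?yu ?yv SW.
move/subset_leq_card/leq_trans/(_ (leq_card_setU _ _).1); rewrite !sh //.
have := cardsC Good; rewrite card_vertices.
by move: #|Good| #|~: Good| => m n; clear; lia.
Qed.

Let fine y z a b : e x y -> e x z -> y \notin orb x -> z \notin orb x ->
  S y = S x -> z \notin orb y -> z \notin orb (t y) ->
  a \in W -> b \in W -> e y (a z) -> e y (b (t z)) -> a != 1%g /\ a = b.
Proof.
move=> xy xz yx zx Sy zy zty aW bW ya yb.
have xty : e x (t y) by rewrite -{1}tx aut_adj.
have xtz : e x (t z) by rewrite -{1}tx aut_adj.
have yty : e y (t y) by apply: (order2_flip tG ot tx).
have neW w u v : w \in W -> v \notin orb u -> u != w v.
  by move=> wW; apply: contraNneq => ->; rewrite orb_sym orb_W ?orbit_refl.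
have tzy : t z \notin orb y by rewrite -(t2 y) orb_tt.
have tzx : t z \notin orb x by rewrite -tx orb_tt.
have a1 : a != 1%g.
  apply: contraNneq zty => aE; rewrite aE perm1 in ya.
  by rewrite (triangle_uniq xy xz ya xty yty) orbit_refl.
have b1 : b != 1%g.
  apply: contraNneq zy => bE; rewrite bE perm1 in yb.
  by rewrite -(perm_inj (triangle_uniq xy xtz yb xty yty)) orbit_refl.
have aS : a \notin S x.
  apply/negP => aS; apply: (@common_le2 y (a x) x (a y) (a z)); first (by apply: neW => //; rewrite orb_sym).
  - rewrite /= !in_cons !in_nil !orbF negb_or (neW a x y) ?(neW a x z) //= (inj_eq perm_inj) andbT.
    by apply: contraNneq zy => ->; apply: orbit_refl.
  move: (aS); rewrite in_S => /andP[_ xax]; rewrite -Sy in_S in aS; case/andP: aS => _ yay.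
  by rewrite /= e_sym xy e_sym xax yay ya !WadjE // xy xz.
have bS : b \notin S x.
  apply/negP => bS; apply: (@common_le2 y (b x) x (b y) (b (t z))); first (by apply: neW => //; rewrite orb_sym).
  - rewrite /= !in_cons !in_nil !orbF negb_or (neW b x y) ?(neW b x (t z)) //= (inj_eq perm_inj) andbT.
    by apply: contraNneq zty => ->; rewrite t2 orbit_refl.
  move: (bS); rewrite in_S => /andP[_ xbx]; rewrite -Sy in_S in bS; case/andP: bS => _ yby.
  by rewrite /= e_sym xy e_sym xbx yby yb !WadjE // xy xtz.
pose c := (a * b)%g; have cW : c \in W by apply: groupM.
have cE u : c u = a (b u) by rewrite /c Wc // permM.
have cE' u : c u = b (a u) by rewrite /c permM.
have cya : e (c (t y)) (a z).
  by rewrite cE WadjE // -(aut_adj _ _ tG) tW // t2 -(WadjE _ _ bW) -permM mulVg perm1.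
have cyb : e (c (t y)) (b (t z)).
  by rewrite cE' WadjE // -(aut_adj _ _ tG) t2 tW // t2 -(WadjE _ _ aW) -permM mulVg perm1.
have ab_z : a z != b (t z).
  rewrite -(inj_eq (@perm_inj _ (b^-1)%g)) permK -permM; apply/negP => /eqP ztz.
  by have := orb_t zx; rewrite -ztz orb_W ?orbit_refl // groupM ?groupV.
have c1 : c != 1%g.
  apply/negP => /eqP c1; move: cya cyb; rewrite c1 perm1 => tya tyb.
  by have := triangle_uniq yty ya tya yb tyb => /eqP; rewrite (negPf ab_z).
have cS : c \notin S x.
  apply/negP; rewrite -Sy in_S cW /= => yc.
  apply: (@common_le2 y (c (t y)) (c y) (a z) (b (t z))).
  - by apply: neW; rewrite ?orb_t // -tx orb_tt.
  - have neW' w u v : w \in W -> v \notin orb u -> c u != w v.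
      by move=> wW vu; apply: neW => //; rewrite orb_sym orb_W // orb_sym.
    by rewrite /= !in_cons !in_nil !orbF negb_or ab_z !neW'.
  by rewrite /= yc ya yb cya cyb WadjE // e_sym yty.
split=> //; apply/eqP/negPn/negP => ab.
pose R := W :\: (1%g |: S x).
have cR : #|R| = 4.
  have SW : 1%g |: S x \subset W.
    by apply/subsetP => w; rewrite in_setU1 in_S => /predU1P[->|/andP[] //].
  by rewrite /R cardsD (setIidPr SW) oW cardsU1 S1 [#|S x|]p4.
have RE w : w \in W -> w != 1%g -> w \notin S x -> w \in R.
  by move=> wW w1 wS; rewrite in_setD in_setU1 negb_or w1 wS wW.
have RV w : w \in W -> w != 1%g -> w \notin S x -> (w^-1)%g \in R.
  by move=> wW w1 wS; apply: RE; rewrite ?groupV ?invg_eq1 ?S_inv.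
have sq w : w \in W -> (w * w)%g = (w^-1)%g.
  by move=> wW; apply/eqP; rewrite eq_sym eq_invg_mul; have := cube wW; rewrite !expgS expg0 mulg1 => ->.
have : uniq [:: a; a^-1; b; b^-1; c]%g.
  have aVb : (a^-1)%g != b by rewrite eq_invg_mul.
  have abV : a != (b^-1)%g by rewrite -(inj_eq invg_inj) invgK.
  have aVbV : (a^-1)%g != (b^-1)%g by rewrite (inj_eq invg_inj).
  have ac : a != c by rewrite -{1}(mulg1 a) (inj_eq (mulgI a)) eq_sym.
  have bc : b != c by rewrite -{1}(mul1g b) (inj_eq (mulIg b)) eq_sym.
  have aVc : (a^-1)%g != c by rewrite -sq // (inj_eq (mulgI a)).
  have bVc : (b^-1)%g != c by rewrite -sq // (inj_eq (mulIg b)) eq_sym.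
  by rewrite /= !in_cons !in_nil !orbF !negb_or !neqV // ab abV aVb aVbV ac bc aVc bVc.
move/card_uniqP => c5; have : 5 <= 4.
  rewrite -[5]c5 -cR; apply/subset_leq_card/subsetP => w.
  by rewrite !in_cons in_nil orbF => /or4P[/eqP->|/eqP->|/eqP->|/orP[]/eqP->]; auto.
by [].
Qed.

(** Exchanging y and z in [fine] turns a = b into a^-1 = b, but W has no involution. The bound 54
    leaves room to avoid the orbits of x, y and t y. *)
Lemma no_order18_inverted : False.
Proof.
have big (A : {set T}) : #|A| <= 54 -> exists2 y, y \in Good & y \notin A.
  move=> A54; have : 0 < #|Good :\: A|.
    have := cardsID A Good; have := subset_leq_card (subsetIr Good A); have := card_Good.
    by lia.
  by case/card_gt0P => y; rewrite in_setD => /andP[yA yG]; exists y.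
have GoodW w y : w \in W -> (w y \in Good) = (y \in Good).
  by move=> wW; rewrite /Good !in_set S_W.
have [y [yG yx xy]] : exists y, [/\ y \in Good, y \notin orb x & e x y].
  have [y yG yx] : exists2 y, y \in Good & y \notin orb x by apply: big; rewrite card_orb.
  by have [w wW xy] := adj1 yx; exists (w y); rewrite GoodW // orb_W.
have [z [zG /and3P[zx zy zty] xz]] : exists z,
    [/\ z \in Good, [&& z \notin orb x, z \notin orb y & z \notin orb (t y)] & e x z].
  have [z zG] : exists2 z, z \in Good & z \notin orb x :|: (orb y :|: orb (t y)).
    apply: big; have := (leq_card_setU (orb x) (orb y :|: orb (t y))).1.
    have := (leq_card_setU (orb y) (orb (t y))).1; rewrite !card_orb.
    by move: #|_ :|: (_ :|: _)| #|_ :|: _| => m n; clear; lia.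
  rewrite !in_setU !negb_or => /and3P[zx zy zty].
  by have [w wW xz] := adj1 zx; exists (w z); rewrite GoodW // !orb_W // zx zy zty.
have [a aW ya] := adj1 zy.
have [b bW yb] : exists2 b, b \in W & e y (b (t z)).
  by apply: adj1; rewrite -(t2 y) orb_tt.
move: yG zG; rewrite /Good !in_set => /eqP yG /eqP zG.
have [a1 ab] := fine xy xz yx zx yG zy zty aW bW ya yb.
have [_ Vab] : (a^-1 != 1)%g /\ (a^-1 = b)%g.
  apply: (fine xz xy zx yx zG) => //; rewrite ?groupV //.
  - by rewrite orb_sym.
  - by rewrite -(t2 y) orb_tt orb_sym.
  - by rewrite -(WadjE _ _ aW) -permM mulVg perm1 e_sym.
  by rewrite e_sym -(aut_adj _ _ tG) tW // t2 -(WadjE _ _ bW) -permM mulVg perm1.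
by have := neqV aW a1; rewrite Vab ab eqxx.
Qed.

End InvertedOrder9.

(** * The full automorphism group *)

Lemma cycle_order_elt (g : {perm T}) p : prime p -> p.-elt g -> g != 1%g ->
  exists2 h, h \in <[g]>%g & #[h]%g = p.
Proof.
move=> pp pg g1; have ntg : (<[g]> != 1)%g by rewrite cycle_eq1.
have [_ dp _] := pgroup_pdiv (pg : p.-group <[g]>%g) ntg.
by have [h hg oh] := Cauchy pp dp; exists h.
Qed.

Lemma prime_card_Sylow p (P : {group {perm T}}) : prime p -> p.-Sylow(G) P ->
  p %| #|G| -> #|P| %| p -> #|P| = p.
Proof.
move=> pp sylP dp Pp; apply/eqP; rewrite eqn_dvd Pp (card_Hall sylP) p_part.
by rewrite dvdn_exp // logn_gt0 mem_primes pp cardG_gt0.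
Qed.

Lemma pgroup_card_free p (P : {group {perm T}}) X : prime p -> p.-group P -> P \subset G ->
    (forall h y, h \in P -> y \in X -> h y \in X) ->
    (forall h y, h \in P -> #[h]%g = p -> y \in X -> h y <> y) ->
  #|P| %| #|X|.
Proof.
move=> pp pP PG PX free; apply: dvdn_card_free => // h y hP yX hy.
apply/eqP/negPn/negP => h1; have [k kh ok] := cycle_order_elt pp (mem_p_elt pP hP) h1.
apply: (free k y) => //; last exact: cycle_fix hy kh.
by apply: (subsetP _ k kh); rewrite cycle_subG.
Qed.

Lemma card_11group (P : {group {perm T}}) : 11.-group P -> P \subset G -> #|P| %| 11.
Proof.
move=> pP PG; have : #|P| %| #|[set: T]|.
  apply: (pgroup_card_free _ pP PG) => // h y hP oh _.
  by apply/eqP/order11_free => //; apply: (subsetP PG).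
by case/p_natP: pP => k ->; rewrite cardsT card_vertices -[99]/(9 * 11)%N Gauss_dvdr // coprimeXl.
Qed.

(** As 99 is 1 modulo 7, P fixes a vertex x. Elements of order 7 fix nothing else, so P acts freely
    on the 14 neighbours of x. *)
Lemma card_7group (P : {group {perm T}}) : 7.-group P -> P \subset G -> #|P| %| 7.
Proof.
move=> pP PG; have [x xF] : exists x, x \in 'Fix_'P(P)%act.
  have aP : [acts P, on [set: T] | 'P] by apply/acts_permP => h y _ _; rewrite inE.
  have := pgroup_fix_mod pP aP; rewrite cardsT card_vertices setTI => F.
  by apply/card_gt0P; move: F; case: #|_|.
have Px h : h \in P -> h x = x by move=> hP; apply: (afixP xF).
have : #|P| %| #|N x|.
  apply: (pgroup_card_free _ pP PG) => // [h y hP | h y hP oh yN hy].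
    by rewrite !in_nbrs -{2}(Px h hP) aut_adj // (subsetP PG).
  have [z Fz] := order7_fix (subsetP PG h hP) oh.
  have /set1P yz : y \in [set z] by rewrite -Fz in_set hy.
  have /set1P xz : x \in [set z] by rewrite -Fz in_set Px.
  by move: yN; rewrite yz xz in_nbrs e_irr.
by case/p_natP: pP => k ->; rewrite card_nbrs -[14]/(2 * 7)%N Gauss_dvdr // coprimeXl.
Qed.

Lemma dvdn7_no_involution : 2 %| #|G| -> 7 %| #|G| -> False.
Proof.
move=> d2 d7; have [t tG ot] := Cauchy (isT : prime 2) d2.
have [P sylP [s [sG os sP]]] := normalizing_involution tG (order2_odd_perm tG ot) (isT : prime 7) isT.
have [PG pP _] := and3P sylP.
have oP := prime_card_Sylow (isT : prime 7) sylP d7 (card_7group pP PG).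
have [g gP og] := Cauchy (isT : prime 7) (eq_ind_r (dvdn 7) (dvdnn 7) oP).
have gG := subsetP PG g gP; have PE : P :=: <[g]>%g.
  by apply/eqP; rewrite eq_sym eqEcard cycle_subG gP oP -orderE og.
have [x Fx] := order7_fix gG og.
have sx : s x = x.
  have /(cycle_fix (fixpts1_fix Fx)) : (g ^ s^-1)%g \in <[g]>%g by rewrite -PE memJ_norm ?groupV.
  rewrite /conjg invgK !permM => /(canRL (permK s^-1)%g); rewrite invgK => gsx.
  by apply/set1P; rewrite -Fx in_set gsx.
by apply: (no_order14 gG sG og os); apply/commute_sym/(order2_central sG gG os sx)/fixpts1_fix.
Qed.

Lemma dvdn11_no_involution : 2 %| #|G| -> 11 %| #|G| -> False.
Proof.
move=> d2 d11; have [t tG ot] := Cauchy (isT : prime 2) d2.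
have [P sylP [s [sG os sP]]] := normalizing_involution tG (order2_odd_perm tG ot) (isT : prime 11) isT.
have [PG pP _] := and3P sylP.
have oP := prime_card_Sylow (isT : prime 11) sylP d11 (card_11group pP PG).
have [g gP og] := Cauchy (isT : prime 11) (eq_ind_r (dvdn 11) (dvdnn 11) oP).
have PE : P :=: <[g]>%g.
  by apply/eqP; rewrite eq_sym eqEcard cycle_subG gP oP -orderE og.
by apply: (no_order11_normalized (subsetP PG g gP) sG og os); rewrite -PE.
Qed.

(** Since t fixes w * w ^ t for every w in W, either t centralizes a nontrivial element of W or it
    inverts W. *)
Lemma order9_no_involution (W : {group {perm T}}) t : W \subset G -> #|W| = 9 ->
  t \in G -> #[t]%g = 2 -> t \in 'N(W) -> False.
Proof.
move=> WG oW tG ot tW; have [x Fx] := order2_fix tG ot; have tx := fixpts1_fix Fx.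
have abW : abelian W by apply: (@card_p2group_abelian _ 3).
have tt (g : {perm T}) : ((g ^ t) ^ t = g)%g.
  by rewrite -conjgM -[(t * t)%g]/(t ^+ 2)%g -ot expg_order conjg1.
have tWJ (g : {perm T}) : g \in W -> (g ^ t)%g \in W by rewrite memJ_norm.
have cW (g h : {perm T}) : g \in W -> h \in W -> commute g h by move=> gW hW; apply: (centsP abW).
have fx (g : {perm T}) : g \in W -> (g ^ t)%g = g -> g x = x.
  move=> gW gt; have ctg : commute t g by apply/commute_sym/commgP/conjg_fixP.
  by apply/set1P; rewrite -Fx in_set -permM -ctg permM tx.
have [[w [wW w1 wt]] | inv] : (exists w, [/\ w \in W, w != 1%g & (w ^ t)%g = w]) \/
    (forall w, w \in W -> (w ^ t)%g = w^-1)%g.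
  have [/existsP[w /and3P[wW w1 /eqP wt]] | /existsPn none] :=
      boolP [exists w, [&& w \in W, w != 1 & w ^ t == w]]%g; first by left; exists w.
  right=> w wW; apply/eqP; rewrite eq_sym eq_invg_mul.
  have := none (w * w ^ t)%g; rewrite groupM ?tWJ //= conjMg tt -cW ?tWJ // eqxx andbT.
  by rewrite negbK.
2: by apply: (no_order18_inverted WG oW tG ot tx).
pose Q := 'C_W[x | 'P]%G.
have Qx h : h \in Q -> h x = x by case/setIP=> _ /astab1P.
have QP h : h \in W -> h x = x -> h \in Q by move=> hW hx; rewrite in_setI hW; apply/astab1P.
have QW : Q \subset W := subsetIl _ _.
have oQ : #|Q| %| 3.
  by apply: card_3group_fix Qx; [apply: subset_trans WG | apply: pgroupS QW _; rewrite /pgroup oW].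
have wQ := QP w wW (fx w wW wt).
have ow : #[w]%g = 3.
  apply/prime_nt_dvdP => //; first by rewrite order_eq1.
  exact: dvdn_trans (order_dvdG wQ) oQ.
have QE : Q :=: <[w]>%g.
  by apply/eqP; rewrite eq_sym eqEcard cycle_subG wQ -orderE ow dvdn_leq.
have [u uW uw] : exists2 u, u \in W & u \notin <[w]>%g.
  apply/subsetPn; apply/negP => /subset_leq_card; by rewrite oW -orderE ow.
(* A commutator with t is inverted by t. It is nontrivial, since otherwise u would commute with t,
   fix x and lie in <w>; its order is not 9, since then t would also invert w. *)
pose v := (u^-1 * u ^ t)%g.
have vW : v \in W by rewrite groupM ?groupV ?tWJ.
have vt : (v ^ t = v^-1)%g by rewrite /v conjMg (conjVg u) (tt u) (invMg u^-1) invgK.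
have v1 : v != 1%g.
  apply: contra uw; rewrite -eq_mulVg1 => /eqP ut.
  by rewrite -QE QP // fx.
have fix_inv (g : {perm T}) : g \in W -> (g ^ t)%g = g -> (g ^ t)%g = (g^-1)%g -> g = 1%g.
  move=> gW gt gV; apply/eqP; rewrite -order_eq1 -dvdn1 -[1%N]/(gcdn 2 9) dvdn_gcd.
  by rewrite order_dvdn expgS expg1 -{2}gt gV mulgV eqxx -oW order_dvdG.
have vnw : v \notin <[w]>%g.
  by apply: contra v1 => /cycleP[k vE]; apply/eqP/fix_inv; rewrite // vE conjXg wt.
have ov : #[v]%g = 3.
  have := order_dvdG vW; rewrite oW (dvdn_divisors _ (isT : 0 < 9)) -[divisors 9]/[:: 1; 3; 9].
  rewrite !in_cons in_nil orbF order_eq1 (negPf v1) /= => /orP[]/eqP // ov.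
  have WE : W :=: <[v]>%g by apply/eqP; rewrite eq_sym eqEcard cycle_subG vW oW -orderE ov.
  case/eqP: w1; apply: fix_inv => //.
  by have := wW; rewrite WE => /cycleP[k ->]; rewrite conjXg vt expgVn.
apply: (no_order18_mixed WG oW abW tG ot wW vW ow ov _ vt vnw).
by apply/commgP/conjg_fixP.
Qed.

Lemma dvdn9_no_involution : 2 %| #|G| -> 9 %| #|G| -> False.
Proof.
move=> d2 d9; have [t tG ot] := Cauchy (isT : prime 2) d2.
have [P sylP [s [sG os sP]]] := normalizing_involution tG (order2_odd_perm tG ot) (isT : prime 3) isT.
have [PG pP _] := and3P sylP.
have d9P : 9 %| #|P|.
  rewrite (card_Hall sylP) p_part (@dvdn_exp2l 3 2) //.
  by rewrite -pfactor_dvdn.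
have [W [WP oW sW]] : exists W : {group {perm T}}, [/\ W \subset P, #|W| = 9 & s \in 'N(W)].
  by apply: invariant_order9 => //; rewrite -os expg_order.
exact: order9_no_involution (subset_trans WP PG) oW sG os sW.
Qed.

Lemma even_card_dvdn6 : 2 %| #|G| -> #|G| %| 6.
Proof.
move=> d2; apply/dvdn_partP => // p; rewrite mem_primes => /and3P[pp _ dp].
have [g gG og] := Cauchy pp dp.
have part1 n : ~~ (p ^ n.+1 %| #|G|) -> #|G|`_p %| p ^ n.
  by rewrite pfactor_dvdn // p_part -leqNgt => /(dvdn_exp2l p).
have [p2 | odd_p] := even_prime pp.
  by apply: dvdn_trans (part1 1%N _) _; rewrite p2 // not_dvd4.
have [[p3 _] | [p7 _] | [p11 _]] := odd_prime_automorphism gG og pp odd_p.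
- by apply: dvdn_trans (part1 1%N _) _; rewrite p3 //; apply/negP/(dvdn9_no_involution d2).
- by case: (dvdn7_no_involution d2); rewrite -p7.
by case: (dvdn11_no_involution d2); rewrite -p11.
Qed.

Lemma prime_divisors p : prime p -> p %| #|G| -> p \in [:: 2; 3; 7; 11].
Proof.
move=> pp dp; have [g gG og] := Cauchy pp dp.
have [-> // | odd_p] := even_prime pp.
by case: (odd_prime_automorphism gG og pp odd_p) => -[-> _].
Qed.

Lemma card_sylow_dvd (H : {group {perm T}}) (p m : nat) : H \subset G ->
  (forall P : {group {perm T}}, p.-group P -> P \subset H -> #|P| %| m) -> #|H|`_p %| m.
Proof.
move=> HG Hm; have [P sylP] := Sylow_exists p H.
by rewrite -(card_Hall sylP); apply: Hm; [apply: pHall_pgroup sylP | apply: pHall_sub sylP].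
Qed.

(** * Automorphism groups of order divisible by 7 *)

Section Order7.

Variables (s : {perm T}) (x : T).
Hypotheses (sG : s \in G) (os : #[s]%g = 7) (Fx : fixpts s = [set x]).

Let sx : s x = x. Proof. exact: fixpts1_fix Fx. Qed.

Let H := 'C_G[x | 'P]%G.

Let HG : H \subset G. Proof. exact: subsetIl. Qed.

Let HP g : reflect (g \in G /\ g x = x) (g \in H).
Proof.
by apply: (iffP setIP) => -[gG]; [move/astab1P | move=> gx; split=> //; apply/astab1P].
Qed.

Let sH : s \in H. Proof. by apply/HP. Qed.

Let odd_G : ~~ (2 %| #|G|).
Proof. by apply/negP => /dvdn7_no_involution; apply; rewrite -os order_dvdG. Qed.

Let card_H : #|H| %| 21.
Proof.
apply/dvdn_partP => // p; rewrite mem_primes => /and3P[pp _ dp].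
have := prime_divisors pp (dvdn_trans dp (cardSg HG)).
rewrite !in_cons in_nil orbF => /or4P[]/eqP pE; move: dp; rewrite pE => dp.
- by case/negP: odd_G; apply: dvdn_trans dp (cardSg HG).
- apply: (@dvdn_trans 3) => //; apply: card_sylow_dvd => // P pP PH.
  by apply: (card_3group_fix (x := x) (subset_trans PH HG) pP) => h /(subsetP PH)/HP[].
- apply: (@dvdn_trans 7) => //; apply: card_sylow_dvd => // P pP PH.
  exact: card_7group pP (subset_trans PH HG).
have [u uH ou] := Cauchy (isT : prime 11) dp; have /HP[uG ux] := uH.
by have /eqP := order11_free uG ou x; rewrite ux.
Qed.

Let P := <[s]>%G.

Let sub_norm : 'N_G(P) \subset H.
Proof.
apply/subsetP => g /setIP[gG gN]; apply/HP; split=> //.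
have /(cycle_fix sx) : (s ^ g^-1)%g \in <[s]>%g by rewrite memJ_norm ?groupV ?cycle_id.
rewrite /conjg invgK !permM => /(canRL (permK g^-1)%g); rewrite invgK => gsx.
by apply/set1P; rewrite -Fx in_set gsx.
Qed.

Let sylP : 7.-Sylow(G) P.
Proof.
rewrite pHallE cycle_subG sG -orderE os eqn_dvd /=; apply/andP; split.
  rewrite p_part -[X in X %| _](expn1 7) dvdn_exp2l // -pfactor_dvdn // expn1 -os.
  exact: order_dvdG.
by apply: card_sylow_dvd => // Q pQ QG; apply: card_7group.
Qed.

(** The index of the normalizer of P in H divides 3 and is 1 modulo 7. *)
Let norm_H : 'N_G(P) = H.
Proof.
have NE : 'N_G(P) = 'N_H(P) by rewrite -(setIidPr sub_norm) setIA (setIidPl HG).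
apply/eqP; rewrite NE eq_sym -[_ == _]andbT eqEsubset subsetIl andbT -indexg_eq1.
have PH : P \subset H by rewrite cycle_subG.
have := card_Syl_mod H (isT : prime 7); rewrite (card_Syl (pHall_subl PH HG sylP)).
have : 7 * #|H : 'N_H(P)| %| 21.
  apply: dvdn_trans card_H; rewrite -(Lagrange (subsetIl H 'N(P))) dvdn_pmul2r ?indexg_gt0 //.
  by rewrite -os order_dvdG // in_setI sH (subsetP (normG P)) ?cycle_id.
rewrite (@dvdn_pmul2l 7 _ 3) // (dvdn_divisors _ (isT : 0 < 3)) -[divisors 3]/[:: 1; 3].
by rewrite !in_cons in_nil orbF => /orP[]/eqP->.
Qed.

Let index_H : #|G : H| = 1 \/ #|G : H| = 99.
Proof.
have m7 : #|G : H| %% 7 = 1 by rewrite -norm_H -(card_Syl sylP) card_Syl_mod.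
have le99 : #|G : H| <= 99 by rewrite -card_orbit -card_vertices max_card.
have dG : #|G : H| %| #|G| := dvdn_indexg _ _.
have no p : prime p -> p \notin [:: 3; 7; 11] -> ~~ (p %| #|G : H|).
  move=> pp np; apply/negP => dp; have dpG := dvdn_trans dp dG.
  have := prime_divisors pp dpG; rewrite in_cons (negPf np) orbF => /eqP p2.
  by rewrite p2 (negPf odd_G) in dpG.
(* The listed primes cannot divide the index; they eliminate every number up to 99 that is 1 modulo
   7 except 1 and 99, for instance 57 = 3 * 19. *)
have : #|G : H| \in [seq i <- iota 0 100 | (i %% 7 == 1) &&
    all (fun p => ~~ (p %| i)) [:: 2; 5; 19; 29; 43; 71]].
  rewrite mem_filter mem_iota m7 /= ltnS le99 andbT.
  by rewrite !no.
have -> : [seq i <- iota 0 100 | (i %% 7 == 1) &&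
    all (fun p => ~~ (p %| i)) [:: 2; 5; 19; 29; 43; 71]] = [:: 1; 99] by [].
by rewrite !in_cons in_nil orbF => /orP[]/eqP->; [left | right].
Qed.

Let index_neq99 : #|G : H| <> 99.
Proof.
move=> i99; have oG : #|G| = (#|H| * 99)%N by rewrite -i99 Lagrange.
have d11 : 11 %| #|G| by rewrite oG dvdn_mull.
have [Q sylQ nQ] : exists2 Q : {group {perm T}}, 11.-Sylow(G) Q & Q <| G.
  apply/normal_sylowP; have [Q sylQ] := Sylow_exists 11 G; have [QG pQ _] := and3P sylQ.
  have oQ := prime_card_Sylow (isT : prime 11) sylQ d11 (card_11group pQ QG).
  have := card_Syl_mod G (isT : prime 11); rewrite (card_Syl sylQ).
  (* Here |G| divides 21 * 99 = 11 * 189, and 1 is the only divisor of 189 congruent to 1 modulo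
     11. *)
  have : 11 * #|G : 'N_G(Q)| %| 11 * 189.
    apply: (@dvdn_trans #|G|); last by rewrite oG -[(11 * 189)%N]/(21 * 99)%N dvdn_pmul2r // card_H.
    rewrite -(Lagrange (subsetIl G 'N(Q))) dvdn_pmul2r ?indexg_gt0 // -oQ.
    by apply: cardSg; rewrite subsetI QG normG.
  rewrite dvdn_pmul2l // (dvdn_divisors _ (isT : 0 < 189)).
  rewrite -[divisors 189]/[:: 1; 3; 7; 9; 21; 27; 63; 189] !in_cons in_nil orbF.
  by do 7?[case/predU1P => [-> //|]]; move/eqP->.
have [QG pQ _] := and3P sylQ.
have oQ := prime_card_Sylow (isT : prime 11) sylQ d11 (card_11group pQ QG).
have aQ : [acts P, on Q | 'J].
  by rewrite astabsJ (subset_trans _ (normal_norm nQ)) // cycle_subG.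
have pP : 7.-group P by rewrite /pgroup -orderE os.
(* The number of elements of Q centralized by P is congruent to 11, that is to 4, modulo 7, so it is
   not 1. *)
have := pgroup_fix_mod pP aQ; rewrite oQ afixJ => c4.
have [u uC u1] : exists2 u, u \in 'C_Q(P)%g & u != 1%g.
  apply/trivgPn; apply: contra_eqN c4 => /eqP->; by rewrite cards1.
have /setIP[uQ cu] := uC; have uG := subsetP QG u uQ.
have ou : #[u]%g = 11.
  by apply/prime_nt_dvdP; rewrite ?order_eq1 // -oQ order_dvdG.
case/eqP: (order11_free uG ou x); apply/set1P; rewrite -Fx in_set -permM.
by rewrite (centP cu s (cycle_id s)) permM sx.
Qed.

Lemma order7_card : #|G| = 7 \/ #|G| = 21 /\ ~~ abelian G.
Proof.
have [i1 | /index_neq99] := index_H; last by [].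
have GH : G :=: H by apply/eqP; rewrite eq_sym eqEsubset HG -indexg_eq1 i1.
have := card_H; rewrite -GH (dvdn_divisors _ (isT : 0 < 21)) -[divisors 21]/[:: 1; 3; 7; 21].
have d7 : 7 %| #|G| by rewrite -os order_dvdG.
rewrite !in_cons in_nil orbF => /or4P[] /eqP oG; try by rewrite oG in d7.
  by left.
(* In an abelian group s would act on the triangle fixed by an element of order 3, and 7 > 3 forces
   it to fix all three vertices. *)
right; split=> //; apply/negP => abG.
have d3 : 3 %| #|G| by rewrite oG.
have [w wG ow] := Cauchy (isT : prime 3) d3.
have /HP[_ wx] : w \in H by rewrite -GH.
have p7 : 7.-elt s by rewrite /p_elt os.
have sF y : y \in fixpts w -> s y \in fixpts w.
  by rewrite !in_set => /eqP wy; rewrite -permM (centsP abG _ sG _ wG) permM wy.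
have := card_fix_mod p7 sF; rewrite (order3_fix_triangle wG ow wx wx).1.1.
have : #|[set y in fixpts w | s y == y]| <= 1.
  rewrite -(cards1 x) -Fx; apply/subset_leq_card/subsetP => y; rewrite !in_set => /andP[_ sy] //.
by case: #|_| => [|[]].
Qed.

End Order7.

Lemma dvdn7_isog : 7 %| #|G| -> G \isog [set: 'Z_7] \/ G \isog Frob21.
Proof.
move=> d7; have [s sG os] := Cauchy (isT : prime 7) d7.
have [x Fx] := order7_fix sG os.
have [oG | [oG nabG]] := order7_card sG os Fx; [left | right].
  have cG : cyclic G by rewrite prime_cyclic ?oG.
  have oZ : #|[set: 'Z_7]| = 7 by rewrite cardsT card_ord.
  by rewrite (isog_cyclic_card _ cG) oZ oG eqxx prime_cyclic ?oZ.
exact: metacyclic21_isog oG nabG card_Frob21 Frob21_nonabelian.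
Qed.

End ConwayGraph.

Theorem corollary4p4 (T : finType) (e : rel T)
    (srg : strongly_regular e 99 14 1 2) :
  (2 %| #|graph_aut e| -> #|graph_aut e| %| 6) /\
  (7 %| #|graph_aut e| ->
     graph_aut e \isog [set: 'Z_7] \/ graph_aut e \isog Frob21).
Proof. by split; [apply: even_card_dvdn6 | apply: dvdn7_isog]. Qed.
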